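(* Let $m>0$, $M>m$ and $\varepsilon>0$ be real numbers. Then there exists a constant $A(\varepsilon,m,M)$ such that, for all nonnegative integers $n$ and all real $c$ with $m\leq c\leq M\sqrt n$, $$\lambda_n(c)\leq A(\varepsilon,m,M)\, e^{\varepsilon n}\left(\frac{e c}{4(n+\frac12)}\right)^{2n+1}.$$
   Context: For $c>0$, let $\mathcal Q_c$ be the compact integral operator on $L^2([-1,1])$ given by $\mathcal Q_c(f)(x)=\int_{-1}^1\frac{\sin c(x-y)}{\pi(x-y)}f(y)\,dy$. Its eigenvalues are arranged in decreasing order $1>\lambda_0(c)>\lambda_1(c)>\cdots>\lambda_n(c)>\cdots>0$. *)

(* Defs.v *)
From mathcomp Require Import all_boot all_order all_algebra.
From mathcomp Require Import all_classical all_reals all_analysis.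
Import Order.TTheory GRing.Theory Num.Theory.
Import numFieldNormedType.Exports.

Set Implicit Arguments.
Unset Strict Implicit.
Unset Printing Implicit Defensive.

Local Open Scope classical_set_scope.
Local Open Scope ring_scope.

(* Lebesgue measure restricted to [-1, 1]: Lfun mu11 2 consists of
   representatives of L^2([-1, 1]), whose values outside [-1, 1] play no role. *)
Definition mu11 (R : realType) : {measure set (measurableTypeR R) -> \bar R} :=
  mrestr lebesgue_measure (measurable_itv `[(-1 : R), 1]).

(* On the diagonal, x / 0 = 0 in MathComp, so the continuous value c / pi has to
   be given explicitly. *)
Definition sinc_kernel (R : realType) (c x y : R) : R :=
  if x == y then c / pi else sin (c * (x - y)) / (pi * (x - y)).

Definition sinc_op (R : realType) (c : R) (f : R -> R) (x : R) : R :=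
  Rintegral (@lebesgue_measure R) `[(-1 : R), 1]
    (fun y => sinc_kernel c x y * f y).

(* Equality in L^2([-1, 1]) is equality almost everywhere.  Real scalars lose
   nothing: the kernel is real and symmetric, so the complex eigenvalues are real
   and have real eigenfunctions. *)
Definition sinc_eigenvalue (R : realType) (c nu : R) : Prop :=
  exists f : R -> R,
    [/\ f \in Lfun (mu11 R) 2%:E,
        ~ ae_eq (mu11 R) setT f (cst 0)
      & ae_eq (mu11 R) setT (sinc_op c f) (fun x => nu * f x)].

(* For each c > 0 the eigenvalues of sinc_op c are positive and simple and form
   an infinite sequence tending to 0, so exactly one lambda qualifies. *)
Definition sinc_spectrum (R : realType) (c : R) (lambda : nat -> R) : Prop :=
  (forall n, lambda n.+1 < lambda n) /\
  range lambda = [set nu | sinc_eigenvalue c nu].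

(* Main.v *)
Require Import Defs.
From mathcomp Require Import all_boot all_order all_algebra.
From mathcomp Require Import all_classical all_reals all_analysis.
From mathcomp Require Import perm measurable_realfun ring lra zify.
Import Order.TTheory GRing.Theory Num.Theory.
Import numFieldNormedType.Exports.

Set Implicit Arguments.
Unset Strict Implicit.
Unset Printing Implicit Defensive.

Local Open Scope ring_scope.

(** Let H be the integral operator on [-1, 1] with kernel cas(c s x), where
    cas = cos + sin.  Integrating cas(c s x) cas(c s y) over s shows that the
    operator of the theorem is (c / 2 pi) H^2.  The kernel of H is a power
    series in s x with coefficients of absolute value c^m / m!, and
    s^m = 2^-m sum_k b(m, k) T_k(s) in terms of Chebyshev polynomials.  The
    factors 2^-m in s and in x turn c^m / m! into d_m = (c / 4)^m / m!, and
    d_n^2 is the size of the n-th eigenvalue, up to subexponential factors: by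
    n! >= (n / e)^n, (c / 2 pi) d_n^2 is at most n + 1 times the power in the
    theorem ([expw_sqr_le_target]).

    What the expansion bounds directly are determinants.  For two families of
    K linear functionals, one acting on s and one on x, all bounded on the
    Chebyshev polynomials, the Cauchy-Binet formula writes the K x K matrix of
    their values on the kernel as a sum of products of minors; distinct rows
    force distinct Chebyshev indices, so the determinant is at most
    prod_(k < K) d_k times exp (O (K (c + log K))) ([minor_sum_le]).

    To isolate lambda_n, split n + 1 = N + w with w small compared with n.
    The span of the eigenfunctions f_0, ..., f_n contains w independent
    functions e such that H e vanishes at N prescribed points.  Evaluating the
    kernel at these points and at functions H f_i in the variable s, at N
    points and at the functions e in the variable x, gives a block triangular
    matrix whose determinant is that of (cas (c s_j x_b)) times a product of w
    eigenvalues.  Hence lambda_n^(w / 2) times the N x N determinant is at most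
    prod_(k < n + 1) d_k, up to the losses above ([block_det_ineq]).

    It remains to bound the N x N determinant from below.  At the points
    th s_j and s_b, with Chebyshev nodes s_j, its lowest order term in th is an
    explicit multiple of a squared Vandermonde determinant, of size
    prod_(k < N) d_k ([det_node_powers]).  The higher order terms may cancel it
    at th = 1, but their growth is known, and a combination of the values at
    th = 1, q, ..., q^D annihilates th, ..., th^D while it keeps the constant
    ([qbinom_weights], [finite_remez]); so some th close to 1 gives a large
    determinant ([det_cas_nodes_lower]).

    In the quotient the first N factors d_k cancel, and w factors close to d_n
    remain.  With n close to t^14, w = t^12 and th >= 1 - t^-3 every loss is
    exp (O (n w / t)), so after a w-th root only exp (o (n)) is left
    ([sqrt_eigen_le]). *)

(** * Determinants of sums over a long index *)

Lemma det_expand_rows (R : comNzRingType) (N M : nat)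
    (c : 'I_N -> 'I_M -> R) (T : 'I_M -> 'I_N -> R) :
  \det (\matrix_(a, b) \sum_k c a k * T k b) =
  \sum_(psi : {ffun 'I_N -> 'I_M})
     (\prod_a c a (psi a)) * \det (\matrix_(a, b) T (psi a) b).
Proof.
rewrite /determinant.
under [RHS]eq_bigr do rewrite mulr_sumr.
rewrite exchange_big /=; apply: eq_bigr => s _.
under eq_bigr do rewrite mxE.
rewrite bigA_distr_bigA mulr_sumr /=; apply: eq_bigr => psi _.
rewrite big_split /= mulrCA; congr (_ * (_ * _)).
by apply: eq_bigr => a _; rewrite mxE.
Qed.

Lemma det_rows_noninj (R : comNzRingType) (N M : nat)
    (T : 'I_M -> 'I_N -> R) (psi : {ffun 'I_N -> 'I_M}) :
  ~~ injectiveb psi -> \det (\matrix_(a, b) T (psi a) b) = 0.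
Proof.
move/injectivePn => [a1 [a2 neq eqp]].
by apply: (determinant_alternate neq) => b; rewrite !mxE eqp.
Qed.

(** The Cauchy-Binet formula, with a sum over all maps instead of subsets.
    Averaging the expansion along the rows over the reorderings of [phi] turns
    the product of entries of [A] into a second minor; maps that are not
    injective contribute zero. *)
Lemma cauchy_binet_ffun (R : comNzRingType) (N M : nat) (wt : 'I_M -> R)
    (A B : 'M[R]_(N, M)) :
  N`!%:R * \det (\matrix_(a, b) \sum_m wt m * A a m * B b m) =
  \sum_(phi : {ffun 'I_N -> 'I_M}) (\prod_a wt (phi a)) *
    \det (\matrix_(a, b) A b (phi a)) * \det (\matrix_(a, b) B b (phi a)).
Proof.
rewrite (det_expand_rows (fun a m => wt m * A a m) (fun m b => B b m)).
pose G (phi : {ffun 'I_N -> 'I_M}) := (\prod_a (wt (phi a) * A a (phi a))) *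
  \det (\matrix_(a, b) B b (phi a)).
rewrite -/(\sum_phi G phi).
have -> : N`!%:R * \sum_phi G phi = \sum_(s : 'S_N) \sum_phi G phi.
  by rewrite sumr_const card_Sn mulr_natl.
transitivity (\sum_(s : 'S_N) \sum_(phi : {ffun 'I_N -> 'I_M}) G [ffun a => phi (s a)]).
  apply: eq_bigr => s _.
  rewrite (reindex (fun phi : {ffun 'I_N -> 'I_M} => [ffun a => phi (s a)])) //.
  exists (fun phi : {ffun 'I_N -> 'I_M} => [ffun a => phi ((s^-1)%g a)]) => phi _;
    by apply/ffunP => a; rewrite !ffunE ?permK ?permKV.
rewrite exchange_big /=; apply: eq_bigr => phi _.
rewrite -(det_tr (\matrix_(a, b) A b (phi a))).
have [dB EdB] : exists dB, \det (\matrix_(a, b) B b (phi a)) = dB by eexists.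
rewrite EdB.
have detE (X : 'M[R]_N) :
  \det X = \sum_(s : 'S_N) (-1) ^+ s * \prod_i X i (s i) by [].
rewrite (detE (\matrix_(a, b) A b (phi a))^T) mulr_sumr mulr_suml; apply: eq_bigr => s _.
rewrite /G.
have -> : \matrix_(a, b) B b ([ffun a => phi (s a)] a) =
          row_perm s (\matrix_(a, b) B b (phi a)).
  by apply/matrixP => a b; rewrite !mxE ffunE.
rewrite row_permE det_mulmx det_perm EdB big_split /=.
have -> : \prod_(a < N) wt ([ffun a => phi (s a)] a) = \prod_(a < N) wt (phi a).
  by rewrite [RHS](reindex_perm s); apply: eq_bigr => a _; rewrite ffunE.
have -> : \prod_(a < N) A a ([ffun a => phi (s a)] a) =
   \prod_(a < N) (\matrix_(a0, b) A b (phi a0))^T a (s a).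
  by apply: eq_bigr => a _; rewrite !mxE ffunE.
by rewrite -!mulrA; congr (_ * _); rewrite mulrCA.
Qed.

Lemma det_norm_le (R : realDomainType) (N : nat) (T : 'M[R]_N) (C : 'I_N -> R) :
  (forall a b, `|T a b| <= C b) -> `|\det T| <= N`!%:R * \prod_b C b.
Proof.
move=> hT; apply: (le_trans (ler_norm_sum _ _ _)).
have <- : \sum_(s : 'S_N) \prod_b C b = N`!%:R * \prod_b C b.
  by rewrite sumr_const card_Sn mulr_natl.
apply: ler_sum => s _; rewrite normrM normr_sign mul1r normr_prod.
rewrite [X in _ <= X](reindex_perm s).
by apply: ler_prod => a _; rewrite normr_ge0 hT.
Qed.

(** * Kernels of matrices and maximal minors *)

Lemma row_free_minor (F : fieldType) (w p : nat) (X : 'M[F]_(w, p)) :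
  row_free X -> exists S : {ffun 'I_w -> 'I_p}, \det (\matrix_(a, b) X b (S a)) != 0.
Proof.
move/row_freeP => [B XB].
have e : \det (\matrix_(a, b) \sum_k B k a * X b k) = 1.
  rewrite -[RHS](det1 _ w) -XB -det_tr; congr (\det _); apply/matrixP => a b.
  by rewrite !mxE; apply: eq_bigr => k _; rewrite mulrC.
apply/existsP; apply: contraT => /existsPn h.
have := oner_neq0 F.
rewrite -e (det_expand_rows (fun a k => B k a) (fun k b => X b k)) big1 ?eqxx // => S _.
by have /negbNE/eqP -> := h S; rewrite mulr0.
Qed.

(** Cramer's rule: both sides are the cofactor expansion along column [a]. *)
Lemma cramer_replace (F : fieldType) (w p : nat) (X : 'M[F]_(w, p))
    (S : {ffun 'I_w -> 'I_p}) (a : 'I_w) (k : 'I_p) :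
  let G := \matrix_(b, i) X b (S i) in
  G \in unitmx ->
  (invmx G *m X) a k * \det G =
  \det (\matrix_(b, i) X b (if i == a then k else S i)).
Proof.
move=> G uG; have G0 : \det G != 0 by rewrite -unitfE -unitmxE.
have -> : (invmx G *m X) a k = (\det G)^-1 * \sum_b \adj G a b * X b k.
  by rewrite /invmx uG -scalemxAl [LHS]mxE [in LHS]mxE.
rewrite mulrAC mulVf // mul1r [RHS](expand_det_col _ a).
apply: eq_bigr => b _; rewrite [\adj G a b]mxE [in RHS]mxE eqxx mulrC; congr (_ * _).
rewrite /cofactor; congr (_ * \det _); apply/matrixP => i j; rewrite !mxE.
by rewrite eq_sym (negbTE (neq_lift a j)).
Qed.

(** Solutions of a homogeneous system, normalised at a minor of maximal absolute
    value among all maximal minors of a basis: by Cramer's rule every entry is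
    then a quotient of two minors, hence bounded by 1.  Such a basis plays the
    role of an orthonormal one, and in addition has unit columns. *)
Lemma kernel_max_minor (R : realFieldType) (w p N : nat) (Y : 'M[R]_(p, N)) :
  (w + N <= p)%N ->
  exists (X : 'M[R]_(w, p)) (S : 'I_w -> 'I_p),
    [/\ X *m Y = 0, (forall a i, X a (S i) = (a == i)%:R) & forall a k, `|X a k| <= 1].
Proof.
move=> wN.
pose U := row_base (kermx Y).
pose X0 : 'M[R]_(w, p) := pid_mx w *m U.
have rk : (w <= \rank (kermx Y))%N.
  by rewrite mxrank_ker; have := rank_leq_col Y; lia.
have fX0 : row_free X0.
  by rewrite /row_free mxrankMfree ?row_base_free // rank_pid_mx.
have XY0 : X0 *m Y = 0.
  rewrite -mulmxA.
  have /sub_kermxP -> : (U <= kermx Y)%MS by rewrite eq_row_base.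
  by rewrite mulmx0.
have [S0 hS0] := row_free_minor fX0.
pose d (S : {ffun 'I_w -> 'I_p}) := `|\det (\matrix_(b, i) X0 b (S i))|.
have dE (S : {ffun 'I_w -> 'I_p}) : d S = `|\det (\matrix_(a, b) X0 b (S a))|.
  by rewrite /d -det_tr; congr (`|\det _|); apply/matrixP => a b; rewrite !mxE.
have [S _ maxS] := @Order.TotalTheory.arg_maxP _ _ _ S0 xpredT d isT.
set G := \matrix_(b, i) X0 b (S i).
have dS0 : 0 < d S.
  by apply: lt_le_trans (maxS S0 isT); rewrite dE normr_gt0.
have uG : G \in unitmx by rewrite unitmxE unitfE -normr_gt0.
exists (invmx G *m X0), S; split.
- by rewrite -mulmxA XY0 mulmx0.
- move=> a i.
  have <- : (invmx G *m G) a i = (a == i)%:R by rewrite mulVmx // mxE.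
  by rewrite !mxE; apply: eq_bigr => b _; rewrite !mxE.
- move=> a k; rewrite -(ler_pM2r dS0) mul1r -normrM cramer_replace //.
  pose S' : {ffun 'I_w -> 'I_p} := [ffun i => if i == a then k else S i].
  have := maxS S' isT; rewrite {1}/d => h; apply: le_trans h.
  rewrite le_eqVlt; apply/orP; left; apply/eqP; congr (`|\det _|).
  by apply/matrixP => b i; rewrite !mxE ffunE.
Qed.

(** * Chebyshev coefficients of monomials *)

Lemma expX_fact_le (R : realType) (y : R) (k : nat) :
  0 <= y -> y ^+ k / k`!%:R <= expR y.
Proof.
move=> y0; case: k => [|k]; last first.
  by apply: le_trans (expR_ge1Dxn k y0); rewrite lerDr.
by rewrite expr0 fact0 divr1; apply: le_trans (expR_ge1Dx y); rewrite lerDl.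
Qed.

(** The coefficient of the Chebyshev polynomial T_k in (2 x)^m: expand
    (z + 1 / z)^m and collect the exponents m - 2 r of absolute value k. *)
Definition chebN (m k : nat) : nat :=
  (\sum_(r < m.+1 | (m - r.*2) + (r.*2 - m) == k) 'C(m, r))%N.

Lemma chebN_gt (m k : nat) : (m < k)%N -> chebN m k = 0%N.
Proof. by move=> mk; rewrite /chebN big1 // => r /eqP; have := ltn_ord r; lia. Qed.

Lemma chebN_diag (m : nat) : (0 < chebN m m)%N.
Proof.
rewrite /chebN (bigD1 ord0) /=; last by apply/eqP; rewrite double0; lia.
by rewrite bin0.
Qed.

Lemma chebN_odd (m k : nat) : odd m != odd k -> chebN m k = 0%N.
Proof.
move=> mk; rewrite /chebN big1 // => r /eqP.
by have := ltn_ord r; move: mk; lia.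
Qed.

Lemma chebN_le (k q : nat) : (chebN (k + q.*2) k <= 2 * 'C(k + q.*2, q))%N.
Proof.
rewrite /chebN.
set m := (k + q.*2)%N.
apply: (@leq_trans (\sum_(r < m.+1 | (r == q :> nat) || (r == q + k :> nat)) 'C(m, q))%N).
  rewrite [leqLHS]big_mkcond [leqRHS]big_mkcond /=; apply: leq_sum => r _.
  case: ifP => // /eqP h.
  have : (r == q :> nat) || (r == q + k :> nat)%N by move: h; rewrite /m; lia.
  move=> /[dup] + -> => /orP[/eqP -> //|/eqP ->].
  rewrite -bin_sub; last by rewrite /m; lia.
  by have -> : (m - (q + k))%N = q by rewrite /m; lia.
rewrite sum_nat_const leq_mul2r; apply/orP; right.
have qm : (q < m.+1)%N by rewrite /m; lia.
have qkm : (q + k < m.+1)%N by rewrite /m; lia.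
apply: (@leq_trans #|[set Ordinal qm; Ordinal qkm]|); last by rewrite cards2; case: (_ != _).
apply/subset_leq_card/fintype.subsetP => r; rewrite !inE => /orP[] /eqP h; apply/orP.
  by left; apply/eqP/val_inj.
by right; apply/eqP/val_inj.
Qed.

(** Induction on [k] from the bound 4^q for the central binomial coefficient; the
    step is (k + 1 + 2 q) (k + 1) <= (k + 1 + q)^2. *)
Lemma fact_shift_le (k q : nat) :
  ((k + q.*2)`! * k`! <= 4 ^ q * ((k + q)`! * (k + q)`!))%N.
Proof.
elim: k => [|k IH].
  rewrite !add0n fact0 muln1.
  have h : (q <= q.*2)%N by lia.
  have /= <- := bin_fact h.
  have -> : (q.*2 - q = q)%N by lia.
  rewrite leq_mul2r; apply/orP; right.
  have -> : (4 ^ q = 2 ^ q.*2)%N by rewrite -[4%N]/(2 ^ 2)%N -expnM mul2n.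
  rewrite -[in leqRHS](addn1 1) expnDn.
  under eq_bigr do rewrite !exp1n !muln1.
  have qm : (q < q.*2.+1)%N by lia.
  by rewrite (bigD1 (Ordinal qm)) //= leq_addr.
rewrite !addSn !factS.
have : ((k + q.*2).+1 * k.+1 <= (k + q).+1 * (k + q).+1)%N by nia.
move/leq_mul => /(_ _ _ IH) h.
by apply: leq_trans (leq_trans h _); apply: eq_leq; ring.
Qed.

(** The squared coefficient C(m, q)^2 makes up for the passage from y^m / m! to
    y^k / k!, where m = k + 2 q: the quotient is at most ((2 y)^q / q!)^2, which
    is controlled by an exponential in [y], with room for a geometric factor. *)
Lemma chebN_term_le (R : realType) (y : R) (k q : nat) : 0 <= y ->
  (k + q.*2).+1%:R * (y ^+ (k + q.*2) / (k + q.*2)`!%:R) *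
     (chebN (k + q.*2) k)%:R ^+ 2 <=
  4 * k.+1%:R * expR (16 * y) * (y ^+ k / k`!%:R) * 2^-1 ^+ q.*2.
Proof.
move=> y0.
set m := (k + q.*2)%N.
have kf0 : 0 < (k`!%:R : R) by rewrite ltr0n fact_gt0.
have mf0 : 0 < (m`!%:R : R) by rewrite ltr0n fact_gt0.
have qf0 : 0 < (q`!%:R : R) by rewrite ltr0n fact_gt0.
have kqf0 : 0 < ((k + q)`!%:R : R) by rewrite ltr0n fact_gt0.
have c0 : 0 <= ((chebN m k)%:R : R) by [].
have hb : ('C(m, q)%:R : R) = m`!%:R / (q`!%:R * (k + q)`!%:R).
  have h : (q <= m)%N by rewrite /m; lia.
  apply: (canRL (mulfK _)); first by rewrite mulf_neq0 ?gt_eqF.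
  have := bin_fact h.
  have -> : (m - q = k + q)%N by rewrite /m; lia.
  by move=> <-; rewrite !natrM.
have h1 : (chebN m k)%:R ^+ 2 <= 4 * (m`!%:R / (q`!%:R * (k + q)`!%:R)) ^+ 2 :> R.
  have := chebN_le k q; rewrite -/m -(ler_nat R) natrM hb => h.
  have -> : 4 * (m`!%:R / (q`!%:R * (k + q)`!%:R)) ^+ 2 =
     (2 * (m`!%:R / (q`!%:R * (k + q)`!%:R))) ^+ 2 :> R by ring.
  by rewrite ler_sqr ?nnegrE ?(le_trans c0 h).
have h2 : m`!%:R * k`!%:R <= 4 ^+ q * (k + q)`!%:R ^+ 2 :> R.
  by have := fact_shift_le k q; rewrite -(ler_nat R) !natrM natrX expr2.
have h3 : m.+1%:R <= k.+1%:R * 4 ^+ q :> R.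
  rewrite -natrX -natrM ler_nat.
  have h : (q.*2.+1 <= 4 ^ q)%N by elim: (q) => // p IH; rewrite expnS; lia.
  apply: (@leq_trans (k.+1 * q.*2.+1)); last by rewrite leq_mul2l h orbT.
  rewrite /m; nia.
have h4 : ((8 * y) ^+ q / q`!%:R) ^+ 2 <= expR (16 * y).
  have -> : 16 * y = 8 * y + 8 * y by ring.
  rewrite expRD -expr2 ler_sqr ?nnegrE ?expR_ge0 //.
    by apply: expX_fact_le; rewrite mulr_ge0.
  by rewrite divr_ge0 ?exprn_ge0 ?mulr_ge0 // ltW.
have ym0 : 0 <= y ^+ m by rewrite exprn_ge0.
have y2q : 0 <= y ^+ q by rewrite exprn_ge0.
have yk0 : 0 <= y ^+ k by rewrite exprn_ge0.
apply: (@le_trans _ _ (k.+1%:R * 4 ^+ q * (y ^+ m / m`!%:R) *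
     (4 * (m`!%:R / (q`!%:R * (k + q)`!%:R)) ^+ 2))).
  apply: ler_pM => //.
    by rewrite mulr_ge0 // divr_ge0 // ltW.
  apply: ler_pM => //.
  by rewrite divr_ge0 // ltW.
have -> : k.+1%:R * 4 ^+ q * (y ^+ m / m`!%:R) *
     (4 * (m`!%:R / (q`!%:R * (k + q)`!%:R)) ^+ 2) =
   (4 * k.+1%:R * (y ^+ k / k`!%:R)) * (y ^+ q / q`!%:R) ^+ 2 * 4 ^+ q *
     ((m`!%:R * k`!%:R) / (k + q)`!%:R ^+ 2).
  rewrite /m exprD -mul2n mulnC exprM.
  by field; rewrite !gt_eqF.
apply: (@le_trans _ _ ((4 * k.+1%:R * (y ^+ k / k`!%:R)) * (y ^+ q / q`!%:R) ^+ 2 * 4 ^+ q *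
     4 ^+ q)).
  apply: ler_wpM2l.
    by rewrite !mulr_ge0 ?exprn_ge0 ?invr_ge0 ?mulr_ge0 ?ler0n.
  by rewrite ler_pdivrMr ?exprn_gt0.
have -> : (4 * k.+1%:R * (y ^+ k / k`!%:R)) * (y ^+ q / q`!%:R) ^+ 2 * 4 ^+ q * 4 ^+ q
  = (4 * k.+1%:R * (y ^+ k / k`!%:R)) * ((8 * y) ^+ q / q`!%:R) ^+ 2 * 2^-1 ^+ q.*2.
  have -> : (2^-1 : R) ^+ q.*2 = (4 ^+ q)^-1.
    by rewrite -mul2n exprM -exprVn; congr (_ ^+ _); field.
  have -> : ((8 * y) ^+ q / q`!%:R) ^+ 2 =
      4 ^+ q * 4 ^+ q * 4 ^+ q * (y ^+ q / q`!%:R) ^+ 2.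
    rewrite !expr_div_n mulrA; congr (_ / _).
    by rewrite ![_ ^+ q ^+ 2]exprAC -!exprMn; congr (_ ^+ _); ring.
  by field; rewrite ?expf_neq0 ?gt_eqF.
rewrite [leRHS](_ : _ = 4 * k.+1%:R * (y ^+ k / k`!%:R) * expR (16 * y) * 2^-1 ^+ q.*2); last by ring.
apply: ler_wpM2r; first by rewrite exprn_ge0 // invr_ge0.
apply: ler_wpM2l => //.
by rewrite !mulr_ge0 // invr_ge0 ltW.
Qed.

Lemma geom_half_sum (R : realType) (M k : nat) :
  \sum_(m < M | (k <= m)%N) (2^-1 : R) ^+ (m - k) <= 2.
Proof.
suff h : \sum_(m < M | (k <= m)%N) (2^-1 : R) ^+ (m - k) <= 2 - 2 * 2^-1 ^+ (M - k).
  by apply: le_trans h _; rewrite gerBl mulr_ge0 // exprn_ge0 // invr_ge0.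
elim: M => [|M IH]; first by rewrite big_ord0 sub0n expr0; lra.
rewrite big_mkcond big_ord_recr /= -big_mkcond /=.
case: leqP => h; last first.
  rewrite addr0; apply: le_trans IH _.
  by have -> : (M - k = M.+1 - k)%N by lia.
rewrite subSn // exprS.
by apply: le_trans (lerD IH (lexx (2^-1 ^+ (M - k)))) _; rewrite mulVKf //; move: (_ ^+ (M - k)) => X; lra.
Qed.

(** Replacing a power by a Chebyshev index multiplies the weight y^k / k! only by
    exp (O (y)) and a linear factor. *)
Lemma chebN_sum_le (R : realType) (y : R) (M k : nat) : 0 <= y ->
  \sum_(m < M) m.+1%:R * (y ^+ m / m`!%:R) * (chebN m k)%:R ^+ 2 <=
  8 * expR (16 * y) * (k.+1%:R * (y ^+ k / k`!%:R)).
Proof.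
move=> y0.
have h0 : 0 <= 4 * k.+1%:R * expR (16 * y) * (y ^+ k / k`!%:R).
  by rewrite !mulr_ge0 ?expR_ge0 ?invr_ge0 ?exprn_ge0.
apply: (@le_trans _ _ ((4 * k.+1%:R * expR (16 * y) * (y ^+ k / k`!%:R)) *
   (\sum_(m < M | (k <= m)%N) (2^-1 : R) ^+ (m - k)))); last first.
  apply: le_trans (ler_wpM2l h0 (geom_half_sum _ _ _)) _.
  by rewrite le_eqVlt; apply/orP; left; apply/eqP; ring.
rewrite mulr_sumr [leRHS]big_mkcond /=; apply: ler_sum => m _.
case: leqP => km; last by rewrite chebN_gt // expr0n mulr0.
have [/eqP e|ne] := boolP (odd m == odd k); last first.
  by rewrite chebN_odd // expr0n mulr0 mulr_ge0 // exprn_ge0 // invr_ge0.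
have [q mq] : exists q, nat_of_ord m = (k + q.*2)%N
  by exists ((m - k)./2); move: e km; lia.
rewrite mq.
have -> : (k + q.*2 - k = q.*2)%N by lia.
exact: chebN_term_le.
Qed.

(** * Sums over injective maps *)

(** The Cauchy-Schwarz inequality, used with [w] the indicator function of a set
    outside which [x] vanishes. *)
Lemma sqr_sum_le (R : realFieldType) (I : finType) (P : pred I) (w x : I -> R) :
  (forall i, 0 <= w i) -> (forall i, 0 <= x i) -> (forall i, w i * x i = x i) ->
  (\sum_(i | P i) x i) ^+ 2 <= (\sum_i w i) * \sum_(i | P i) x i ^+ 2.
Proof.
move=> w0 x0 wx.
have hw : \sum_(i | P i) w i <= \sum_i w i.
  by rewrite [leRHS](bigID P) /= lerDl sumr_ge0.
have hx : 0 <= \sum_(i | P i) x i ^+ 2 by apply: sumr_ge0 => i _; rewrite sqr_ge0.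
apply: le_trans (ler_wpM2r hx hw).
have e : (\sum_(i | P i) w i) * (\sum_(i | P i) x i ^+ 2) =
   \sum_(i | P i) \sum_(j | P j) 2^-1 * (w j * x i ^+ 2 + w i * x j ^+ 2).
  under [RHS]eq_bigr do rewrite -mulr_sumr big_split /= -mulr_suml -mulr_sumr.
  rewrite -mulr_sumr big_split /= -mulr_sumr -mulr_suml.
  by field.
rewrite e expr2 mulr_suml; apply: ler_sum => i _.
rewrite mulr_sumr; apply: ler_sum => j _.
have h3 : 0 <= w i * w j * (x i - x j) ^+ 2 by apply: mulr_ge0; [apply: mulr_ge0 | exact: sqr_ge0].
have h1 : w j * x i ^+ 2 = w i * w j * x i ^+ 2.
  by rewrite expr2 -{1}(wx i); ring.
have h2 : w i * x j ^+ 2 = w i * w j * x j ^+ 2.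
  by rewrite expr2 -{1}(wx j); ring.
have h4 : x i * x j = w i * w j * (x i * x j) by rewrite -{1}(wx i) -{1}(wx j); ring.
rewrite h4 h1 h2; move: h3; lra.
Qed.

Definition cheb_inj_sum (R : realType) (N M : nat) (phi : {ffun 'I_N -> 'I_M}) : R :=
  \sum_(psi : {ffun 'I_N -> 'I_M} | injectiveb psi)
    \prod_a (chebN (phi a) (psi a))%:R.

(** Expanding each row over Chebyshev polynomials leaves determinants of the
    values of the functionals at these polynomials; two equal indices give two
    equal rows, so that only injective choices remain. *)
Lemma det_cheb_le (R : realType) (N M : nat) (A T : 'M[R]_(N, M)) (C : 'I_N -> R)
    (phi : {ffun 'I_N -> 'I_M}) :
  (forall b m, A b m = 2^-1 ^+ m * \sum_(k < M) (chebN m k)%:R * T b k) ->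
  (forall b k, `|T b k| <= C b) ->
  `|\det (\matrix_(a, b) A b (phi a))| <=
    (\prod_a 2^-1 ^+ phi a) * (N`!%:R * \prod_b C b) * cheb_inj_sum R phi.
Proof.
move=> hA hT.
have -> : \matrix_(a, b) A b (phi a) =
   \matrix_(a, b) \sum_(k < M) (2^-1 ^+ phi a * (chebN (phi a) k)%:R) * T b k.
  apply/matrixP => a b; rewrite !mxE hA mulr_sumr.
  by apply: eq_bigr => k _; rewrite mulrA.
rewrite (det_expand_rows (fun a (k : 'I_M) => 2^-1 ^+ phi a * (chebN (phi a) k)%:R)
   (fun k b => T b k)).
rewrite (bigID (fun psi : {ffun 'I_N -> 'I_M} => injectiveb psi)) /=.
rewrite [X in _ + X]big1 ?addr0; last first.
  by move=> psi hp; rewrite (det_rows_noninj (fun (k : 'I_M) b => T b k) hp) mulr0.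
apply: (le_trans (ler_norm_sum _ _ _)).
rewrite /cheb_inj_sum mulr_sumr; apply: ler_sum => psi _.
rewrite big_split /= !normrM.
rewrite ger0_norm; last by apply: prodr_ge0 => a _; rewrite exprn_ge0 // invr_ge0.
rewrite ger0_norm; last by apply: prodr_ge0 => a _.
rewrite -[leRHS]mulrA [X in _ <= _ * X]mulrC mulrA; apply: ler_wpM2l.
  by apply: mulr_ge0; apply: prodr_ge0 => a _; rewrite ?ler0n // exprn_ge0 // invr_ge0.
by apply: det_norm_le => a b; rewrite mxE.
Qed.

(** A power m involves only T_0, ..., T_m, so at most prod (phi a + 1) terms of
    the sum do not vanish. *)
Lemma cheb_inj_sum_sqr (R : realType) (N M : nat) (phi : {ffun 'I_N -> 'I_M}) :
  cheb_inj_sum R phi ^+ 2 <=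
  (\prod_a (phi a).+1%:R) *
   \sum_(psi : {ffun 'I_N -> 'I_M} | injectiveb psi)
      \prod_a (chebN (phi a) (psi a))%:R ^+ 2.
Proof.
(* The indicator function of the maps bounded by phi. *)
pose w (psi : {ffun 'I_N -> 'I_M}) : R := \prod_a (psi a <= phi a)%N%:R.
have hw : \sum_psi w psi <= \prod_a (phi a).+1%:R.
  rewrite /w -(bigA_distr_bigA (fun a (k : 'I_M) => (k <= phi a)%N%:R)).
  apply: ler_prod => a _; rewrite sumr_ge0 //=.
  have hm : ((phi a).+1 <= M)%N := ltn_ord (phi a).
  rewrite -natr_sum ler_nat.
  under eq_bigr do rewrite -[nat_of_bool _]/(if _ then 1%N else 0%N).
  rewrite -big_mkcond /= sum1dep_card.
  apply: (@leq_trans #|[set widen_ord hm i | i : 'I_(phi a).+1]|).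
    apply/subset_leq_card/fintype.subsetP => k; rewrite !inE => h.
    apply/imsetP; exists (Ordinal (h : (k < (phi a).+1)%N)) => //.
    exact/val_inj.
  by apply: leq_trans (leq_imset_card _ _) _; rewrite card_ord.
apply: (@le_trans _ _ ((\sum_psi w psi) *
   \sum_(psi : {ffun 'I_N -> 'I_M} | injectiveb psi)
      (\prod_a (chebN (phi a) (psi a))%:R) ^+ 2)).
  apply: sqr_sum_le => psi; rewrite ?prodr_ge0 //.
  rewrite /w -big_split /=; apply: eq_bigr => a _.
  by case: leqP => h; rewrite ?mul1r // chebN_gt // mulr0.
under [X in _ * X <= _]eq_bigr do rewrite -prodrXl.
apply: ler_wpM2r => //; apply: sumr_ge0 => psi _; apply: prodr_ge0 => a _.
by rewrite sqr_ge0.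
Qed.

(** An injective map is determined by its image up to at most N^N choices. *)
Lemma sum_inj_le_sets (R : realFieldType) (N M : nat) (x : nat -> R) :
  (forall k, 0 <= x k) ->
  \sum_(psi : {ffun 'I_N -> 'I_M} | injectiveb psi) \prod_a x (psi a) <=
  N%:R ^+ N * \sum_(A : {set 'I_M} | #|A| == N) \prod_(k in A) x k.
Proof.
move=> x0.
pose im (psi : {ffun 'I_N -> 'I_M}) := [set psi a | a : 'I_N].
rewrite (partition_big im (fun A => #|A| == N)) /=; last first.
  by move=> psi /injectiveP h; rewrite card_imset // card_ord.
rewrite mulr_sumr; apply: ler_sum => A /eqP cA.
apply: (@le_trans _ _ (\sum_(psi : {ffun 'I_N -> 'I_M} | injectiveb psi && (im psi == A))
   \prod_(k in A) x k)).
  apply: ler_sum => psi /andP[/injectiveP h /eqP <-].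
  by rewrite big_imset //=; move=> a b _ _ /h.
rewrite sumr_const -[leLHS]mulr_natl.
apply: ler_wpM2r; first by apply: prodr_ge0.
rewrite -natrX ler_nat.
apply: (@leq_trans #|(ffun_on (mem A) : pred {ffun 'I_N -> 'I_M})|); last by rewrite card_ffun_on card_ord cA.
apply/subset_leq_card/fintype.subsetP => psi; rewrite !inE => /andP[_ /eqP e].
by apply/ffun_onP => a; rewrite -e imset_f.
Qed.

(** Every elementary symmetric polynomial is part of an expanded product; the
    scale [t] is free, and the best choice is near the N-th value of [x]. *)
Lemma sum_sets_le_prod (R : realFieldType) (N M : nat) (x : nat -> R) (t : R) :
  (forall k, 0 <= x k) -> 0 < t ->
  \sum_(A : {set 'I_M} | #|A| == N) \prod_(k in A) x k <=
  t ^+ N * \prod_(k < M) (1 + x k / t).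
Proof.
move=> x0 t0.
have xt k : 0 <= x k / t by rewrite divr_ge0 // ltW.
under [X in _ * X]eq_bigr do rewrite addrC.
rewrite bigA_distr /= [X in _ <= _ * X](bigID (fun A : {set 'I_M} => #|A| == N)) /= mulrDr.
rewrite -[leLHS]addr0; apply: lerD; last first.
  apply: mulr_ge0; first by rewrite exprn_ge0 // ltW.
  apply: sumr_ge0 => A _; apply: prodr_ge0 => k _.
  by case: ifP.
rewrite mulr_sumr; apply: ler_sum => A /eqP cA.
rewrite -{1}cA -big_mkcond /= -prodr_const -big_split /=.
rewrite le_eqVlt; apply/orP; left; apply/eqP; apply: eq_bigr => k _.
by rewrite mulrC divfK // gt_eqF.
Qed.

(** * Upper bound for sums of products of minors *)

(** For y = c / 4 this is the size of the singular values of the operator with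
    kernel cas(c s x). *)
Definition expw (R : realType) (y : R) (k : nat) : R := y ^+ k / k`!%:R.

Lemma expw_gt0 (R : realType) (y : R) k : 0 < y -> 0 < expw y k.
Proof. by move=> y0; rewrite divr_gt0 ?exprn_gt0 // ltr0n fact_gt0. Qed.

Lemma expw_ge0 (R : realType) (y : R) k : 0 <= y -> 0 <= expw y k.
Proof. by move=> y0; rewrite divr_ge0 ?exprn_ge0. Qed.

Lemma expwS (R : realType) (y : R) k : expw y k.+1 = expw y k * (y / k.+1%:R).
Proof.
rewrite /expw exprSr factS natrM.
have : k`!%:R != 0 :> R by rewrite pnatr_eq0 -lt0n fact_gt0.
have : k.+1%:R != 0 :> R by rewrite pnatr_eq0.
by move=> h1 h2; field; rewrite ?nat1r ?h1 ?h2.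
Qed.

(** From k! b! <= (k + b)!. *)
Lemma expw_split_le (R : realType) (y : R) k b : 0 <= y ->
  expw y (k + b) <= expR y * expw y k.
Proof.
move=> y0.
apply: (@le_trans _ _ (expw y b * expw y k)); last first.
  by apply: ler_wpM2r; [exact: expw_ge0 | exact: expX_fact_le].
rewrite /expw mulrACA -exprD addnC; apply: ler_wpM2l; first by rewrite exprn_ge0.
rewrite -invfM -natrM lef_pV2 ?posrE ?ltr0n ?muln_gt0 ?fact_gt0 // ler_nat.
have h : (b <= b + k)%N by rewrite leq_addr.
have := bin_fact h; rewrite addKn => <-.
by rewrite leq_pmull // bin_gt0.
Qed.

Definition kexpw (R : realType) (y : R) (k : nat) : R := k.+1%:R * expw y k.

Lemma kexpw_gt0 (R : realType) (y : R) k : 0 < y -> 0 < kexpw y k.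
Proof. by move=> y0; rewrite mulr_gt0 ?expw_gt0. Qed.

(** From the index N >= 8 y on, consecutive quotients are at most 1/2. *)
Lemma kexpw_tail (R : realType) (y : R) (N b : nat) : (0 < N)%N -> 0 < y ->
  8 * y <= N%:R -> kexpw y (N + b) <= kexpw y N * 2^-1 ^+ b.
Proof.
move=> N0 y0 yN; elim: b => [|b IH]; first by rewrite addn0 expr0 mulr1.
rewrite addnS exprSr mulrA; apply: (@le_trans _ _ (kexpw y (N + b) * 2^-1)); last first.
  by apply: ler_wpM2r => //; rewrite invr_ge0.
rewrite /kexpw expwS.
set k := (N + b)%N.
have k0 : 0 < (k.+1%:R : R) by [].
have -> : k.+2%:R * (expw y k * (y / k.+1%:R)) =
   k.+1%:R * expw y k * (k.+2%:R * y / k.+1%:R ^+ 2).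
  by field; rewrite nat1r gt_eqF.
apply: ler_wpM2l; first by rewrite mulr_ge0 // expw_ge0 // ltW.
rewrite ler_pdivrMr ?exprn_gt0 //.
have yk : 8 * y <= k.+1%:R by apply: le_trans yN _; rewrite ler_nat /k; lia.
have e : (k.+2%:R : R) = k.+1%:R + 1 by rewrite -[in LHS]addn1 natrD.
rewrite e; have : 1 <= (k.+1%:R : R) by rewrite ler1n.
nra.
Qed.

Lemma prod_1D_le_exp (R : realType) (M : nat) (t : nat -> R) :
  (forall b, 0 <= t b) -> (forall b, t b <= 2^-1 ^+ b) ->
  \prod_(b < M) (1 + t b) <= expR 2.
Proof.
move=> t0 ht.
apply: (@le_trans _ _ (\prod_(b < M) expR (2^-1 ^+ b))).
  apply: ler_prod => b _; rewrite addr_ge0 //=.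
  by apply: le_trans (expR_ge1Dx _); rewrite lerD2l.
rewrite -expR_sum ler_expR.
have := geom_half_sum R M 0.
by under eq_bigr do rewrite subn0.
Qed.

Lemma expr_prod_ord (R : comNzRingType) (N : nat) (z : R) :
  z ^+ N = \prod_(k < N) z.
Proof. by rewrite prodr_const card_ord. Qed.

(** The scale [kexpw y N] separates the indices below [N], which produce the
    product, from those above, whose contribution is bounded by geometric decay. *)
Lemma inj_sum_kexpw (R : realType) (N M : nat) (y : R) : (0 < N)%N -> (N <= M)%N ->
  0 < y -> 8 * y <= N%:R ->
  \sum_(psi : {ffun 'I_N -> 'I_M} | injectiveb psi) \prod_a kexpw y (psi a) <=
  expR 2 * (N%:R * (N.+2%:R * expR y)) ^+ N * \prod_(k < N) kexpw y k.
Proof.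
move=> N0 NM y0 yN.
have x0 k : 0 <= kexpw y k by rewrite ltW // kexpw_gt0.
have xN := kexpw_gt0 N y0.
apply: le_trans (sum_inj_le_sets _ _ x0) _.
apply: le_trans (ler_wpM2l _ (sum_sets_le_prod N M x0 xN)) _; first exact: exprn_ge0.
have -> : \prod_(k < M) (1 + kexpw y k / kexpw y N) =
  (\prod_(k < N) (1 + kexpw y k / kexpw y N)) *
  (\prod_(b < M - N) (1 + kexpw y (N + b) / kexpw y N)).
  rewrite -(big_mkord xpredT (fun k => 1 + kexpw y k / kexpw y N)).
  rewrite (big_cat_nat (leq0n N) NM) /= big_mkord; congr (_ * _).
  rewrite -{1}[N]add0n big_addn big_mkord.
  by apply: eq_bigr => b _; rewrite addnC.
have h1 : \prod_(b < M - N) (1 + kexpw y (N + b) / kexpw y N) <= expR 2.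
  apply: (@prod_1D_le_exp _ _ (fun b => kexpw y (N + b) / kexpw y N)) => b; first by rewrite divr_ge0.
  by rewrite ler_pdivrMr // mulrC kexpw_tail.
have h2 : kexpw y N ^+ N * \prod_(k < N) (1 + kexpw y k / kexpw y N) <=
   (N.+2%:R * expR y) ^+ N * \prod_(k < N) kexpw y k.
  rewrite [kexpw y N ^+ N]expr_prod_ord [(_ * expR y) ^+ N]expr_prod_ord -!big_split /=.
  apply: ler_prod => k _; rewrite mulr_ge0 ?addr_ge0 ?divr_ge0 //=.
  rewrite mulrDr mulr1 mulrCA divff ?gt_eqF // mulr1.
  have e1 : 1 <= expR y by apply: le_trans (expR_ge1Dx _); rewrite lerDl ltW.
  have h3 : kexpw y N <= N.+1%:R * expR y * kexpw y k.
    rewrite /kexpw -mulrA ler_wpM2l //.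
    have := expw_split_le k (N - k) (ltW y0); rewrite subnKC; last exact: ltnW.
    move=> /le_trans; apply.
    apply: ler_wpM2l; first exact: expR_ge0.
    by rewrite ler_peMl ?ler1n //; exact: expw_ge0 (ltW y0).
  have -> : (N.+2%:R : R) = N.+1%:R + 1 by rewrite -[in LHS]addn1 natrD.
  rewrite mulrDl mulrDl; apply: lerD => //.
  by rewrite mul1r ler_peMl.
apply: (@le_trans _ _ (N%:R ^+ N * ((N.+2%:R * expR y) ^+ N * \prod_(k < N) kexpw y k *
   expR 2))).
  apply: ler_wpM2l; first exact: exprn_ge0.
  rewrite mulrA; apply: ler_pM => //.
    rewrite mulr_ge0 ?exprn_ge0 //; apply: prodr_ge0 => k _.
    by rewrite addr_ge0 // divr_ge0.
  by apply: prodr_ge0 => k _; rewrite addr_ge0 // divr_ge0.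
by rewrite !exprMn le_eqVlt; apply/orP; left; apply/eqP; ring.
Qed.

(** The factor exp (O (N (y + log N))) lost in [minor_sum_le]. *)
Definition minor_loss (R : realType) (N : nat) (y : R) : R :=
  expR 2 * (8 * N.+2%:R ^+ 4 * expR (17 * y)) ^+ N.

Lemma minor_loss_gt0 (R : realType) (N : nat) (y : R) : 0 < minor_loss N y.
Proof. by rewrite mulr_gt0 ?expR_gt0 // exprn_gt0 // !mulr_gt0 ?expR_gt0 // exprn_gt0. Qed.

Lemma fact_le_exp (N : nat) : (N`! <= N.+2 ^ N)%N.
Proof.
have h m : (m <= N)%N -> (m`! <= N.+2 ^ m)%N.
  elim: m => // m IH hm; rewrite factS expnS; apply: leq_mul; first by lia.
  by apply: IH; lia.
exact: h.
Qed.

(** The main upper bound.  The rows of [A] and [B] are the moments of linear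
    functionals, those of [TA] and [TB] their values at Chebyshev polynomials.
    Each power m carries (4 y)^m / m! and the two factors 2^-m, that is
    y^m / m!; injectivity of the Chebyshev indices makes the product over k < N
    of y^k / k! appear instead of the N-th power of a sum. *)
Lemma minor_sum_le (R : realType) (N M : nat) (y : R) (A B TA TB : 'M[R]_(N, M))
    (CA CB : 'I_N -> R) :
  (0 < N)%N -> (N <= M)%N -> 0 < y -> 8 * y <= N%:R ->
  (forall b m, A b m = 2^-1 ^+ m * \sum_(k < M) (chebN m k)%:R * TA b k) ->
  (forall b m, B b m = 2^-1 ^+ m * \sum_(k < M) (chebN m k)%:R * TB b k) ->
  (forall b k, `|TA b k| <= CA b) -> (forall b k, `|TB b k| <= CB b) ->
  \sum_(phi : {ffun 'I_N -> 'I_M}) (\prod_a expw (4 * y) (phi a)) *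
    `|\det (\matrix_(a, b) A b (phi a))| * `|\det (\matrix_(a, b) B b (phi a))| <=
  N`!%:R * (minor_loss N y * (\prod_b CA b) * (\prod_b CB b) * \prod_(k < N) expw y k).
Proof.
move=> N0 NM y0 yN hA hB hTA hTB.
have CA0 b : 0 <= CA b by apply: le_trans (hTA b (Ordinal (leq_trans N0 NM))).
have CB0 b : 0 <= CB b by apply: le_trans (hTB b (Ordinal (leq_trans N0 NM))).
set PA := \prod_b CA b; set PB := \prod_b CB b.
have PA0 : 0 <= PA by apply: prodr_ge0.
have PB0 : 0 <= PB by apply: prodr_ge0.
have half0 m : 0 <= 2^-1 ^+ m :> R by rewrite exprn_ge0 // invr_ge0.
have y4 : 0 <= 4 * y by rewrite mulr_ge0 // ltW.
apply: (@le_trans _ _ (\sum_(phi : {ffun 'I_N -> 'I_M}) (N`!%:R ^+ 2 * PA * PB) *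
   \sum_(psi : {ffun 'I_N -> 'I_M} | injectiveb psi)
     \prod_a ((phi a).+1%:R * expw y (phi a) * (chebN (phi a) (psi a))%:R ^+ 2))).
  apply: ler_sum => phi _.
  have hS : 0 <= cheb_inj_sum R phi.
    by apply: sumr_ge0 => psi _; apply: prodr_ge0.
  have h0 : 0 <= \prod_a expw (4 * y) (phi a).
    by apply: prodr_ge0 => a _; exact: expw_ge0.
  have hP : 0 <= \prod_a (2^-1 ^+ phi a : R) by apply: prodr_ge0.
  have := ler_pM (normr_ge0 _) (normr_ge0 _) (det_cheb_le phi hA hTA) (det_cheb_le phi hB hTB).
  move/(ler_wpM2l h0); rewrite mulrA => /le_trans; apply.
  rewrite -/PA -/PB.
  have -> : (\prod_a expw (4 * y) (phi a)) *
     ((\prod_a 2^-1 ^+ phi a) * (N`!%:R * PA) * cheb_inj_sum R phi *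
     ((\prod_a 2^-1 ^+ phi a) * (N`!%:R * PB) * cheb_inj_sum R phi)) =
     (N`!%:R ^+ 2 * PA * PB) * (((\prod_a expw (4 * y) (phi a)) *
       (\prod_a 2^-1 ^+ phi a) * (\prod_a 2^-1 ^+ phi a)) * cheb_inj_sum R phi ^+ 2).
    by ring.
  apply: ler_wpM2l; first by rewrite !mulr_ge0 // exprn_ge0.
  rewrite -!big_split /=.
  have -> : \prod_(i < N) (expw (4 * y) (phi i) * 2^-1 ^+ phi i * 2^-1 ^+ phi i) =
     \prod_(i < N) expw y (phi i).
    apply: eq_bigr => i _; rewrite /expw exprMn.
    rewrite (_ : 4 ^+ phi i = (2 ^+ phi i) ^+ 2 :> R); last first.
      by rewrite exprAC; congr (_ ^+ _); ring.
    rewrite exprVn; field.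
    by rewrite pnatr_eq0 -lt0n fact_gt0 expf_neq0.
  have h1 : 0 <= \prod_a expw y (phi a).
    by apply: prodr_ge0 => a _; exact: expw_ge0 (ltW y0).
  apply: le_trans (ler_wpM2l h1 (cheb_inj_sum_sqr R phi)) _.
  rewrite mulrA mulr_sumr le_eqVlt; apply/orP; left; apply/eqP.
  by apply: eq_bigr => psi _; rewrite -!big_split /=; apply: eq_bigr => a _; ring.
rewrite -mulr_sumr exchange_big /=.
have hx (psi : {ffun 'I_N -> 'I_M}) : \sum_(phi : {ffun 'I_N -> 'I_M})
     \prod_a ((phi a).+1%:R * expw y (phi a) * (chebN (phi a) (psi a))%:R ^+ 2) <=
     (8 * expR (16 * y)) ^+ N * \prod_(a < N) kexpw y (psi a).
  rewrite -(bigA_distr_bigA (fun a (m : 'I_M) =>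
      m.+1%:R * expw y m * (chebN m (psi a))%:R ^+ 2)).
  rewrite [_ ^+ N]expr_prod_ord -!big_split /=.
  apply: ler_prod => a _; apply/andP; split; last exact: chebN_sum_le (ltW y0).
  apply: sumr_ge0 => m _; apply: mulr_ge0; last exact: sqr_ge0.
  by apply: mulr_ge0 => //; exact: expw_ge0 (ltW y0).
apply: (@le_trans _ _ (N`!%:R ^+ 2 * PA * PB * ((8 * expR (16 * y)) ^+ N *
   (expR 2 * (N%:R * (N.+2%:R * expR y)) ^+ N * \prod_(k < N) kexpw y k)))).
  apply: ler_wpM2l; first by rewrite !mulr_ge0 // exprn_ge0.
  apply: le_trans (ler_sum _ (fun psi _ => hx psi)) _.
  rewrite -mulr_sumr; apply: ler_wpM2l; last exact: inj_sum_kexpw.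
  by rewrite exprn_ge0 // mulr_ge0 // expR_ge0.
have -> : \prod_(k < N) kexpw y k = N`!%:R * \prod_(k < N) expw y k.
  by rewrite big_split /= fact_prod natr_prod big_add1 /= big_mkord.
have D0 : 0 <= \prod_(k < N) expw y k.
  by apply: prodr_ge0 => k _; exact: expw_ge0 (ltW y0).
have -> : N`!%:R ^+ 2 * PA * PB * ((8 * expR (16 * y)) ^+ N *
   (expR 2 * (N%:R * (N.+2%:R * expR y)) ^+ N * (N`!%:R * \prod_(k < N) expw y k))) =
   N`!%:R * ((expR 2 * ((8 * expR (16 * y)) ^+ N * expR y ^+ N) *
     (N`!%:R * N`!%:R * N%:R ^+ N * N.+2%:R ^+ N)) * PA * PB * \prod_(k < N) expw y k).
  by rewrite !exprMn; ring.
apply: ler_wpM2l => //; apply: ler_wpM2r => //; apply: ler_wpM2r => //; apply: ler_wpM2r => //.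
rewrite /minor_loss.
have -> : 17 * y = 16 * y + y by ring.
have -> : expR 2 * (8 * N.+2%:R ^+ 4 * expR (16 * y + y)) ^+ N =
  (expR 2 * ((8 * expR (16 * y)) ^+ N * expR y ^+ N) *
     (N.+2%:R ^+ N * N.+2%:R ^+ N * N.+2%:R ^+ N * N.+2%:R ^+ N)) :> R.
  by rewrite (expRD (16 * y) y) !exprMn; ring.
apply: ler_wpM2l; first by rewrite !mulr_ge0 ?expR_ge0 ?exprn_ge0 ?mulr_ge0 ?expR_ge0.
rewrite -!natrX -!natrM ler_nat.
have hN := fact_le_exp N.
by rewrite !leq_mul // leq_exp2r //; lia.
Qed.

(** * Recovering the constant coefficient from values near 1 *)

(** The weights are the coefficients of the polynomial
    prod_k (X - q^(k+1)) / (1 - q^(k+1)).  At X = q^r it vanishes for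
    0 < r <= D and equals 1 for r = 0: on sequences of values at 1, q, ..., q^D
    it kills the monomials of degree 1 to D and preserves constants. *)
Lemma qbinom_weights (R : realFieldType) (q : R) (D : nat) : 0 < q -> q < 1 ->
  exists c : nat -> R,
    (forall r : nat, \sum_(i < D.+1) c i * q ^+ (i * r) =
       \prod_(k < D) ((q ^+ r - q ^+ k.+1) / (1 - q ^+ k.+1))) /\
    \sum_(i < D.+1) `|c i| <= \prod_(k < D) ((1 + q ^+ k.+1) / (1 - q ^+ k.+1)).
Proof.
move=> q0 q1; elim: D => [|D [c [hc hs]]].
  exists (fun=> 1); split=> [r|]; rewrite big_ord1 big_ord0 ?mul0n ?expr0 ?mulr1 //.
  by rewrite normr1.
set Q := q ^+ D.+1.
have Q0 : 0 < Q by rewrite exprn_gt0.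
have Q1 : 0 < 1 - Q by rewrite subr_gt0 exprn_ilt1 // ltW.
(* s and t are the coefficients of X times, and of, the polynomial of degree D. *)
pose s i := if i is j.+1 then c j else 0.
pose t i := if (i < D.+1)%N then c i else 0.
have sS r : \sum_(i < D.+2) s i * q ^+ (i * r) = q ^+ r * \sum_(i < D.+1) c i * q ^+ (i * r).
  rewrite big_ord_recl /= mul0r add0r mulr_sumr; apply: eq_bigr => i _.
  by rewrite /= /bump /= add1n mulSn exprD mulrCA.
have tS r : \sum_(i < D.+2) t i * q ^+ (i * r) = \sum_(i < D.+1) c i * q ^+ (i * r).
  rewrite big_ord_recr /= /t ltnn mul0r addr0; apply: eq_bigr => i _.
  by rewrite /= ltn_ord.
exists (fun i => (s i - Q * t i) / (1 - Q)); split.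
  move=> r; rewrite [RHS]big_ord_recr /= -hc -/Q.
  transitivity (((\sum_(i < D.+2) s i * q ^+ (i * r)) -
     Q * \sum_(i < D.+2) t i * q ^+ (i * r)) / (1 - Q)).
    rewrite mulr_sumr -sumrB mulr_suml; apply: eq_bigr => i _.
    by ring.
  by rewrite sS tS; ring.
rewrite [leRHS]big_ord_recr /= -/Q.
apply: (@le_trans _ _ ((\sum_(i < D.+2) `|s i| + Q * \sum_(i < D.+2) `|t i|) / (1 - Q))).
  rewrite mulr_sumr -big_split mulr_suml /=; apply: ler_sum => i _.
  rewrite normrM (ger0_norm (ltW (_ : 0 < (1 - Q)^-1))) ?invr_gt0 //.
  apply: ler_wpM2r; first by rewrite invr_ge0 ltW.
  by apply: le_trans (ler_normB _ _) _; rewrite normrM (ger0_norm (ltW Q0)).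
have -> : \sum_(i < D.+2) `|s i| = \sum_(i < D.+1) `|c i|.
  by rewrite big_ord_recl /= normr0 add0r; apply: eq_bigr.
have -> : \sum_(i < D.+2) `|t i| = \sum_(i < D.+1) `|c i|.
  rewrite big_ord_recr /= /t ltnn normr0 addr0; apply: eq_bigr => i _.
  by rewrite /= ltn_ord.
move: hs; move: (\sum_(i < D.+1) `|c i|) => C hs.
have -> : (C + Q * C) / (1 - Q) = C * ((1 + Q) / (1 - Q)) by ring.
by apply: ler_wpM2r hs; apply: divr_ge0; [apply: addr_ge0 => // | ]; exact: ltW.
Qed.

(** 1 - q^j is (1 - q) times a sum of [j] powers of [q], each at least q^j. *)
Lemma one_sub_expr_ge (R : realFieldType) (q : R) (j : nat) : 0 <= q -> q <= 1 ->
  j%:R * (1 - q) * q ^+ j <= 1 - q ^+ j.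
Proof.
move=> q0 q1; elim: j => [|j IH]; first by rewrite !mul0r expr0 subrr.
have qj0 : 0 <= q ^+ j by exact: exprn_ge0.
have qj1 : q ^+ j <= 1 by rewrite exprn_ile1.
have j0 : 0 <= (j%:R : R) by [].
rewrite exprS -[in X in X <= _]addn1 natrD.
have h : j%:R * (1 - q) * (q * q ^+ j) <= j%:R * (1 - q) * q ^+ j.
  apply: ler_wpM2l; first by rewrite mulr_ge0 // subr_ge0.
  by rewrite ler_piMl.
have h2 : (1 - q) * (q * q ^+ j) <= (1 - q) * q ^+ j.
  apply: ler_wpM2l; first by rewrite subr_ge0.
  by rewrite ler_piMl.
lra.
Qed.

Lemma bernoulli_sub (R : realFieldType) (x : R) (D : nat) : 0 <= x -> x <= 1 ->
  1 - D%:R * x <= (1 - x) ^+ D.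
Proof.
move=> x0 x1; elim: D => [|D IH]; first by rewrite expr0 mul0r subr0.
have D0 : 0 <= (D%:R : R) by [].
rewrite exprS -[in X in X <= _]addn1 natrD.
have h : (1 - x) * (1 - D%:R * x) <= (1 - x) * (1 - x) ^+ D.
  by apply: ler_wpM2l IH; rewrite subr_ge0.
by apply: le_trans h; nra.
Qed.

(** With q^D >= 1 - delta >= 1/2 each 1 - q^k is at least k delta / (2 D), and
    D^D / D! <= e^D. *)
Lemma qprod_le (R : realType) (delta : R) (D : nat) :
  (0 < D)%N -> 0 < delta -> delta <= 2^-1 ->
  \prod_(k < D) (2 / (1 - (1 - delta / D%:R) ^+ k.+1)) <= (4 * expR 1 / delta) ^+ D.
Proof.
move=> D0 d0 d1; set q := 1 - _.
have D0' : 0 < (D%:R : R) by rewrite ltr0n.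
have D1 : 1 <= (D%:R : R) by rewrite ler1n.
have dD0 : 0 < delta / D%:R by rewrite divr_gt0.
have dD1 : delta / D%:R <= 2^-1.
  by rewrite ler_pdivrMr //; apply: le_trans d1 _; rewrite ler_peMr // invr_ge0.
have h21 : (2^-1 : R) <= 1 by lra.
have q0 : 0 <= q by rewrite subr_ge0; apply: le_trans dD1 h21.
have q1 : q <= 1 by rewrite gerBl ltW.
have qD : 2^-1 <= q ^+ D.
  apply: le_trans (bernoulli_sub _ (ltW dD0) (le_trans dD1 h21)).
  by rewrite mulrC divfK ?gt_eqF //; lra.
have hk (k : 'I_D) : k.+1%:R * delta / (2 * D%:R) <= 1 - q ^+ k.+1.
  apply: le_trans (one_sub_expr_ge _ q0 q1).
  have -> : 1 - q = delta / D%:R by rewrite /q; ring.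
  have -> : k.+1%:R * delta / (2 * D%:R) = k.+1%:R * (delta / D%:R) * 2^-1.
    by field; rewrite gt_eqF.
  apply: ler_wpM2l; first by rewrite mulr_ge0 // ltW.
  by apply: le_trans qD _; rewrite ler_wiXn2l.
have kd0 (k : 'I_D) : 0 < k.+1%:R * delta / (2 * D%:R).
  by rewrite divr_gt0 // mulr_gt0.
apply: (@le_trans _ _ (\prod_(k < D) (4 * D%:R / delta * k.+1%:R^-1))).
  apply: ler_prod => k _; rewrite divr_ge0 //=; last first.
    by apply: le_trans (hk k); exact: ltW.
  have -> : 4 * D%:R / delta * k.+1%:R^-1 = 2 * (k.+1%:R * delta / (2 * D%:R))^-1.
    by field; rewrite nat1r !gt_eqF.
  apply: ler_wpM2l => //.
  by rewrite lef_pV2 ?posrE //; exact: lt_le_trans (kd0 k) (hk k).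
rewrite big_split /= -expr_prod_ord.
have -> : \prod_(i < D) (i.+1%:R^-1 : R) = D`!%:R^-1.
  rewrite fact_prod natr_prod big_add1 /= big_mkord prodfV.
  by [].
have -> : (4 * D%:R / delta) ^+ D / D`!%:R = (4 / delta) ^+ D * expw D%:R D.
  by rewrite /expw mulrA -exprMn; congr (_ ^+ _ / _); ring.
have -> : (4 * expR 1 / delta) ^+ D = (4 / delta) ^+ D * expR D%:R :> R.
  by rewrite -[in RHS](mulr1 D%:R) expRM_natl -exprMn; congr (_ ^+ _); ring.
apply: ler_wpM2l; first by rewrite exprn_ge0 // divr_ge0 // ltW.
exact: expX_fact_le (ltW D0').
Qed.

(** A Remez type inequality.  Apply the weights to the values of
    g0 + sum_i w_i th^(r_i) at th = q^j: the terms of degree at most [D] drop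
    out, and those of higher degree are at most rho^-D times a bound for the
    growth at radius [rho].  The weights depend on [delta] and [D] only, which
    permits to pass to a limit in the function. *)
Lemma finite_remez (R : realType) (delta : R) (D : nat) :
  (0 < D)%N -> 0 < delta -> delta <= 2^-1 ->
  exists c : nat -> R,
    \sum_(i < D.+1) `|c i| <= (4 * expR 1 / delta) ^+ D /\
    forall (I : finType) (w : I -> R) (r : I -> nat) (g0 rho W : R),
      1 <= rho ->
      (forall i, w i != 0 -> (0 < r i)%N) ->
      \sum_i `|w i| * rho ^+ r i <= `|g0| * W ->
      2 * (W * (4 * expR 1 / delta) ^+ D) <= rho ^+ D ->
      `|g0| <= 2 * \sum_(j < D.+1)
         `|c j| * `|g0 + \sum_i w i * ((1 - delta / D%:R) ^+ j) ^+ r i|.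
Proof.
move=> D0 d0 d1.
set q := 1 - delta / D%:R.
have D0' : 0 < (D%:R : R) by rewrite ltr0n.
have D1 : 1 <= (D%:R : R) by rewrite ler1n.
have dD0 : 0 < delta / D%:R by rewrite divr_gt0.
have dD1 : delta / D%:R <= 2^-1.
  by rewrite ler_pdivrMr //; apply: le_trans d1 _; rewrite ler_peMr // invr_ge0.
have q0 : 0 < q by rewrite subr_gt0; apply: le_lt_trans dD1 _; lra.
have q1 : q < 1 by rewrite gtrBl.
have := qprod_le D0 d0 d1; rewrite -/q.
set L := (4 * expR 1 / delta) ^+ D => hL.
have qk k : 0 < 1 - q ^+ k.+1 by rewrite subr_gt0 exprn_ilt1 // ltW.
have [c [hc hs]] := qbinom_weights D q0 q1.
exists c; split.
  apply: le_trans hs (le_trans _ hL); apply: ler_prod => k _.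
  apply/andP; split.
    apply: divr_ge0; last exact: ltW (qk k).
    by rewrite addr_ge0 ?exprn_ge0 ?(ltW q0).
  apply: ler_wpM2r; first by rewrite invr_ge0 ltW.
  have := qk k; lra.
move=> I w r g0 rho W rho1 hr hW hD.
have rho0 : 0 < rho by apply: lt_le_trans rho1.
pose P n := \prod_(k < D) ((q ^+ n - q ^+ k.+1) / (1 - q ^+ k.+1)).
have P0 : P 0%N = 1.
  by rewrite /P big1 // => k _; rewrite expr0 divff // gt_eqF.
have Psmall n : (0 < n)%N -> (n <= D)%N -> P n = 0.
  move=> n0 nD; have h : (n.-1 < D)%N by rewrite prednK.
  by rewrite /P (bigD1 (Ordinal h)) //= prednK // subrr !mul0r.
have Pbound n : `|P n| <= L.
  apply: le_trans hL; rewrite normr_prod; apply: ler_prod => k _.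
  rewrite normr_ge0 /= normrM [X in _ * X]ger0_norm ?invr_ge0 ?(ltW (qk k)) //.
  apply: ler_wpM2r; first by rewrite invr_ge0 ltW.
  have a1 : 0 <= q ^+ n <= 1 by rewrite exprn_ge0 ?exprn_ile1 ?(ltW q0) ?(ltW q1).
  have a2 : 0 <= q ^+ k.+1 <= 1 by rewrite exprn_ge0 ?exprn_ile1 ?(ltW q0) ?(ltW q1).
  move: a1 a2; move: (q ^+ n) (q ^+ k.+1) => a b /andP[? ?] /andP[? ?].
  rewrite ler_norml; lra.
have L0 : 0 <= L by apply: le_trans (Pbound 0%N).
have key : \sum_(j < D.+1) c j * (g0 + \sum_i w i * (q ^+ j) ^+ r i) =
   g0 + \sum_i w i * P (r i).
  under eq_bigr do rewrite mulrDr mulr_sumr.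
  rewrite big_split /= exchange_big /= -mulr_suml; congr (_ + _).
    have := hc 0%N; rewrite -/(P 0%N) P0; under eq_bigr do rewrite muln0 expr0 mulr1.
    by move=> ->; rewrite mul1r.
  apply: eq_bigr => i _; rewrite /P -hc mulr_sumr; apply: eq_bigr => j _.
  by rewrite mulrCA exprM.
have tail : `|\sum_i w i * P (r i)| <= 2^-1 * `|g0|.
  apply: (le_trans (ler_norm_sum _ _ _)).
  apply: (@le_trans _ _ (L / rho ^+ D * \sum_i `|w i| * rho ^+ r i)).
    rewrite mulr_sumr; apply: ler_sum => i _; rewrite normrM.
    have [->|wi0] := eqVneq (w i) 0; first by rewrite normr0 !mul0r mulr0.
    have ri0 := hr i wi0.
    have rhs0 : 0 <= L / rho ^+ D * (`|w i| * rho ^+ r i).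
      have rn n : 0 <= rho ^+ n by rewrite exprn_ge0 // ltW.
      by apply: mulr_ge0; [exact: divr_ge0 | exact: mulr_ge0].
    case: (leqP (r i) D) => h; first by rewrite Psmall // normr0 mulr0.
    rewrite mulrC; apply: (@le_trans _ _ (L * `|w i|)); first exact: ler_wpM2r.
    have -> : L / rho ^+ D * (`|w i| * rho ^+ r i) = L * `|w i| * (rho ^+ r i / rho ^+ D).
      by ring.
    rewrite ler_peMr //; first exact: mulr_ge0.
    by rewrite ler_pdivlMr ?exprn_gt0 // mul1r ler_weXn2l // ltnW.
  apply: (@le_trans _ _ (L / rho ^+ D * (`|g0| * W))).
    by apply: ler_wpM2l hW; rewrite divr_ge0 // exprn_ge0 // ltW.
  have -> : L / rho ^+ D * (`|g0| * W) = `|g0| * (2^-1 * ((2 * (W * L)) / rho ^+ D)).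
    by field; rewrite gt_eqF // exprn_gt0.
  rewrite mulrC; apply: ler_wpM2r => //.
  by rewrite ler_piMr // ?invr_ge0 // ler_pdivrMr ?exprn_gt0 // mul1r.
have h1 : `|\sum_(j < D.+1) c j * (g0 + \sum_i w i * (q ^+ j) ^+ r i)| <=
   \sum_(j < D.+1) `|c j| * `|g0 + \sum_i w i * (q ^+ j) ^+ r i|.
  by apply: (le_trans (ler_norm_sum _ _ _)); apply: ler_sum => j _; rewrite normrM.
rewrite key in h1.
have h2 := lerB_normD g0 (\sum_i w i * P (r i)).
move: h1 h2 tail.
set S := \sum_(j < D.+1) _; move: (\sum_i _) => T; move: (`|g0|) (`|T|) (`|g0 + T|) => a b d.
lra.
Qed.

(** * Chebyshev polynomials and nodes *)

Fixpoint chebT (R : pzRingType) (k : nat) (x : R) : R :=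
  if k is k1.+1 then
    if k1 is k2.+1 then 2 * x * chebT k1 x - chebT k2 x else x
  else 1.

Lemma chebTSS (R : pzRingType) (k : nat) (x : R) :
  chebT k.+2 x = 2 * x * chebT k.+1 x - chebT k x.
Proof. by []. Qed.

Lemma chebT_cos (R : realType) (k : nat) (t : R) : chebT k (cos t) = cos (k%:R * t).
Proof.
suff : chebT k (cos t) = cos (k%:R * t) /\ chebT k.+1 (cos t) = cos (k.+1%:R * t) by case.
elim: k => [|k [h1 h2]]; first by rewrite /= mul0r cos0 mul1r.
split=> //; rewrite chebTSS h1 h2.
have -> : k.+2%:R * t = k.+1%:R * t + t by rewrite -[in LHS]addn1 natrD; ring.
have -> : k%:R * t = k.+1%:R * t - t by rewrite -[in RHS]addn1 natrD; ring.
by rewrite cosB cosD; ring.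
Qed.

Lemma chebT_norm_le1 (R : realType) (k : nat) (x : R) : `|x| <= 1 -> `|chebT k x| <= 1.
Proof.
rewrite ler_norml => h.
by rewrite -(@acosK _ x) ?in_itv // chebT_cos cos_max.
Qed.

(** The index |m - 2 r| of [chebN]. *)
Definition chebix (m r : nat) : nat := ((m - r.*2) + (r.*2 - m))%N.

(** The recurrence 2 x T_j = T_(j+1) + T_(j-1), valid for all integers j when
    T_j stands for T_|j|. *)
Lemma chebT_mul2x (R : comPzRingType) (m r : nat) (x : R) :
  2 * x * chebT (chebix m r) x = chebT (chebix m.+1 r) x + chebT (chebix m.+1 r.+1) x.
Proof.
have [h|h|h] := ltngtP m r.*2.
- have [k hk] : exists k, r.*2 = (m + k.+1)%N by exists (r.*2 - m).-1; lia.
  have -> : chebix m r = k.+1 by rewrite /chebix; lia.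
  have -> : chebix m.+1 r = k by rewrite /chebix; lia.
  have -> : chebix m.+1 r.+1 = k.+2 by rewrite /chebix; lia.
  by rewrite chebTSS; ring.
- have [k hk] : exists k, m = (r.*2 + k.+1)%N by exists (m - r.*2).-1; lia.
  have -> : chebix m r = k.+1 by rewrite /chebix; lia.
  have -> : chebix m.+1 r = k.+2 by rewrite /chebix; lia.
  have -> : chebix m.+1 r.+1 = k by rewrite /chebix; lia.
  by rewrite chebTSS; ring.
- have -> : chebix m r = 0%N by rewrite /chebix; lia.
  have -> : chebix m.+1 r = 1%N by rewrite /chebix; lia.
  have -> : chebix m.+1 r.+1 = 1%N by rewrite /chebix; lia.
  by rewrite /=; ring.
Qed.

(** Pascal's rule applied to the recurrence. *)
Lemma expr_chebT_bin (R : comPzRingType) (m : nat) (x : R) :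
  (2 * x) ^+ m = \sum_(r < m.+1) 'C(m, r)%:R * chebT (chebix m r) x.
Proof.
elim: m => [|m IH]; first by rewrite big_ord1 bin0 expr0 /= mulr1.
rewrite exprS IH mulr_sumr.
under eq_bigr do rewrite mulrCA chebT_mul2x mulrDr.
rewrite big_split /=.
have -> : \sum_(r < m.+1) 'C(m, r)%:R * chebT (chebix m.+1 r) x =
          \sum_(r < m.+2) 'C(m, r)%:R * chebT (chebix m.+1 r) x.
  by rewrite [RHS]big_ord_recr /= bin_small // mul0r addr0.
rewrite [X in X + _ = _]big_ord_recl [RHS]big_ord_recl /= !bin0 -[LHS]addrA; congr (_ + _).
rewrite -big_split /=; apply: eq_bigr => r _.
by rewrite /bump /= add1n binS natrD mulrDl.
Qed.

Lemma expr_chebT (R : numFieldType) (m M : nat) (x : R) : (m < M)%N ->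
  x ^+ m = 2^-1 ^+ m * \sum_(k < M) (chebN m k)%:R * chebT k x.
Proof.
move=> mM.
have -> : \sum_(k < M) (chebN m k)%:R * chebT k x =
   \sum_(r < m.+1) 'C(m, r)%:R * chebT (chebix m r) x.
  under eq_bigr do rewrite natr_sum mulr_suml.
  under eq_bigr do rewrite big_mkcond.
  rewrite exchange_big /=; apply: eq_bigr => r _.
  have hr : (chebix m r < M)%N by have := ltn_ord r; rewrite /chebix; lia.
  rewrite (bigD1 (Ordinal hr)) //= eqxx big1 ?addr0 // => k hk.
  case: eqP => // e; case/eqP: hk; apply/val_inj => /=.
  by rewrite -e.
by rewrite -expr_chebT_bin -exprMn mulKf // pnatr_eq0.
Qed.

Section ChebNodes.
Variables (R : realType) (N : nat).

Definition cheb_angle (i : 'I_N) : R := (2 * i%:R + 1) * pi / (2 * N%:R).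
Definition cheb_node (i : 'I_N) : R := cos (cheb_angle i).

(** After multiplication by 2 sin h, with h half of the step of the angles, the
    sum telescopes from sin 0 to sin (m pi). *)
Lemma sum_cos_nodes (m : nat) : (0 < m)%N -> (m < 2 * N)%N ->
  \sum_i cos (m%:R * cheb_angle i) = 0.
Proof.
move=> m0 mN.
have N0 : 0 < (N%:R : R) by rewrite ltr0n; lia.
have m0' : 0 < (m%:R : R) by rewrite ltr0n.
set h := m%:R * pi / (2 * N%:R) : R.
have sh : 0 < sin h.
  apply: sin_gt0_pi; apply/andP; split.
    by rewrite divr_gt0 ?mulr_gt0 ?pi_gt0.
  rewrite ltr_pdivrMr ?mulr_gt0 // mulrC ltr_pM2l ?pi_gt0 //.
  by rewrite -natrM ltr_nat.
pose F i : R := sin (2 * i%:R * h).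
have step (i : 'I_N) : 2 * sin h * cos (m%:R * cheb_angle i) = F i.+1 - F i.
  have -> : m%:R * cheb_angle i = 2 * i%:R * h + h.
    by rewrite /cheb_angle /h; ring.
  rewrite /F; have -> : 2 * i.+1%:R * h = (2 * i%:R * h + h) + h.
    by rewrite -[in LHS]addn1 natrD; ring.
  have -> : 2 * i%:R * h = (2 * i%:R * h + h) - h by ring.
  by rewrite !subrK sinB sinD; ring.
have e : 2 * sin h * \sum_i cos (m%:R * cheb_angle i) = 0.
  rewrite mulr_sumr; under eq_bigr do rewrite step.
  rewrite -(big_mkord xpredT (fun i => F i.+1 - F i)) telescope_sumr //.
  rewrite /F mulr0 mul0r sin0 subr0.
  have -> : 2 * N%:R * h = 0 + pi *+ m by rewrite /h -mulr_natl; field; rewrite gt_eqF.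
  by rewrite (alternatingn (@sinDpi R)) sin0 mulr0.
by move/eqP: e; rewrite mulf_eq0 gt_eqF ?mulr_gt0 //= => /eqP.
Qed.

Lemma cheb_nodes_orth (j k : 'I_N) :
  \sum_i chebT j (cheb_node i) * chebT k (cheb_node i) =
  if j == k then (if j == 0%N :> nat then N%:R else N%:R / 2) else 0.
Proof.
have [hj hk] := (ltn_ord j, ltn_ord k).
wlog jk : j k hj hk / (j <= k)%N.
  move=> H; case: (leqP j k) => h; first exact: H.
  under eq_bigr do rewrite mulrC.
  rewrite (H k j) ?(ltnW h) // eq_sym; case: eqP => // ->.
  by [].
under eq_bigr do rewrite !chebT_cos.
have e (i : 'I_N) : cos (j%:R * cheb_angle i) * cos (k%:R * cheb_angle i) =
   2^-1 * (cos ((k - j)%:R * cheb_angle i) + cos ((k + j)%:R * cheb_angle i)).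
  by rewrite natrB // natrD mulrBl mulrDl cosB cosD [sin (k%:R * _) * _]mulrC; field.
under eq_bigr do rewrite e.
rewrite -mulr_sumr big_split /=.
have sN : \sum_(i < N) cos (0%:R * cheb_angle i) = N%:R.
  under eq_bigr do rewrite mul0r cos0.
  by rewrite sumr_const card_ord.
case: eqP => [->|ne].
  rewrite subnn sN; case: eqP => [->|k0].
    by rewrite addn0 sN; field.
  by rewrite sum_cos_nodes; [ring|lia|lia].
have ne' : (j : nat) <> k by move=> h; apply: ne; exact: val_inj.
by rewrite !sum_cos_nodes ?addr0 ?mulr0 //; lia.
Qed.

(** Discrete orthogonality makes the product of the matrix with its transpose
    diagonal, with entries [N] and [N / 2], all at least 1. *)
Lemma det_chebT_nodes :
  1 <= `|\det (\matrix_(j < N, i < N) chebT j (cheb_node i))|.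
Proof.
set C := \matrix_(j < N, i < N) _.
pose d : 'rV[R]_N := \row_j (if j == 0%N :> nat then N%:R else N%:R / 2).
have CC : C *m C^T = diag_mx d.
  apply/matrixP => j k; rewrite !mxE.
  under eq_bigr do rewrite !mxE.
  by rewrite cheb_nodes_orth; case: eqP => _; rewrite ?mulr1n ?mulr0n.
have : 1 <= \det C ^+ 2.
  rewrite expr2 -{2}det_tr -det_mulmx CC det_diag.
  rewrite -[leLHS](_ : \prod_(i < N) (1 : R) = 1); last by rewrite big1.
  apply: ler_prod => i _; rewrite ler01 mxE /=.
  have := ltn_ord i; case: eqP => [_|i0] hi; first by rewrite ler1n; lia.
  by rewrite ler_pdivlMr // mul1r ler_nat; lia.
by rewrite -real_normK ?num_real // -[X in X <= _ -> _](expr1n _ 2) ler_sqr ?nnegrE.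
Qed.

(** The Vandermonde matrix factors through the values of the Chebyshev
    polynomials; the other factor is triangular, with diagonal entries at least
    2^-k. *)
Lemma det_node_powers :
  \prod_(k < N) (2^-1 : R) ^+ k <= `|\det (\matrix_(k < N, i < N) cheb_node i ^+ k)|.
Proof.
set V := \matrix_(k < N, i < N) _.
pose L : 'M[R]_N := \matrix_(k < N, j < N) (2^-1 ^+ k * (chebN k j)%:R).
have -> : V = L *m \matrix_(j < N, i < N) chebT j (cheb_node i).
  apply/matrixP => k i; rewrite !mxE (expr_chebT _ (ltn_ord k)) mulr_sumr.
  by apply: eq_bigr => j _; rewrite !mxE mulrA.
rewrite det_mulmx normrM det_trig; last first.
  by apply/is_trig_mxP => k j kj; rewrite mxE chebN_gt // mulr0.
have h0 m : 0 <= (2^-1 : R) ^+ m by rewrite exprn_ge0 // invr_ge0.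
have h1 : \prod_(k < N) (2^-1 : R) ^+ k <= `|\prod_(k < N) L k k|.
  rewrite normr_prod; apply: ler_prod => k _; rewrite h0 mxE /=.
  rewrite ger0_norm ?mulr_ge0 //.
  by rewrite ler_peMr // ler1n chebN_diag.
apply: le_trans h1 _.
by rewrite ler_peMr // det_chebT_nodes.
Qed.

End ChebNodes.

Local Open Scope classical_set_scope.
Local Open Scope ring_scope.

(** * The kernel cos + sin and its determinants at Chebyshev nodes *)

(** The Taylor coefficients of cos (c x) + sin (c x) at 0. *)
Definition cas_coeff (R : realType) (c : R) (m : nat) : R := (-1) ^+ m./2 * expw c m.

Lemma norm_cas_coeff (R : realType) (c : R) (m : nat) : 0 <= c -> `|cas_coeff c m| = expw c m.
Proof. by move=> c0; rewrite normrM normrX normrN1 expr1n mul1r ger0_norm // expw_ge0. Qed.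

Definition cas_series (R : realType) (c : R) (u : nat -> R) : R :=
  limn (fun M => \sum_(m < M) cas_coeff c m * u m).

Lemma cas_series_cvg (R : realType) (c C : R) (u : nat -> R) : 0 <= c ->
  (forall m, `|u m| <= C) ->
  (fun M => \sum_(m < M) cas_coeff c m * u m) @ \oo --> cas_series c u.
Proof.
move=> c0 hu; apply: cvgP.
pose v m := cas_coeff c m * u m.
have -> : (fun M => \sum_(m < M) cas_coeff c m * u m) = series v.
  by apply/funext => M; rewrite /series /= big_mkord.
have C0 : 0 <= C by apply: le_trans (hu 0%N).
apply: normed_cvg; rewrite /=.
apply: (@series_le_cvg _ _ (C *: exp_coeff c)) => [n|n|n|].
- exact: normr_ge0.
- by apply: mulr_ge0 => //; apply: exp_coeff_ge0.
- rewrite /= /v normrM norm_cas_coeff // mulrC; apply: ler_wpM2r; first exact: expw_ge0.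
  exact: hu.
- apply: is_cvg_seriesZ; exact: is_cvg_series_exp_coeff.
Qed.

Lemma det_cvg (R : realType) (N : nat) (A : nat -> 'M[R]_N) (B : 'M[R]_N) :
  (forall i j, (fun M => A M i j) @ \oo --> B i j) ->
  (fun M => \det (A M)) @ \oo --> \det B.
Proof.
move=> h; apply: cvg_big; first exact: add_continuous.
move=> s _; apply: cvgM; first exact: cvg_cst.
apply: cvg_big => [|i _]; first exact: mul_continuous.
exact: h.
Qed.

(** Write the sum of [f] as the sum over t of the number of [a] with f a > t.  By
    injectivity this number is at least N - (t + 1), and for t = N - 1 it is
    positive. *)
Lemma sum_inj_gt (N : nat) (f : 'I_N -> nat) : injective f ->
  (exists a, (N <= f a)%N) -> (\sum_(k < N) k < \sum_a f a)%N.
Proof.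
move=> inj [a0 ha0].
have h1 a : (\sum_(t < N) (t < f a) <= f a)%N.
  have : (\sum_(t < N) (t < f a) <= \sum_(t < N + f a) (t < f a))%N.
    by rewrite big_split_ord /= leq_addr.
  move/leq_trans; apply.
  rewrite addnC big_split_ord /= [X in (_ + X)%N]big1 ?addn0; last by move=> i _; lia.
  by rewrite (eq_bigr (fun=> 1%N)) ?sum1_card ?card_ord // => i _; rewrite ltn_ord.
have h2 : (\sum_(t < N) \sum_a (t < f a) <= \sum_a f a)%N.
  by rewrite exchange_big /=; apply: leq_sum => a _.
apply: leq_trans h2.
have h3 (t : 'I_N) : (N - t.+1 <= \sum_a (t < f a))%N.
  have e : (\sum_(a < N) (t < f a) + \sum_(a < N) (f a <= t) = N)%N.
    rewrite -big_split /= -[RHS](card_ord N) -sum1_card; apply: eq_bigr => a _.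
    by case: ltnP.
  have : (\sum_(a < N) (f a <= t) <= t.+1)%N.
    have -> : (\sum_(a < N) (f a <= t) = #|[set a | (f a <= t)%N]%SET|)%N.
      by rewrite -sum1dep_card [RHS]big_mkcond; apply: eq_bigr => a _; case: leqP.
    have inj' : {in [set a | (f a <= t)%N]%SET &, injective (fun a => inord (f a) : 'I_t.+1)}.
      move=> a b; rewrite !inE => ha hb /(congr1 val) /=.
      by rewrite !inordK ?ltnS // => /inj.
    by rewrite -(card_in_imset inj'); apply: leq_trans (max_card _) _; rewrite card_ord.
  by move=> h; rewrite leq_subLR addnC -[leqLHS]e leq_add2l.
have N0 : (0 < N)%N by apply: leq_ltn_trans (ltn_ord a0).
have hl : (N.-1 < N)%N by rewrite prednK.
have -> : (\sum_(k < N) k = \sum_(t < N) (N - t.+1))%N.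
  by rewrite (reindex_inj rev_ord_inj).
rewrite (bigD1 (Ordinal hl)) //= [leqRHS](bigD1 (Ordinal hl)) //=.
rewrite prednK // subnn add0n -add1n; apply: leq_add; last exact: leq_sum.
rewrite (bigD1 a0) //= ha0.
by rewrite leq_addr.
Qed.

Section LowerBound.
Variables (R : realType) (N : nat) (c : R).
Hypotheses (N0 : (0 < N)%N) (c0 : 0 < c).

Let s := @cheb_node R N.

Definition cas_trunc (M : nat) (th : R) : 'M[R]_N :=
  \matrix_(a, b) \sum_(m < M) cas_coeff c m * ((th * s a) * s b) ^+ m.

Let V : 'M[R]_N := \matrix_(k, i) s i ^+ k.
Let g0 : R := (\prod_(k < N) cas_coeff c k) * \det V ^+ 2.
Let k0 : nat := (\sum_(k < N) k)%N.

Let Apow M : 'M[R]_(N, M) := \matrix_(b, m) s b ^+ m.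
Let minor M (phi : {ffun 'I_N -> 'I_M}) : R := \det (\matrix_(a, b) Apow M b (phi a)).
Let low M (phi : {ffun 'I_N -> 'I_M}) := [forall a, (phi a < N)%N].
Let w M (phi : {ffun 'I_N -> 'I_M}) : R :=
  if low phi then 0 else N`!%:R^-1 * ((\prod_a cas_coeff c (phi a)) * minor phi ^+ 2).
Let r M (phi : {ffun 'I_N -> 'I_M}) : nat := (\sum_a phi a - k0)%N.

(** In the Cauchy-Binet sum the maps with all values below [N] form the
    determinant of the truncation at degree [N], which is homogeneous in [th];
    all other maps have larger degree. *)
Lemma det_cas_trunc (M : nat) (th : R) : (N <= M)%N ->
  \det (cas_trunc M th) = th ^+ k0 * (g0 + \sum_phi w (phi : {ffun 'I_N -> 'I_M}) * th ^+ r phi).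
Proof.
move=> NM.
have F0 : N`!%:R != 0 :> R by rewrite pnatr_eq0 -lt0n fact_gt0.
have e1 : N`!%:R * \det (cas_trunc M th) =
   \sum_(phi : {ffun 'I_N -> 'I_M}) (\prod_a (cas_coeff c (phi a) * th ^+ phi a)) *
     minor phi * minor phi.
  rewrite -(cauchy_binet_ffun (fun m : 'I_M => cas_coeff c m * th ^+ m) (Apow M) (Apow M)).
  congr (_ * \det _); apply/matrixP => a b; rewrite !mxE; apply: eq_bigr => m _.
  by rewrite !mxE !exprMn; ring.
(* Cutting the coefficients off at N selects the maps with values below N. *)
pose cas_coeff' (m : 'I_M) := if (m < N)%N then cas_coeff c m * th ^+ m else 0.
have e2 : N`!%:R * (th ^+ k0 * g0) =
   \sum_(phi : {ffun 'I_N -> 'I_M} | low phi) (\prod_a (cas_coeff c (phi a) * th ^+ phi a)) *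
     minor phi * minor phi.
  transitivity (\sum_(phi : {ffun 'I_N -> 'I_M}) (\prod_a cas_coeff' (phi a)) *
     minor phi * minor phi).
    rewrite -(cauchy_binet_ffun cas_coeff' (Apow M) (Apow M)); congr (_ * _).
    pose D : 'rV[R]_N := \row_k (cas_coeff c k * th ^+ k).
    have -> : \matrix_(a, b) \sum_m cas_coeff' m * Apow M a m * Apow M b m =
        V^T *m diag_mx D *m V.
      apply/matrixP => a b; rewrite mul_mx_diag !mxE.
      rewrite (bigID (fun m : 'I_M => (m < N)%N)) /= [X in _ + X]big1 ?addr0; last first.
        by move=> m /negbTE h; rewrite /cas_coeff' h !mul0r.
      rewrite (big_ord_narrow NM) /=; apply: eq_bigr => k _.
      by rewrite !mxE /cas_coeff' /= ltn_ord; ring.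
    rewrite !det_mulmx det_tr det_diag.
    under [X in _ = _ * X * _]eq_bigr do rewrite mxE.
    by rewrite big_split /= prodrXr /g0 -/k0; ring.
  rewrite [LHS](bigID (@low M)) /= [X in _ + X]big1 ?addr0; last first.
    move=> phi; rewrite negb_forall => /existsP[a ha].
    by rewrite (bigD1 a) //= /cas_coeff' (negbTE ha) !mul0r.
  by apply: eq_bigr => phi /forallP h; congr (_ * _ * _); apply: eq_bigr => a _; rewrite /cas_coeff' h.
apply: (mulfI F0); rewrite e1 mulrDr mulrDr e2 [LHS](bigID (@low M)) /=; congr (_ + _).
rewrite !mulr_sumr [RHS](bigID (@low M)) /= [X in _ = X + _]big1 ?add0r; last first.
  by move=> phi h; rewrite /w h mul0r !mulr0.
apply: eq_bigr => phi h; rewrite /w (negbTE h) big_split /= prodrXr.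
have [/injectiveP inj|/det_rows_noninj z] := boolP (injectiveb phi); last first.
  by rewrite /minor (z _ (fun m b => Apow M b m)) expr2 !mulr0 !mul0r !mulr0.
have hk : (k0 < \sum_a phi a)%N.
  apply: sum_inj_gt; first by move=> a b /val_inj /inj.
  by move: h; rewrite negb_forall => /existsP[a]; rewrite -leqNgt => ha; exists a.
have -> : th ^+ (\sum_a phi a)%N = th ^+ k0 * th ^+ r phi.
  by rewrite -exprD subnKC // ltnW.
by field.
Qed.

Lemma g0_lower : \prod_(k < N) expw (c / 4) k <= `|g0|.
Proof.
rewrite normrM normr_prod normrX.
have h0 : 0 <= \prod_(k < N) (2^-1 : R) ^+ k.
  by apply: prodr_ge0 => k _; rewrite exprn_ge0 // invr_ge0.
have h1 : (\prod_(k < N) (2^-1 : R) ^+ k) ^+ 2 <= `|\det V| ^+ 2.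
  by rewrite ler_sqr ?nnegrE // det_node_powers.
have h2 : 0 <= \prod_(i < N) `|cas_coeff c i| by apply: prodr_ge0.
apply: le_trans (ler_wpM2l h2 h1).
rewrite expr2 -!big_split /= le_eqVlt; apply/orP; left; apply/eqP.
apply: eq_bigr => k _; rewrite norm_cas_coeff ?(ltW c0) // /expw expr_div_n.
have -> : (4 : R) ^+ k = 2 ^+ k * 2 ^+ k by rewrite -exprMn; congr (_ ^+ _); ring.
rewrite exprVn; field.
by rewrite expf_neq0 // pnatr_eq0 -lt0n fact_gt0.
Qed.

(** The upper bound at radius [rho]: the dilation replaces y = c / 4 by
    c rho / 4, and rho^k0 is exactly the factor by which the product grows. *)
Lemma w_sum_le (M : nat) (rho : R) : (N <= M)%N -> 0 < rho -> 8 * (c * rho / 4) <= N%:R ->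
  \sum_phi `|w (phi : {ffun 'I_N -> 'I_M})| * rho ^+ r phi <=
  `|g0| * minor_loss N (c * rho / 4).
Proof.
move=> NM rho0 hrho.
have F0 : 0 < (N`!%:R : R) by rewrite ltr0n fact_gt0.
set y := c * rho / 4.
have y0 : 0 < y by rewrite divr_gt0 // mulr_gt0.
have snorm b : `|s b| <= 1 by exact: cos_max.
pose TA : 'M[R]_(N, M) := \matrix_(b, k) chebT k (s b).
have hA b m : Apow M b m = 2^-1 ^+ m * \sum_(k < M) (chebN m k)%:R * TA b k.
  rewrite mxE (expr_chebT _ (ltn_ord m)); congr (_ * _).
  by apply: eq_bigr => k _; rewrite mxE.
have hT b k : `|TA b k| <= 1 by rewrite mxE chebT_norm_le1.
have p1 : \prod_(b < N) (1 : R) = 1 by rewrite big1.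
have := minor_sum_le (CA := fun=> 1) (CB := fun=> 1) N0 NM y0 hrho hA hA hT hT.
rewrite !p1 !mulr1 => hm.
apply: (@le_trans _ _ (minor_loss N y * \prod_(k < N) expw (c / 4) k)); last first.
  by rewrite mulrC; apply: ler_wpM2r; [exact: ltW (minor_loss_gt0 _ _) | exact: g0_lower].
rewrite -(ler_pM2l F0) -(ler_pM2l (exprn_gt0 k0 rho0)).
have -> : rho ^+ k0 * (N`!%:R * (minor_loss N y * \prod_(k < N) expw (c / 4) k)) =
   N`!%:R * (minor_loss N y * \prod_(k < N) expw y k).
  have -> : \prod_(k < N) expw y k = rho ^+ k0 * \prod_(k < N) expw (c / 4) k.
    rewrite -prodrXr -big_split /=; apply: eq_bigr => k _.
    by rewrite /expw /y mulrAC exprMn; ring.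
  by ring.
apply: le_trans hm; rewrite !mulr_sumr; apply: ler_sum => phi _.
have e4 : 4 * y = c * rho by rewrite /y; field.
rewrite e4 -/(minor phi).
have rhs0 : 0 <= \prod_(a < N) expw (c * rho) (phi a) * `|minor phi| * `|minor phi|.
  rewrite !mulr_ge0 //; apply: prodr_ge0 => a _.
  by rewrite expw_ge0 // ltW // mulr_gt0.
rewrite /w; case: ifP => h; first by rewrite normr0 mul0r !mulr0.
have [/injectiveP inj|/det_rows_noninj z] := boolP (injectiveb phi); last first.
  by rewrite /minor (z _ (fun m b => Apow M b m)) expr2 !mulr0 normr0 !mul0r !mulr0.
have hk : (k0 < \sum_a phi a)%N.
  apply: sum_inj_gt; first by move=> a b /val_inj /inj.
  by move/negbT: h; rewrite negb_forall => /existsP[a]; rewrite -leqNgt => ha; exists a.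
have -> : \prod_(a < N) expw (c * rho) (phi a) =
   rho ^+ k0 * rho ^+ r phi * \prod_(a < N) `|cas_coeff c (phi a)|.
  rewrite -exprD subnKC ?(ltnW hk) // -prodrXr -big_split /=; apply: eq_bigr => a _.
  by rewrite norm_cas_coeff ?(ltW c0) // /expw exprMn; ring.
rewrite !normrM normr_prod (ger0_norm (_ : 0 <= N`!%:R^-1)); last by rewrite invr_ge0.
rewrite le_eqVlt; apply/orP; left; apply/eqP; field.
by rewrite gt_eqF.
Qed.

End LowerBound.

Definition cas_nodes (R : realType) (N : nat) (c th : R) : 'M[R]_N :=
  \matrix_(a, b) cas_series c (fun m => ((th * cheb_node R a) * cheb_node R b) ^+ m).

(** Lower bound for the determinant at dilated Chebyshev nodes.  The weights of
    [finite_remez] do not depend on the truncation [M], so the inequality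
    passes to the limit; one of finitely many dilations must then be good. *)
Lemma det_cas_nodes_lower (R : realType) (N D : nat) (c delta rho : R) :
  (0 < N)%N -> 0 < c -> (0 < D)%N -> 0 < delta -> delta <= 2^-1 -> 1 <= rho ->
  8 * (c * rho / 4) <= N%:R ->
  2 * (minor_loss N (c * rho / 4) * (4 * expR 1 / delta) ^+ D) <= rho ^+ D ->
  exists th : R, [/\ 0 <= th, th <= 1 &
    (1 - delta) ^+ (\sum_(k < N) k) * \prod_(k < N) expw (c / 4) k <=
    4 * (4 * expR 1 / delta) ^+ D * `|\det (cas_nodes N c th)|].
Proof.
move=> N0 c0 D0 d0 d1 rho1 hrho hD.
have [cw [hcw hrem]] := finite_remez D0 d0 d1.
set L := (4 * expR 1 / delta) ^+ D in hcw hD *.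
set k0 := (\sum_(k < N) k)%N.
set q := 1 - delta / D%:R in hrem.
have D0' : 0 < (D%:R : R) by rewrite ltr0n.
have D1 : 1 <= (D%:R : R) by rewrite ler1n.
have dD0 : 0 < delta / D%:R by rewrite divr_gt0.
have dD1 : delta / D%:R <= 2^-1.
  by rewrite ler_pdivrMr //; apply: le_trans d1 _; rewrite ler_peMr // invr_ge0.
have h21 : (2^-1 : R) < 1 by lra.
have q0 : 0 < q by rewrite subr_gt0; apply: le_lt_trans dD1 _.
have q1 : q <= 1 by rewrite gerBl ltW.
have qD j : (j <= D)%N -> 1 - delta <= q ^+ j.
  move=> hj; apply: (@le_trans _ _ (q ^+ D)); last by rewrite ler_wiXn2l // ltW.
  apply: le_trans (bernoulli_sub _ (ltW dD0) (le_trans dD1 (ltW h21))).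
  by rewrite mulrC divfK ?gt_eqF.
have L0 : 0 < L by rewrite exprn_gt0 // divr_gt0 // mulr_gt0 // expR_gt0.
have d1' : 0 < 1 - delta by rewrite subr_gt0; apply: le_lt_trans d1 _.
set P := \prod_(k < N) expw (c / 4) k.
have P0 : 0 < P by apply: prodr_gt0 => k _; rewrite expw_gt0 // divr_gt0.
have X0 : 0 < (1 - delta) ^+ k0 by rewrite exprn_gt0.
have rho0 : 0 < rho by apply: lt_le_trans rho1.
have fin M : (N <= M)%N -> (1 - delta) ^+ k0 * P <=
   2 * \sum_(j < D.+1) `|cw j| * `|\det (cas_trunc N c M (q ^+ j))|.
  move=> NM.
  apply: (@le_trans _ _ ((1 - delta) ^+ k0 * `|(\prod_(k < N) cas_coeff c k) *
     \det (\matrix_(k < N, i < N) cheb_node R i ^+ k) ^+ 2|)).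
    by apply: ler_wpM2l; [exact: ltW | exact: g0_lower].
  have hw := w_sum_le N0 c0 NM rho0 hrho.
  have hr := hrem _ _ _ _ _ _ rho1 _ hw hD.
  apply: le_trans (ler_wpM2l (ltW X0) (hr _)) _; last first.
    rewrite mulrCA; apply: ler_wpM2l => //.
    rewrite mulr_sumr; apply: ler_sum => j _; rewrite mulrCA; apply: ler_wpM2l => //.
    rewrite det_cas_trunc // normrM; apply: ler_wpM2r => //.
    have qj0 : 0 <= q ^+ j by rewrite exprn_ge0 // ltW.
    rewrite normrX (ger0_norm qj0) lerXn2r ?nnegrE ?(ltW d1') //.
    by apply: qD; rewrite -ltnS.
  move=> phi; case: ifP => [_|h]; first by rewrite eqxx.
  have [/injectiveP inj _|/det_rows_noninj z] := boolP (injectiveb phi); last first.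
    rewrite (z _ (fun m b => (\matrix_(b, m) cheb_node R b ^+ m : 'M[R]_(N, M)) b m)).
    by rewrite expr2 !mulr0 eqxx.
  rewrite subn_gt0; apply: sum_inj_gt; first by move=> a b /val_inj /inj.
  by move/negbT: h; rewrite negb_forall => /existsP[a]; rewrite -leqNgt => ha; exists a.
have cvgd j : (j < D.+1)%N -> (fun M => `|\det (cas_trunc N c M (q ^+ j))|) @ \oo -->
     `|\det (cas_nodes N c (q ^+ j))|.
  move=> hj; apply: cvg_norm; apply: det_cvg => a b; rewrite mxE.
  under eq_fun do rewrite mxE.
  apply: (@cas_series_cvg _ _ 1) => [|m]; first exact: ltW.
  rewrite normrX exprn_ile1 // !normrM.
  have h1 : `|q ^+ j| <= 1 by rewrite normrX exprn_ile1 // ger0_norm // ltW.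
  have h2 i : `|cheb_node R (i : 'I_N)| <= 1 by exact: cos_max.
  apply: mulr_ile1 => //.
  by apply: mulr_ile1.
have lim_ineq : (1 - delta) ^+ k0 * P <=
   2 * \sum_(j < D.+1) `|cw j| * `|\det (cas_nodes N c (q ^+ j))|.
  have hc : (fun M => 2 * \sum_(j < D.+1) `|cw j| * `|\det (cas_trunc N c M (q ^+ j))|) @ \oo -->
     2 * \sum_(j < D.+1) `|cw j| * `|\det (cas_nodes N c (q ^+ j))|.
    apply: cvgM; first exact: cvg_cst.
    apply: cvg_big => [|j _]; first exact: add_continuous.
    by apply: cvgM; [exact: cvg_cst | exact: cvgd].
  rewrite -(cvg_lim _ hc) //; apply: limr_ge; first by apply/cvg_ex; eexists; exact: hc.
  by exists N => // M /= NM; exact: fin.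
(* Otherwise all D + 1 determinants would be too small for lim_ineq. *)
apply: contrapT => /forallNP hno.
have small (j : 'I_D.+1) : `|\det (cas_nodes N c (q ^+ j))| <= (1 - delta) ^+ k0 * P / (4 * L).
  rewrite leNgt; apply/negP => hlt; apply: (hno (q ^+ j)); split.
  - by rewrite exprn_ge0 // ltW.
  - by rewrite exprn_ile1 // ltW.
  - by rewrite [leRHS]mulrC -ler_pdivrMr ?mulr_gt0 //; exact: ltW.
have : 2 * \sum_(j < D.+1) `|cw j| * `|\det (cas_nodes N c (q ^+ j))| <=
   2 * (L * ((1 - delta) ^+ k0 * P / (4 * L))).
  apply: ler_wpM2l => //.
  apply: (@le_trans _ _ (\sum_(j < D.+1) `|cw j| * ((1 - delta) ^+ k0 * P / (4 * L)))).
    by apply: ler_sum => j _; exact: ler_wpM2l.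
  rewrite -mulr_suml; apply: ler_wpM2r => //.
  by rewrite divr_ge0 ?mulr_ge0 // ltW.
move/(le_trans lim_ineq).
have -> : 2 * (L * ((1 - delta) ^+ k0 * P / (4 * L))) = 2^-1 * ((1 - delta) ^+ k0 * P).
  by field; rewrite gt_eqF.
have : 0 < (1 - delta) ^+ k0 * P by exact: mulr_gt0.
by move=> h1 h2; move: h1 h2; move: (_ * P) => z; lra.
Qed.

(** * Integrals and moments on [-1, 1] *)

Section Toolbox.
Variable R : realType.
Notation mu := (@lebesgue_measure R).
Definition seg : set (measurableTypeR R) := `[(-1 : R), 1].
Notation D := seg.
Definition seg_integrable (f : R -> R) : Prop := mu.-integrable D (EFin \o f).
Definition Iseg (f : R -> R) : R := Rintegral mu D f.

Lemma measurable_seg : measurable D. Proof. exact: measurable_itv. Qed.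

Lemma lebesgue_measure_seg : mu D = 2%:E.
Proof.
rewrite /D lebesgue_measure_itv /= lte_fin.
by rewrite (_ : (-1 < 1 :> R)) ?opprK //; lra.
Qed.

Lemma seg_norm_le1 x : D x -> `|x| <= 1.
Proof. by rewrite /D /= in_itv /= ler_norml. Qed.

Lemma seg_integrable_cont (g : R -> R) : continuous g -> seg_integrable g.
Proof.
move=> cg; apply: continuous_compact_integrable; first exact: segment_compact.
exact: continuous_subspaceT.
Qed.

Lemma cont_bounded (g : R -> R) : continuous g -> [bounded g x | x in D].
Proof.
move=> cg; have cD : compact D by exact: segment_compact.
have cs : {within D, continuous g} by exact: continuous_subspaceT.
have /compact_bounded[M [_ mrt]] := continuous_compact cs cD.
by exists M; split; rewrite ?num_real // => ? ? ? ?; exact: mrt.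
Qed.

Lemma cont_meas (g : R -> R) : continuous g -> measurable_fun D g.
Proof. by move=> cg; apply: measurable_funTS; exact: measurable_realfun.continuous_measurable_fun. Qed.

Lemma seg_integrableM_cont (f g : R -> R) : seg_integrable f -> continuous g -> seg_integrable (fun x => f x * g x).
Proof.
move=> hf cg; apply: (integrableMl measurable_seg hf (cont_meas cg) (cont_bounded cg)).
Qed.

Lemma seg_integrable_meas f : seg_integrable f -> measurable_fun D f.
Proof. by move=> /integrableP[/measurable_EFinP]. Qed.

Lemma seg_integrable_sum n (F : 'I_n -> R -> R) : (forall i, seg_integrable (F i)) ->
  seg_integrable (fun x => \sum_(i < n) F i x).
Proof.
move=> h; rewrite /seg_integrable.
have -> : EFin \o (fun x => \sum_(i < n) F i x) = (fun x => \sum_(i < n) (F i x)%:E)%E.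
  by apply/funext => x /=; rewrite sumEFin.
by apply: integrable_sum => [|i _]; [exact: measurable_seg | exact: h].
Qed.

Lemma Iseg_sum n (F : 'I_n -> R -> R) : (forall i, seg_integrable (F i)) ->
  Iseg (fun x => \sum_(i < n) F i x) = \sum_(i < n) Iseg (F i).
Proof.
elim: n F => [|n IH] F h.
  rewrite big_ord0 /Iseg; under eq_Rintegral do rewrite big_ord0.
  by rewrite Rintegral_cst ?mul0r //; exact: measurable_seg.
rewrite big_ord_recr /= -(IH (fun i => F (widen_ord (leqnSn n) i))) //.
rewrite /Iseg -RintegralD //; [|exact: measurable_seg|exact: seg_integrable_sum|exact: h].
by apply: eq_Rintegral => x _; rewrite big_ord_recr.
Qed.

Lemma Iseg_Zl (f : R -> R) a : seg_integrable f -> Iseg (fun x => a * f x) = a * Iseg f.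
Proof. by move=> h; rewrite /Iseg RintegralZl //; exact: measurable_seg. Qed.

Lemma Iseg_Zr (f : R -> R) a : seg_integrable f -> Iseg (fun x => f x * a) = Iseg f * a.
Proof. by move=> h; rewrite /Iseg RintegralZr //; exact: measurable_seg. Qed.

Lemma seg_integrable_Zl (f : R -> R) a : seg_integrable f -> seg_integrable (fun x => a * f x).
Proof.
move=> h; rewrite /seg_integrable.
have -> : EFin \o (fun x => a * f x) = (fun x => a%:E * (EFin \o f) x)%E.
  by apply/funext => x /=; rewrite EFinM.
by apply: integrableZl => //; exact: measurable_seg.
Qed.

Lemma seg_integrable_Zr (f : R -> R) a : seg_integrable f -> seg_integrable (fun x => f x * a).
Proof. by move=> /(seg_integrable_Zl a); congr seg_integrable; apply/funext => x; rewrite mulrC. Qed.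

Lemma seg_integrable_B (f g : R -> R) : seg_integrable f -> seg_integrable g -> seg_integrable (fun x => f x - g x).
Proof.
move=> hf hg; rewrite /seg_integrable.
have -> : EFin \o (fun x => f x - g x) = ((EFin \o f) \- (EFin \o g))%E.
  by apply/funext => x /=; rewrite EFinB.
by apply: integrableB => //; exact: measurable_seg.
Qed.

Lemma seg_integrable_D (f g : R -> R) : seg_integrable f -> seg_integrable g -> seg_integrable (fun x => f x + g x).
Proof.
move=> hf hg; rewrite /seg_integrable.
have -> : EFin \o (fun x => f x + g x) = ((EFin \o f) \+ (EFin \o g))%E.
  by apply/funext => x /=; rewrite EFinD.
by apply: integrableD => //; exact: measurable_seg.
Qed.

Lemma seg_integrable_abs (f : R -> R) : seg_integrable f -> seg_integrable (fun x => `|f x|).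
Proof.
move=> hf; rewrite /seg_integrable.
have -> : EFin \o (fun x => `|f x|) = (abse \o (EFin \o f))%E by apply/funext.
exact: integrable_abse.
Qed.

Lemma seg_integrable_dom (f g : R -> R) : measurable_fun D f -> seg_integrable g ->
  (forall x, D x -> `|f x| <= `|g x|) -> seg_integrable f.
Proof.
move=> mf hg h; apply: (le_integrable measurable_seg _ _ hg); first exact/measurable_EFinP.
by move=> x Dx /=; rewrite lee_fin h.
Qed.

Lemma Iseg_le_ae (f g : R -> R) : seg_integrable f -> seg_integrable g -> (forall x, D x -> 0 <= g x) ->
  {ae mu, forall x, D x -> `|f x| <= g x} -> `|Iseg f| <= Iseg g.
Proof.
move=> hf hg g0 h.
apply: (le_trans (le_normr_Rintegral measurable_seg hf)).
have ha := seg_integrable_abs hf.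
have fa := integrable_fin_num measurable_seg ha; have fg := integrable_fin_num measurable_seg hg.
rewrite -lee_fin /Rintegral !fineK //.
apply: ae_ge0_le_integral => //.
- exact: measurable_seg.
- by case/integrableP: ha.
- by case/integrableP: hg.
Qed.

Lemma Iseg_le (f g : R -> R) : seg_integrable f -> seg_integrable g ->
  (forall x, D x -> f x <= g x) -> Iseg f <= Iseg g.
Proof. by move=> hf hg h; apply: le_Rintegral => //; exact: measurable_seg. Qed.

Lemma Iseg_cst a : Iseg (fun=> a) = a * 2.
Proof. by rewrite /Iseg (Rintegral_cst _ measurable_seg); congr (_ * _); exact: (congr1 fine lebesgue_measure_seg). Qed.

Lemma Iseg_ext (f g : R -> R) : (forall x, f x = g x) -> Iseg f = Iseg g.
Proof. by move=> h; congr Iseg; apply/funext. Qed.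

Lemma Iseg_ge0 (f : R -> R) : (forall x, 0 <= f x) -> 0 <= Iseg f.
Proof. by move=> h; apply: Rintegral_ge0 => x _. Qed.

Lemma Iseg_absM_le (f g : R -> R) (C : R) : 0 <= C -> seg_integrable f -> continuous g ->
  (forall x, D x -> `|g x| <= C) -> `|Iseg (fun x => f x * g x)| <= C * Iseg (fun x => `|f x|).
Proof.
move=> C0 hf cg h; rewrite -Iseg_Zl; last exact: seg_integrable_abs.
apply: Iseg_le_ae; [exact: seg_integrableM_cont|by apply: seg_integrable_Zl; exact: seg_integrable_abs| |].
  by move=> x _; rewrite mulr_ge0.
apply: aeW => x Dx; rewrite normrM mulrC; apply: ler_wpM2r => //; exact: h.
Qed.

Definition sqint (f : R -> R) : Prop := measurable_fun D f /\ seg_integrable (fun x => f x ^+ 2).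

Lemma cont_exp n : continuous (fun x : R => x ^+ n).
Proof. exact: exprn_continuous. Qed.

Lemma cont_const (a : R) : continuous (fun _ : R => a).
Proof. by move=> x; exact: cvg_cst. Qed.

Lemma sqint_integrable f : sqint f -> seg_integrable f.
Proof.
move=> [mf h]; apply: (seg_integrable_dom (g := fun x => 1 + f x ^+ 2)) => //.
  by apply: seg_integrable_D => //; apply: seg_integrable_cont; exact: cont_const.
move=> x _; rewrite (@ger0_norm _ (1 + f x ^+ 2)); last by rewrite addr_ge0 // sqr_ge0.
have h1 := sqr_ge0 (`|f x| - 1).
have h2 := real_normK (num_real (f x)).
have := normr_ge0 (f x); rewrite -h2; nra.
Qed.

Lemma sqint_mul f g : sqint f -> sqint g -> seg_integrable (fun x => f x * g x).
Proof.
move=> [mf hf] [mg hg]; apply: (seg_integrable_dom (g := fun x => f x ^+ 2 + g x ^+ 2)).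
- exact: measurable_funM.
- exact: seg_integrable_D.
move=> x _; rewrite (@ger0_norm _ (f x ^+ 2 + g x ^+ 2)); last by rewrite addr_ge0 // sqr_ge0.
rewrite normrM -(real_normK (num_real (f x))) -(real_normK (num_real (g x))).
have h1 := sqr_ge0 (`|f x| - `|g x|).
have h2 := normr_ge0 (f x); have h3 := normr_ge0 (g x); nra.
Qed.

Lemma Iseg_abs_le_sqr f (m : R) : sqint f -> 0 < m ->
  Iseg (fun x => `|f x|) <= m + Iseg (fun x => f x ^+ 2) / (2 * m).
Proof.
move=> hf m0; have [mf h2] := hf; have hi := sqint_integrable hf.
have e : m + Iseg (fun x => f x ^+ 2) / (2 * m) =
  Iseg (fun x => m / 2 + f x ^+ 2 * (2 * m)^-1).
  have hz : seg_integrable (fun x => f x ^+ 2 * (2 * m)^-1) by exact: seg_integrable_Zr.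
  have hc : seg_integrable (fun=> m / 2) by apply: seg_integrable_cont; exact: cont_const.
  transitivity (Iseg (fun=> m / 2) + Iseg (fun x => f x ^+ 2 * (2 * m)^-1)).
    by rewrite Iseg_cst Iseg_Zr // divfK.
  by rewrite /Iseg -RintegralD //; exact: measurable_seg.
rewrite e; apply: Iseg_le.
- exact: seg_integrable_abs.
- by apply: seg_integrable_D; [apply: seg_integrable_cont; exact: cont_const | exact: seg_integrable_Zr].
move=> x _; rewrite -subr_ge0.
have -> : m / 2 + f x ^+ 2 / (2 * m) - `|f x| = (m - `|f x|) ^+ 2 / (2 * m).
  by rewrite -(real_normK (num_real (f x))); field; rewrite gt_eqF.
by rewrite divr_ge0 ?sqr_ge0 // mulr_ge0 // ltW.
Qed.

Lemma cont_poly n (a : 'I_n -> R) : continuous (fun x : R => \sum_(i < n) a i * x ^+ i).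
Proof.
move=> x; apply: cvg_big => [|i _]; first exact: add_continuous.
by apply: cvgM; [exact: cvg_cst | exact: cont_exp].
Qed.

Lemma cont_sqint g : continuous g -> sqint g.
Proof.
move=> cg; split; first exact: cont_meas.
by apply: seg_integrable_cont => x; under eq_fun do rewrite expr2; apply: cvgM; exact: cg.
Qed.

Lemma cont_chebT k : continuous (fun x : R => chebT k x).
Proof.
suff : continuous (fun x : R => chebT k x) /\ continuous (fun x : R => chebT k.+1 x) by case.
elim: k => [|k [h1 h2]]; first by split; [exact: cont_const | move=> x; exact: cvg_id].
split=> // x; under eq_fun do rewrite chebTSS.
apply: cvgB; last exact: h1.
apply: cvgM; last exact: h2.
by apply: cvgM; [exact: cvg_cst | exact: cvg_id].
Qed.

(** Moments against monomials; [cmom] is its analogue for Chebyshev polynomials. *)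
Definition mom (f : R -> R) (m : nat) : R := Iseg (fun x => f x * x ^+ m).
Definition cmom (f : R -> R) (k : nat) : R := Iseg (fun x => f x * chebT k x).

Lemma mom_cheb f (m M : nat) : seg_integrable f -> (m < M)%N ->
  mom f m = 2^-1 ^+ m * \sum_(k < M) (chebN m k)%:R * cmom f k.
Proof.
move=> hf mM; rewrite /mom.
have e x : f x * x ^+ m = \sum_(k < M) (2^-1 ^+ m * (chebN m k)%:R) * (f x * chebT k x).
  rewrite (expr_chebT _ mM) mulr_sumr mulr_sumr; apply: eq_bigr => k _.
  by ring.
rewrite (Iseg_ext e) Iseg_sum; last first.
  by move=> k; apply: seg_integrable_Zl; apply: seg_integrableM_cont => //; exact: cont_chebT.
rewrite mulr_sumr; apply: eq_bigr => k _; rewrite Iseg_Zl ?mulrA //.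
by apply: seg_integrableM_cont => //; exact: cont_chebT.
Qed.

Lemma cmom_le f k : seg_integrable f -> `|cmom f k| <= Iseg (fun x => `|f x|).
Proof.
move=> hf; rewrite -[leRHS]mul1r; apply: Iseg_absM_le => //.
  exact: cont_chebT.
by move=> x /seg_norm_le1; exact: chebT_norm_le1.
Qed.

Lemma mom_le f k : seg_integrable f -> `|mom f k| <= Iseg (fun x => `|f x|).
Proof.
move=> hf; rewrite -[leRHS]mul1r; apply: Iseg_absM_le => //.
  exact: cont_exp.
by move=> x /seg_norm_le1 h; rewrite normrX exprn_ile1.
Qed.

Definition xmom (p : nat) : R := Iseg (fun x => x ^+ p).

(** The fundamental theorem of calculus. *)
Lemma xmomE p : xmom p = if odd p then 0 else 2 / p.+1%:R.
Proof.
have p0 : (p.+1%:R : R) != 0 by rewrite pnatr_eq0.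
pose F x : R := x ^+ p.+1 / p.+1%:R.
have dF x : is_derive x (1:R) F (x ^+ p).
  have -> : F = (p.+1%:R^-1 \*: ((id : R -> R) ^+ p.+1)).
    by apply/funext => z; rewrite /F /= exprfctE mulrC.
  apply: is_derive_eq.
  by rewrite /GRing.scale /= mulr1 mulKf.
have h : (\int[mu]_(x in D) (x ^+ p)%:E = (F 1%R)%:E - (F (-1)%R)%:E)%E.
  apply: continuous_FTC2.
  - lra.
  - by apply: continuous_subspaceT; exact: cont_exp.
  - have cF : continuous F.
      by move=> x; apply: differentiable_continuous; apply/derivable1_diffP; case: (dF x).
    split.
    + by move=> x _; case: (dF x).
    + by apply: cvg_at_right_filter; exact: cF.
    + by apply: cvg_at_left_filter; exact: cF.
  - by move=> x _; rewrite derive1E derive_val.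
rewrite /xmom /Iseg /Rintegral h -EFinB /= /F expr1n -mulrBl.
rewrite -signr_odd /=; case: (odd p) => /=; rewrite ?expr1 ?expr0 ?subrr ?mul0r //.
by rewrite opprK.
Qed.

Lemma xmom_le p : `|xmom p| <= 2.
Proof.
rewrite xmomE; case: ifP => _; first by rewrite normr0.
by rewrite ger0_norm // ler_pdivrMr // ler_peMr // ler1n.
Qed.

End Toolbox.

(** * The sinc kernel as a Gram kernel *)

Section ExpTail.
Variable R : realType.

Definition exp_tail (Z : R) (M : nat) : R := expR Z - \sum_(p < M) expw Z p.

Lemma series_expw (Z : R) : (fun M => \sum_(p < M) expw Z p) = series (exp_coeff Z).
Proof. by apply/funext => M; rewrite /series /= big_mkord. Qed.

Lemma exp_tail_cvg (Z : R) : exp_tail Z @ \oo --> 0.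
Proof.
rewrite -[X in _ --> X](subrr (expR Z)).
apply: cvgB; first exact: cvg_cst.
by rewrite series_expw; exact: is_cvg_series_exp_coeff.
Qed.

Lemma sum_expw_le (Z : R) (M : nat) : 0 <= Z -> \sum_(p < M) expw Z p <= expR Z.
Proof.
move=> Z0; have -> : \sum_(p < M) expw Z p = series (exp_coeff Z) M.
  by rewrite -series_expw.
apply: nondecreasing_cvgn_le; last exact: is_cvg_series_exp_coeff.
by apply: nondecreasing_series => n _ _; exact: exp_coeff_ge0.
Qed.

Lemma sum_expw_tail (Z : R) (M L : nat) : 0 <= Z -> (M <= L)%N ->
  \sum_(M <= p < L) expw Z p <= exp_tail Z M.
Proof.
move=> Z0 ML; rewrite /exp_tail lerBrDl; apply: le_trans (sum_expw_le L Z0).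
by rewrite -!(big_mkord xpredT (expw Z)) (big_cat_nat (leq0n M) ML).
Qed.

End ExpTail.

Section Sinc.
Variable R : realType.

(** The Taylor terms of sin z / z. *)
Definition sinc_term (p : nat) (z : R) : R :=
  if odd p then 0 else (-1) ^+ p./2 * (z ^+ p / p.+1`!%:R).
(** The continuous extension of sin z / z, since z / 0 = 0. *)
Definition sinc0 (z : R) : R := if z == 0 then 1 else sin z / z.

Lemma sinc_term_norm (p : nat) (z Z : R) : `|z| <= Z -> `|sinc_term p z| <= expw Z p.
Proof.
move=> zZ; have Z0 : 0 <= Z by apply: le_trans zZ.
rewrite /sinc_term; case: ifP => _; first by rewrite normr0 expw_ge0.
rewrite normrM normrX normrN1 expr1n mul1r normrM normrX /expw.
rewrite [X in _ * X]ger0_norm ?invr_ge0 //.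
apply: ler_pM; rewrite ?exprn_ge0 ?invr_ge0 //; first by rewrite lerXn2r ?nnegrE.
rewrite lef_pV2 ?posrE ?ltr0n ?fact_gt0 // ler_nat factS.
by rewrite leq_pmull.
Qed.

Lemma sinc_term_mul (p : nat) (z : R) : z * sinc_term p z = sin_coeff z p.+1.
Proof.
rewrite /sinc_term /sin_coeff /=; case: (boolP (odd p)) => h /=; first by rewrite mulr0 !mul0r.
by rewrite mul1r exprS; ring.
Qed.

Lemma sinc_term_cvg (z : R) : (fun L => \sum_(p < L) sinc_term p z) @ \oo --> sinc0 z.
Proof.
rewrite /sinc0; have [->|z0] := eqVneq z 0.
  rewrite -cvg_shiftS.
  have -> : (fun L => \sum_(p < L.+1) sinc_term p (0 : R)) = (fun=> 1).
    apply/funext => L; rewrite big_ord_recl big1 ?addr0 => [|i _].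
      by rewrite /sinc_term /= expr0 mul1r expr0 divr1.
    by rewrite /sinc_term lift0 exprS !mul0r mulr0 if_same.
  exact: cvg_cst.
have -> : (fun L => \sum_(p < L) sinc_term p z) = (fun L => series (sin_coeff z) L.+1 / z).
  apply/funext => L; rewrite /series /= big_mkord big_ord_recl /=.
  rewrite {1}/sin_coeff /= !mul0r add0r mulr_suml; apply: eq_bigr => p _.
  by rewrite -sinc_term_mul mulrC mulKf.
have h : series (sin_coeff z) @ \oo --> sin z.
  by rewrite unlock; exact: is_cvg_series_sin_coeff.
apply: cvgMl; move: h; rewrite -(cvg_shiftS (series (sin_coeff z))).
exact.
Qed.

Lemma sinc0_tail (z Z : R) (M : nat) : `|z| <= Z ->
  `|sinc0 z - \sum_(p < M) sinc_term p z| <= exp_tail Z M.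
Proof.
move=> zZ; have Z0 : 0 <= Z by apply: le_trans zZ.
have hc : (fun L => `|\sum_(p < L) sinc_term p z - \sum_(p < M) sinc_term p z|) @ \oo -->
   `|sinc0 z - \sum_(p < M) sinc_term p z|.
  by apply: cvg_norm; apply: cvgB; [exact: sinc_term_cvg | exact: cvg_cst].
rewrite -(cvg_lim _ hc) //; apply: limr_le; first by apply/cvg_ex; eexists; exact: hc.
exists M => // L /= ML.
apply: le_trans (sum_expw_tail Z0 ML).
rewrite -!(big_mkord xpredT (fun p => sinc_term p z)) (big_cat_nat (leq0n M) ML) /=.
rewrite addrAC subrr add0r; apply: (le_trans (ler_norm_sum _ _ _)).
by apply: ler_sum => p _; exact: sinc_term_norm.
Qed.

Lemma sinc_kernelE (c x y : R) : c != 0 ->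
  sinc_kernel c x y = c / pi * sinc0 (c * (x - y)).
Proof.
move=> c0; rewrite /sinc_kernel /sinc0 mulf_eq0 (negbTE c0) /= subr_eq0.
case: eqP => // /eqP xy; first by rewrite mulr1.
have p0 : (pi : R) != 0 by rewrite gt_eqF // pi_gt0.
have xy0 : x - y != 0 by rewrite subr_eq0.
by move: p0; move: (pi : R) => P p0; field; rewrite p0 c0 xy0.
Qed.

(** The terms of total degree [p] of the integral of cas (c s x) cas (c s y) over
    s in [-1, 1].  For even [p] the signs of the two coefficients multiply to
    (-1)^(p/2) (-1)^(p-m), which is the binomial expansion of (x - y)^p. *)
Lemma cas_coeff_binomial (c x y : R) (p : nat) :
  \sum_(m < p.+1) cas_coeff c m * cas_coeff c (p - m) * xmom R p * x ^+ m * y ^+ (p - m) =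
  2 * sinc_term p (c * (x - y)).
Proof.
rewrite xmomE /sinc_term; case: (boolP (odd p)) => hp.
  by rewrite big1 ?mulr0 // => m _; rewrite mulr0 !mul0r.
rewrite exprMn [x - y]addrC exprDn.
rewrite mulr_sumr !mulr_suml mulr_sumr mulr_sumr; apply: eq_bigr => m _.
have mp : (m <= p)%N by rewrite -ltnS.
have sgn : (-1) ^+ m./2 * (-1) ^+ (p - m)./2 = (-1) ^+ p./2 * (-1) ^+ (p - m) :> R.
  rewrite -!exprD -[LHS]signr_odd -[RHS]signr_odd; congr (_ ^+ nat_of_bool _).
  by move: hp; lia.
rewrite /cas_coeff /expw.
have e1 : c ^+ m * c ^+ (p - m) = c ^+ p by rewrite -exprD subnKC.
have pf0 : (p.+1%:R : R) != 0 by rewrite pnatr_eq0.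
have f0 k : (k`!%:R : R) != 0 by rewrite pnatr_eq0 -lt0n fact_gt0.
have e2 : 'C(p, m)%:R * (m`!%:R * (p - m)`!%:R) = p`!%:R :> R.
  by rewrite -!natrM bin_fact.
rewrite [(- y) ^+ _]exprNn factS natrM -mulr_natr.
transitivity (((-1) ^+ m./2 * (-1) ^+ (p - m)./2) * (c ^+ m * c ^+ (p - m)) *
  (2 / p.+1%:R) * x ^+ m * y ^+ (p - m) * (m`!%:R * (p - m)`!%:R)^-1).
  by field; rewrite ?nat1r ?f0 ?pf0.
rewrite sgn e1.
have -> : (m`!%:R * (p - m)`!%:R)^-1 = 'C(p, m)%:R / p`!%:R :> R.
  by rewrite -e2; field; rewrite !f0 pnatr_eq0 -lt0n bin_gt0 mp.
by field; rewrite ?nat1r ?f0 ?pf0.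
Qed.

End Sinc.

Section DoubleSum.
Variable R : realType.

(** Summation by total degree. *)
Lemma triangle_sum (a : nat -> nat -> R) (M : nat) :
  \sum_(p < M) \sum_(m < p.+1) a m (p - m)%N =
  \sum_(m < M) \sum_(l < M | (m + l < M)%N) a m l.
Proof.
transitivity (\sum_(p < M) \sum_(m < M | (m <= p)%N) a m (p - m)%N).
  apply: eq_bigr => p _.
  by rewrite (big_ord_widen M (fun m => a m (p - m)%N)) ?ltn_ord.
rewrite (exchange_big_dep xpredT) //=; apply: eq_bigr => m _.
have hm := ltn_ord m.
transitivity (\sum_(l < M - m) a m l).
  rewrite -(big_mkord (fun p => m <= p)%N (fun p => a m (p - m)%N)).
  rewrite (big_cat_nat (leq0n m) (ltnW hm)) /= big_nat_cond big1 ?add0r; last first.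
    by move=> p /andP[/andP[_ h1] h2]; move: h2; rewrite leqNgt h1.
  rewrite big_nat_cond -{1}[val m]add0n big_addn big_mkord /=.
  apply: eq_big => [l|l _]; last by rewrite addnK.
  by rewrite addnC leq_addr /= andbT; have := ltn_ord l; lia.
rewrite (big_ord_widen M (a m)) ?leq_subr //.
by apply: eq_bigl => l; rewrite ltn_subRL.
Qed.

(** The difference consists of terms with m + l >= M; replacing [c] by 2 c there gains the
    factor 2^-(m + l) <= 2^-M. *)
Lemma square_triangle_le (a : nat -> nat -> R) (c C : R) (M : nat) : 0 <= c -> 0 <= C ->
  (forall m l, `|a m l| <= C * (expw c m * expw c l)) ->
  `|\sum_(m < M) \sum_(l < M) a m l - \sum_(p < M) \sum_(m < p.+1) a m (p - m)%N| <=
  C * expR (2 * c) ^+ 2 * 2^-1 ^+ M.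
Proof.
move=> c0 C0 ha; rewrite triangle_sum -sumrB.
have c20 : 0 <= 2 * c by rewrite mulr_ge0.
have half k : expw c k = 2^-1 ^+ k * expw (2 * c) k.
  rewrite /expw exprMn exprVn; field.
  by rewrite expf_neq0 // pnatr_eq0 -lt0n fact_gt0.
apply: (@le_trans _ _ (\sum_(m < M) \sum_(l < M)
   C * 2^-1 ^+ M * (expw (2 * c) m * expw (2 * c) l))).
  apply: (le_trans (ler_norm_sum _ _ _)); apply: ler_sum => m _.
  rewrite (bigID (fun l : 'I_M => (m + l < M)%N)) /= addrAC subrr add0r big_mkcond /=.
  apply: (le_trans (ler_norm_sum _ _ _)); apply: ler_sum => l _.
  have rhs0 : 0 <= C * 2^-1 ^+ M * (expw (2 * c) m * expw (2 * c) l).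
    by rewrite !mulr_ge0 ?expw_ge0 ?exprn_ge0 ?invr_ge0.
  case: (boolP (m + l < M)%N) => h /=; first by rewrite normr0.
  apply: le_trans (ha m l) _; rewrite -mulrA; apply: ler_wpM2l => //.
  rewrite (half m) (half l) mulrACA -exprD; apply: ler_wpM2r.
    by rewrite mulr_ge0 ?expw_ge0.
  apply: ler_wiXn2l; rewrite ?invr_ge0 ?invf_le1 ?ler1n //.
  by rewrite leqNgt.
under eq_bigr do rewrite -mulr_sumr.
rewrite -mulr_sumr [leRHS]mulrAC; apply: ler_wpM2l.
  by rewrite mulr_ge0 ?exprn_ge0 ?invr_ge0.
under eq_bigr do rewrite -mulr_sumr.
rewrite -mulr_suml expr2; have h := sum_expw_le M c20.
by apply: ler_pM => //; apply: sumr_ge0 => i _; exact: expw_ge0.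
Qed.

(** The integral over [-1, 1] of the product of two truncated cas series whose
    coefficients are weighted by the moments [u] and [v]. *)
Definition gram_sum (c : R) (u v : nat -> R) (M : nat) : R :=
  \sum_(m < M) \sum_(l < M) cas_coeff c m * cas_coeff c l * xmom R (m + l) * u m * v l.

(** The same sum arranged by total degree, which is how the Taylor series of the
    sinc kernel is truncated. *)
Definition gram_tri (c : R) (u v : nat -> R) (M : nat) : R :=
  \sum_(p < M) \sum_(m < p.+1) cas_coeff c m * cas_coeff c (p - m) * xmom R p * u m * v (p - m)%N.

Lemma cvg_half : (fun M => (2^-1 : R) ^+ M) @ \oo --> 0.
Proof. by apply: cvg_expr; rewrite ger0_norm ?invr_ge0 // invf_lt1 // ltr1n. Qed.

Lemma gram_entry_le (c Cu Cv : R) (u v : nat -> R) m l : 0 <= c ->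
  (forall m, `|u m| <= Cu) -> (forall m, `|v m| <= Cv) ->
  `|cas_coeff c m * cas_coeff c l * xmom R (m + l) * u m * v l| <=
    2 * Cu * Cv * (expw c m * expw c l).
Proof.
move=> c0 hu hv; rewrite 4!normrM !norm_cas_coeff //.
have e0 : 0 <= expw c m * expw c l by rewrite mulr_ge0 ?expw_ge0.
have h1 : `|xmom R (m + l)| * `|u m| * `|v l| <= 2 * Cu * Cv.
  by apply: ler_pM; rewrite ?mulr_ge0 //; apply: ler_pM => //; exact: xmom_le.
rewrite [leRHS]mulrC -2!mulrA [X in _ * X <= _]mulrA.
exact: ler_wpM2l.
Qed.

Lemma gram_sub_cvg (c Cu Cv : R) (u v : nat -> R) : 0 <= c ->
  (forall m, `|u m| <= Cu) -> (forall m, `|v m| <= Cv) ->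
  (fun M => gram_sum c u v M - gram_tri c u v M) @ \oo --> 0.
Proof.
move=> c0 hu hv; set C := 2 * Cu * Cv.
have Cu0 : 0 <= Cu by apply: le_trans (hu 0%N).
have Cv0 : 0 <= Cv by apply: le_trans (hv 0%N).
have C0 : 0 <= C by rewrite !mulr_ge0.
apply: (@squeeze_cvgr _ _ _ _ (fun M => - (C * expR (2 * c) ^+ 2 * 2^-1 ^+ M))
   (fun M => C * expR (2 * c) ^+ 2 * 2^-1 ^+ M)); last 2 first.
- rewrite -oppr0; apply: cvgN; rewrite -[X in _ --> X](mulr0 (C * expR (2 * c) ^+ 2)).
  by apply: cvgM; [exact: cvg_cst | exact: cvg_half].
- rewrite -[X in _ --> X](mulr0 (C * expR (2 * c) ^+ 2)).
  by apply: cvgM; [exact: cvg_cst | exact: cvg_half].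
apply: nearW => M; rewrite -ler_norml /gram_sum /gram_tri.
pose a m l := cas_coeff c m * cas_coeff c l * xmom R (m + l) * u m * v l.
have -> : \sum_(p < M) \sum_(m < p.+1) cas_coeff c m * cas_coeff c (p - m) * xmom R p * u m * v (p - m)%N
   = \sum_(p < M) \sum_(m < p.+1) a m (p - m)%N.
  apply: eq_bigr => p _; apply: eq_bigr => m _; rewrite /a subnKC //.
  by rewrite -ltnS.
apply: (square_triangle_le _ c0 C0) => m l; exact: gram_entry_le.
Qed.

Lemma gram_tri_cvg (c Cu Cv : R) (u v : nat -> R) : 0 <= c ->
  (forall m, `|u m| <= Cu) -> (forall m, `|v m| <= Cv) ->
  cvgn (gram_tri c u v).
Proof.
move=> c0 hu hv; set C := 2 * Cu * Cv.
have Cu0 : 0 <= Cu by apply: le_trans (hu 0%N).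
have Cv0 : 0 <= Cv by apply: le_trans (hv 0%N).
have C0 : 0 <= C by rewrite !mulr_ge0.
pose b p := \sum_(m < p.+1) cas_coeff c m * cas_coeff c (p - m) * xmom R p * u m * v (p - m)%N.
have -> : gram_tri c u v = series b.
  by apply/funext => M; rewrite /gram_tri /series /= big_mkord.
apply: normed_cvg; rewrite /=.
apply: (@series_le_cvg _ _ (C *: exp_coeff (c + c))) => [n|n|n|].
- exact: normr_ge0.
- by apply: mulr_ge0 => //; apply: exp_coeff_ge0; rewrite addr_ge0.
- rewrite /=; apply: (le_trans (ler_norm_sum _ _ _)).
  apply: (@le_trans _ _ (\sum_(m < n.+1) C * (expw c m * expw c (n - m)))).
    apply: ler_sum => m _; have mn : (m <= n)%N by rewrite -ltnS.
    by have := gram_entry_le m (n - m) c0 hu hv; rewrite subnKC.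
  rewrite -mulr_sumr; apply: ler_wpM2l => //.
  rewrite /exp_coeff /= exprDn mulr_suml; apply: ler_sum => m _.
  have mn : (m <= n)%N by rewrite -ltnS.
  rewrite le_eqVlt; apply/orP; left; apply/eqP.
  have f0 k : (k`!%:R : R) != 0 by rewrite pnatr_eq0 -lt0n fact_gt0.
  rewrite /expw -(bin_fact mn) !natrM -mulr_natr; field.
  by rewrite !f0 pnatr_eq0 -lt0n bin_gt0 mn.
- by apply: is_cvg_seriesZ; exact: is_cvg_series_exp_coeff.
Qed.

Lemma gram_sum_cvg (c Cu Cv : R) (u v : nat -> R) : 0 <= c ->
  (forall m, `|u m| <= Cu) -> (forall m, `|v m| <= Cv) ->
  cvgn (gram_sum c u v).
Proof.
move=> c0 hu hv.
have -> : gram_sum c u v =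
  (fun M => (gram_sum c u v M - gram_tri c u v M) + gram_tri c u v M).
  by apply/funext => M; rewrite subrK.
apply: is_cvgD; last exact: gram_tri_cvg c0 hu hv.
by apply/cvg_ex; exists 0; exact: gram_sub_cvg c0 hu hv.
Qed.

End DoubleSum.

(** * Eigenfunctions of the sinc operator *)

Section Eigen.
Variable R : realType.
Notation mu := (@lebesgue_measure R).
Notation D := (@seg R).

Lemma mu11_integral (f : R -> \bar R) :
  (\int[mu11 R]_(x in D) f x = \int[mu]_(x in D) f x)%E.
Proof.
apply: eq_measure_integral => A mA AD; rewrite /mu11 /= /mrestr setIidl //.
Qed.

Lemma mu11_integrable (f : R -> R) :
  (mu11 R).-integrable setT (EFin \o f) -> seg_integrable f.
Proof.
move=> h; have := integrableS measurableT (@measurable_seg R) (@subsetT _ _) h.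
move=> /integrableP[mf hf]; apply/integrableP; split => //.
by rewrite -mu11_integral.
Qed.

Lemma mu11_Lfun2 (f : R -> R) : f \in Lfun (mu11 R) 2%:E -> sqint f.
Proof.
move=> hf; split; last exact: mu11_integrable (Lfun2_integrable_sqr hf).
move: hf; rewrite inE => /andP[/[!inE]/= mf _].
exact: measurable_funTS.
Qed.

Lemma mu11_ae (P : R -> Prop) : {ae mu11 R, forall x, P x} -> {ae mu, forall x, D x -> P x}.
Proof.
move=> [A [mA A0 hA]]; exists (A `&` D); split => //.
  by apply: measurableI => //; exact: measurable_seg.
by move=> x /= /not_implyP[Dx nP]; split => //; apply: hA.
Qed.

Lemma ae_mu11 (P : R -> Prop) : {ae mu, forall x, D x -> P x} -> {ae mu11 R, forall x, P x}.
Proof.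
move=> [A [mA A0 hA]]; exists (A `|` ~` D); split.
- by apply: measurableU => //; apply: measurableC; exact: measurable_seg.
- rewrite /mu11 /= /mrestr setIUl setICl setU0.
  apply/eqP; rewrite -measure_le0 -A0; apply: le_measure; rewrite ?inE //.
  by apply: measurableI => //; exact: measurable_seg.
- move=> x /= nP; have [Dx|nD] := pselect (D x); last by right.
  by left; apply: hA => /= h; apply: nP; exact: h.
Qed.

Lemma sqint_pos (f : R -> R) : sqint f -> ~ ae_eq (mu11 R) setT f (cst 0) ->
  0 < Iseg (fun x => f x ^+ 2).
Proof.
move=> [mf hf] nz; rewrite lt0r Iseg_ge0 ?andbT => [|x]; last exact: sqr_ge0.
apply/eqP => h0; apply: nz.
suff : {ae mu, forall x, D x -> f x = 0}.
  by move/ae_mu11 => h; apply: filterS h => x hx _.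
have h1 : (\int[mu]_(x in D) `|(EFin \o (fun x => (f x ^+ 2)%R)) x| = 0)%E.
  have := integrable_fin_num (@measurable_seg R) hf => /fineK.
  rewrite -/(Rintegral mu D (fun x => f x ^+ 2)) -/(Iseg (fun x => f x ^+ 2)) h0 => h1.
  rewrite [RHS]h1; apply: eq_integral => x _ /=.
  by rewrite ger0_norm // sqr_ge0.
have /ae_eq_integral_abs h2 : measurable_fun D (EFin \o (fun x => (f x ^+ 2)%R)).
  by case/integrableP: hf.
have := (h2 mu (@measurable_seg R)).1 h1; apply: filterS => x /= h Dx.
by have /= [/eqP] := h Dx; rewrite sqrf_eq0 => /eqP.
Qed.

Section Kernel.
Variable c : R.
Hypothesis c0 : 0 < c.

(** 2 sin z / z at z = c (x - y): the sinc kernel times 2 pi / c. *)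
Definition sker (x y : R) : R := 2 * sinc0 (c * (x - y)).
Definition spoly (M : nat) (x y : R) : R := \sum_(p < M) 2 * sinc_term p (c * (x - y)).

Lemma cdist_le x y : D x -> D y -> `|c * (x - y)| <= 2 * c.
Proof.
move=> /seg_norm_le1 hx /seg_norm_le1 hy; rewrite normrM (ger0_norm (ltW c0)) mulrC.
apply: ler_wpM2r; first exact: ltW.
by apply: le_trans (ler_normB _ _) _; lra.
Qed.

Lemma sker_spoly x y M : D x -> D y ->
  `|spoly M x y - sker x y| <= 2 * exp_tail (2 * c) M.
Proof.
move=> hx hy; rewrite /spoly /sker -mulr_sumr -mulrBr normrM ger0_norm //.
by apply: ler_wpM2l => //; rewrite distrC; apply: sinc0_tail; exact: cdist_le.
Qed.

Lemma sker_kernel x y : sker x y = 2 * pi / c * sinc_kernel c x y.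
Proof.
have p0 : (pi : R) != 0 by rewrite gt_eqF // pi_gt0.
rewrite sinc_kernelE ?gt_eqF // /sker.
by move: p0; move: (pi : R) => P p0; field; rewrite p0 gt_eqF.
Qed.

Lemma spolyE M x y : spoly M x y =
  \sum_(p < M) \sum_(m < p.+1) cas_coeff c m * cas_coeff c (p - m) * xmom R p * x ^+ m * y ^+ (p - m).
Proof. by apply: eq_bigr => p _; rewrite cas_coeff_binomial. Qed.

Lemma spoly_cont M x : continuous (spoly M x).
Proof.
have -> : spoly M x = (fun y => \sum_(p < M) \sum_(m < p.+1)
   cas_coeff c m * cas_coeff c (p - m) * xmom R p * x ^+ m * y ^+ (p - m)).
  by apply/funext => y; exact: spolyE.
move=> y; apply: cvg_big => [|p _]; first exact: add_continuous.
apply: cvg_big => [|m _]; first exact: add_continuous.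
by apply: cvgM; [exact: cvg_cst | exact: cont_exp].
Qed.

Lemma sker_meas x : measurable_fun D (sker x).
Proof.
apply: (@measurable_fun_cvg _ _ _ D (fun M => spoly M x)).
  by move=> M; apply: cont_meas; exact: spoly_cont.
move=> y _; rewrite /spoly /sker.
under eq_fun do rewrite -mulr_sumr.
by apply: cvgM; [exact: cvg_cst | exact: sinc_term_cvg].
Qed.

Lemma sker_bound x y : D x -> D y -> `|sker x y| <= 2 * expR (2 * c).
Proof.
move=> hx hy; have := sker_spoly 0 hx hy.
by rewrite /spoly /exp_tail !big_ord0 subr0 sub0r normrN.
Qed.

Lemma sker_intg x f : D x -> seg_integrable f -> seg_integrable (fun y => f y * sker x y).
Proof.
move=> hx hf; apply: (seg_integrable_dom (g := fun y => f y * (2 * expR (2 * c)))).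
- by apply: measurable_funM; [exact: seg_integrable_meas | exact: sker_meas].
- exact: seg_integrable_Zr.
- move=> y hy; rewrite [leLHS]normrM [leRHS]normrM; apply: ler_wpM2l => //.
  by rewrite [leRHS]ger0_norm ?sker_bound // mulr_ge0 // expR_ge0.
Qed.

Lemma sinc_op_sker f x : D x -> seg_integrable f ->
  2 * pi / c * sinc_op c f x = Iseg (fun y => f y * sker x y).
Proof.
move=> hx hf; rewrite /sinc_op.
have -> : (fun y => sinc_kernel c x y * f y) = (fun y => (2 * pi / c)^-1 * (f y * sker x y)).
  apply/funext => y; rewrite sker_kernel [f y * _]mulrC mulrA mulrA mulVf ?mul1r //.
  by rewrite !mulf_neq0 ?invr_neq0 ?gt_eqF // pi_gt0.
rewrite -/(Iseg (fun y => (2 * pi / c)^-1 * (f y * sker x y))).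
rewrite Iseg_Zl; last exact: sker_intg.
by rewrite mulVKf // !mulf_neq0 ?invr_neq0 ?gt_eqF // pi_gt0.
Qed.

(** The image of [f] under the truncated kernel, a polynomial. *)
Definition sapprox (f : R -> R) (M : nat) (x : R) : R :=
  \sum_(p < M) \sum_(m < p.+1) cas_coeff c m * cas_coeff c (p - m) * xmom R p * mom f (p - m) * x ^+ m.

Lemma sapproxE f M x : seg_integrable f -> sapprox f M x = Iseg (fun y => f y * spoly M x y).
Proof.
move=> hf; rewrite /sapprox.
have hfx k : seg_integrable (fun y => f y * y ^+ k) by apply: seg_integrableM_cont => //; exact: cont_exp.
have e y : f y * spoly M x y = \sum_(p < M) \sum_(m < p.+1)
   (cas_coeff c m * cas_coeff c (p - m) * xmom R p * x ^+ m) * (f y * y ^+ (p - m)).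
  rewrite spolyE mulr_sumr; apply: eq_bigr => p _; rewrite mulr_sumr.
  by apply: eq_bigr => m _; ring.
rewrite (Iseg_ext e) Iseg_sum; last first.
  by move=> p; apply: seg_integrable_sum => m; exact: seg_integrable_Zl.
apply: eq_bigr => p _; rewrite Iseg_sum; last by move=> m; exact: seg_integrable_Zl.
by apply: eq_bigr => m _; rewrite Iseg_Zl // -/(mom f (p - m)); ring.
Qed.

Lemma sapprox_cont f M : continuous (sapprox f M).
Proof.
move=> x; apply: cvg_big => [|p _]; first exact: add_continuous.
apply: cvg_big => [|m _]; first exact: add_continuous.
by apply: cvgM; [exact: cvg_cst | exact: cont_exp].
Qed.

Lemma sapprox_gram g f M : seg_integrable g ->
  Iseg (fun x => g x * sapprox f M x) = gram_tri c (mom g) (mom f) M.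
Proof.
move=> hg; have hgx k : seg_integrable (fun y => g y * y ^+ k).
  by apply: seg_integrableM_cont => //; exact: cont_exp.
have e x : g x * sapprox f M x = \sum_(p < M) \sum_(m < p.+1)
   (cas_coeff c m * cas_coeff c (p - m) * xmom R p * mom f (p - m)) * (g x * x ^+ m).
  rewrite /sapprox mulr_sumr; apply: eq_bigr => p _; rewrite mulr_sumr.
  by apply: eq_bigr => m _; ring.
rewrite (Iseg_ext e) Iseg_sum; last first.
  by move=> p; apply: seg_integrable_sum => m; exact: seg_integrable_Zl.
apply: eq_bigr => p _; rewrite Iseg_sum; last by move=> m; exact: seg_integrable_Zl.
by apply: eq_bigr => m _; rewrite Iseg_Zl // -/(mom g m); ring.
Qed.

Definition is_eigen (nu : R) (f : R -> R) : Prop :=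
  sqint f /\ {ae mu, forall x, D x -> sinc_op c f x = nu * f x}.

(** Uniform convergence of the kernels, integrated against [f]. *)
Lemma sapprox_eigen nu f M : is_eigen nu f ->
  {ae mu, forall x, D x ->
     `|sapprox f M x - 2 * pi / c * nu * f x| <= 2 * exp_tail (2 * c) M * Iseg (fun y => `|f y|)}.
Proof.
move=> [hf]; apply: filterS => x hx Dx.
have fi := sqint_integrable hf.
rewrite -mulrA -hx // sinc_op_sker // sapproxE //.
have h1 := sker_intg Dx fi.
have h2 : seg_integrable (fun y => f y * spoly M x y) by apply: seg_integrableM_cont => //; exact: spoly_cont.
have -> : Iseg (fun y => f y * spoly M x y) - Iseg (fun y => f y * sker x y) =
   Iseg (fun y => f y * spoly M x y - f y * sker x y).
  by rewrite /Iseg RintegralB //; exact: measurable_seg.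
have t0 : 0 <= 2 * exp_tail (2 * c) M.
  by apply: le_trans (sker_spoly M Dx Dx).
rewrite -Iseg_Zl; last exact: seg_integrable_abs.
apply: Iseg_le_ae.
- exact: seg_integrable_B.
- by apply: seg_integrable_Zl; exact: seg_integrable_abs.
- by move=> y _; rewrite mulr_ge0.
apply: aeW => y Dy; rewrite -mulrBr normrM mulrC; apply: ler_wpM2r => //.
exact: sker_spoly.
Qed.

(** The Gram sums of the cas series converge to the quadratic form of the
    operator with kernel [sker], which acts on [f] as multiplication by
    2 pi nu / c. *)
Lemma gram_eigen nu f g : is_eigen nu f -> sqint g ->
  gram_sum c (mom g) (mom f) @ \oo --> 2 * pi / c * nu * Iseg (fun x => g x * f x).
Proof.
move=> ef hg; have [hf _] := ef.
have fi := sqint_integrable hf; have gi := sqint_integrable hg.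
set K := 2 * pi / c * nu.
have htri : gram_tri c (mom g) (mom f) @ \oo --> K * Iseg (fun x => g x * f x).
  have bound M : `|gram_tri c (mom g) (mom f) M - K * Iseg (fun x => g x * f x)| <=
     2 * exp_tail (2 * c) M * Iseg (fun y => `|f y|) * Iseg (fun y => `|g y|).
    rewrite -sapprox_gram // -Iseg_Zl; last exact: sqint_mul.
    have h1 : seg_integrable (fun x => g x * sapprox f M x).
      by apply: seg_integrableM_cont => //; exact: sapprox_cont.
    have h2 : seg_integrable (fun x => K * (g x * f x)) by apply: seg_integrable_Zl; exact: sqint_mul.
    have -> : Iseg (fun x => g x * sapprox f M x) - Iseg (fun x => K * (g x * f x)) =
       Iseg (fun x => g x * sapprox f M x - K * (g x * f x)).
      by rewrite /Iseg RintegralB //; exact: measurable_seg.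
    have t0 : 0 <= 2 * exp_tail (2 * c) M * Iseg (fun y => `|f y|).
      apply: mulr_ge0; last exact: Iseg_ge0.
      have D0 : D 0 by rewrite /seg /= in_itv /=; lra.
      by apply: le_trans (sker_spoly M D0 D0).
    rewrite -Iseg_Zl; last exact: seg_integrable_abs.
    apply: Iseg_le_ae.
    - exact: seg_integrable_B.
    - by apply: seg_integrable_Zl; exact: seg_integrable_abs.
    - by move=> y _; rewrite mulr_ge0.
    have := sapprox_eigen M ef; apply: filterS => x hx Dx.
    have -> : g x * sapprox f M x - K * (g x * f x) = g x * (sapprox f M x - K * f x) by ring.
    by rewrite normrM mulrC; apply: ler_wpM2r => //; exact: hx.
  apply/cvgrPdist_le => e e0.
  have tc : (fun M => 2 * exp_tail (2 * c) M * Iseg (fun y => `|f y|) * Iseg (fun y => `|g y|)) @ \oo --> 0.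
    rewrite -[X in _ --> X](mul0r (Iseg (fun y => `|g y|))); apply: cvgM; last exact: cvg_cst.
    rewrite -[X in _ --> X](mul0r (Iseg (fun y => `|f y|))); apply: cvgM; last exact: cvg_cst.
    rewrite -[X in _ --> X](mulr0 2); apply: cvgM; first exact: cvg_cst.
    exact: exp_tail_cvg.
  have ev := cvgr_le _ tc _ e0.
  near=> M; rewrite distrC; apply: le_trans (bound M) _.
  by near: M; exact: ev.
have -> : gram_sum c (mom g) (mom f) = (fun M =>
   (gram_sum c (mom g) (mom f) M - gram_tri c (mom g) (mom f) M) + gram_tri c (mom g) (mom f) M).
  by apply/funext => M; rewrite subrK.
rewrite -[X in _ --> X]add0r; apply: cvgD => //.
apply: (gram_sub_cvg (Cu := Iseg (fun y => `|g y|)) (Cv := Iseg (fun y => `|f y|))).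
- exact: ltW.
- by move=> m; exact: mom_le.
- by move=> m; exact: mom_le.
Unshelve. all: by end_near.
Qed.

Lemma gram_sumC (u v : nat -> R) M : gram_sum c u v M = gram_sum c v u M.
Proof.
rewrite /gram_sum exchange_big /=; apply: eq_bigr => m _; apply: eq_bigr => l _.
by rewrite addnC; ring.
Qed.

(** The limit of a symmetric expression is symmetric. *)
Lemma eigen_orth nu1 nu2 f1 f2 : is_eigen nu1 f1 -> is_eigen nu2 f2 -> nu1 != nu2 ->
  Iseg (fun x => f1 x * f2 x) = 0.
Proof.
move=> h1 h2 ne.
have e1 := gram_eigen h1 h2.1; have e2 := gram_eigen h2 h1.1.
have e3 : 2 * pi / c * nu1 * Iseg (fun x => f2 x * f1 x) =
          2 * pi / c * nu2 * Iseg (fun x => f1 x * f2 x).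
  rewrite -(cvg_lim _ e1) // -(cvg_lim _ e2) //; congr (lim (_ @ \oo)).
  by apply/funext => M; exact: gram_sumC.
have e4 : Iseg (fun x => f2 x * f1 x) = Iseg (fun x => f1 x * f2 x).
  by apply: Iseg_ext => x; rewrite mulrC.
move/eqP: e3; rewrite e4 -subr_eq0 -mulrBl -mulrBr !mulf_eq0 subr_eq0 (negbTE ne) orbF.
have /negbTE -> : (pi : R) != 0 by rewrite gt_eqF // pi_gt0.
by rewrite invr_eq0 (gt_eqF c0) pnatr_eq0 /= => /eqP.
Qed.

Lemma eigenfunction nu : sinc_eigenvalue c nu ->
  exists f, is_eigen nu f /\ Iseg (fun x => f x ^+ 2) = 1.
Proof.
move=> [f [hL nz hae]].
have hf := mu11_Lfun2 hL; have fi := sqint_integrable hf.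
have pos := sqint_pos hf nz.
set a := (Num.sqrt (Iseg (fun x => f x ^+ 2)))^-1.
have a2 : a ^+ 2 * Iseg (fun x => f x ^+ 2) = 1.
  by rewrite /a exprVn sqr_sqrtr ?(ltW pos) // mulVf // gt_eqF.
exists (fun x => a * f x); split; last first.
  rewrite -[RHS]a2 -Iseg_Zl; last by case: hf.
  by apply: Iseg_ext => x; rewrite exprMn.
split.
  split; first by apply: measurable_funM => //; case: hf.
  have -> : (fun x => (a * f x) ^+ 2) = (fun x => a ^+ 2 * f x ^+ 2).
    by apply/funext => x; rewrite exprMn.
  by apply: seg_integrable_Zl; case: hf.
have h : {ae mu, forall x, D x -> sinc_op c f x = nu * f x}.
  by apply: mu11_ae; apply: filterS hae => x hx; exact: hx.
apply: filterS h => x hx Dx.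
have K0 : 2 * pi / c != 0 by rewrite !mulf_neq0 ?invr_neq0 ?gt_eqF // pi_gt0.
apply: (mulfI K0); rewrite sinc_op_sker //; last exact: seg_integrable_Zl.
have e y : a * f y * sker x y = a * (f y * sker x y) by exact: esym (mulrA _ _ _).
rewrite (Iseg_ext e) Iseg_Zl; last exact: sker_intg.
by rewrite -sinc_op_sker // hx //; ring.
Qed.

End Kernel.
End Eigen.

(** * Eigenvalues and determinants *)

(** [minor_sum_le] at y = c / 4, where the weights are the absolute values of the
    coefficients. *)
Lemma det_cas_le (R : realType) (K M : nat) (c : R) (A B TA TB : 'M[R]_(K, M))
    (CA CB : 'I_K -> R) :
  (0 < K)%N -> (K <= M)%N -> 0 < c -> 2 * c <= K%:R ->
  (forall b m, A b m = 2^-1 ^+ m * \sum_(k < M) (chebN m k)%:R * TA b k) ->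
  (forall b m, B b m = 2^-1 ^+ m * \sum_(k < M) (chebN m k)%:R * TB b k) ->
  (forall b k, `|TA b k| <= CA b) -> (forall b k, `|TB b k| <= CB b) ->
  `|\det (\matrix_(a, b) \sum_(m < M) cas_coeff c m * A a m * B b m)| <=
   minor_loss K (c / 4) * (\prod_b CA b) * (\prod_b CB b) * \prod_(k < K) expw (c / 4) k.
Proof.
move=> K0 KM c0 cK hA hB hTA hTB.
have F0 : 0 < (K`!%:R : R) by rewrite ltr0n fact_gt0.
have y0 : 0 < c / 4 by rewrite divr_gt0.
have yK : 8 * (c / 4) <= K%:R by move: cK; lra.
rewrite -(ler_pM2l F0); apply: le_trans (minor_sum_le K0 KM y0 yK hA hB hTA hTB).
have -> : 4 * (c / 4) = c by field.
rewrite -[X in X * _](ger0_norm (ltW F0)) -normrM.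
rewrite (cauchy_binet_ffun (fun m : 'I_M => cas_coeff c m)).
apply: (le_trans (ler_norm_sum _ _ _)); apply: ler_sum => phi _.
rewrite normrM [X in X * _]normrM normr_prod.
by under eq_bigr do rewrite norm_cas_coeff ?(ltW c0) //.
Qed.

Section Main.
Variables (R : realType) (c : R) (n N w : nat) (nu : 'I_n.+1 -> R)
  (f : 'I_n.+1 -> R -> R) (th : R).
Hypotheses (c0 : 0 < c) (N0 : (0 < N)%N) (wN : (w + N <= n.+1)%N).
Hypotheses (nu0 : forall i, 0 < nu i)
  (ef : forall i, is_eigen c (nu i) (f i))
  (orth : forall i j, Iseg (fun x => f i x * f j x) = (i == j)%:R).
Hypotheses (th0 : 0 <= th) (th1 : th <= 1) (cN : 2 * c <= (N + w)%:R).

Let s := @cheb_node R N.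
Let g i : R := 2 * pi / c * nu i.

Let hs j : `|s j| <= 1. Proof. exact: cos_max. Qed.
Let hts j : `|th * s j| <= 1.
Proof. by rewrite normrM ger0_norm // mulr_ile1. Qed.

Let g0 i : 0 < g i.
Proof. by rewrite mulr_gt0 // divr_gt0 // mulr_gt0 // pi_gt0. Qed.

Let fint i : seg_integrable (f i). Proof. by apply: sqint_integrable; case: (ef i). Qed.

Let fabs i : Iseg (fun x => `|f i x|) <= 2.
Proof.
have sf : sqint (f i) by case: (ef i).
apply: (le_trans (Iseg_abs_le_sqr sf ltr01)).
have -> : Iseg (fun x => f i x ^+ 2) = 1.
  by transitivity (Iseg (fun x => f i x * f i x)); [exact: Iseg_ext | rewrite orth eqxx].
lra.
Qed.

Let fmom i m : `|mom (f i) m| <= 2.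
Proof. exact: le_trans (mom_le m (fint i)) (fabs i). Qed.

(** The cas transforms of the eigenfunctions at the points th s_j. *)
Let Y : 'M[R]_(n.+1, N) := \matrix_(i, j) cas_series c (fun m => (th * s j) ^+ m * mom (f i) m).

Let Ycvg i j : (fun M => \sum_(m < M) cas_coeff c m * ((th * s j) ^+ m * mom (f i) m)) @ \oo --> Y i j.
Proof.
rewrite mxE; apply: (@cas_series_cvg _ _ 2) => [|m]; first exact: ltW.
rewrite normrM -[leRHS]mul1r; apply: ler_pM => //.
by rewrite normrX exprn_ile1.
Qed.

Section WithMinor.
Variables (X : 'M[R]_(w, n.+1)) (S : 'I_w -> 'I_n.+1).
Hypotheses (XY : X *m Y = 0) (XS : forall a i, X a (S i) = (a == i)%:R)
  (X1 : forall a k, `|X a k| <= 1).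

(** Combinations of eigenfunctions whose cas transform vanishes at these points. *)
Let e a x : R := \sum_k X a k * f k x.
Let v a m : R := \sum_k X a k * mom (f k) m.

Let eint a : seg_integrable (e a).
Proof. by apply: seg_integrable_sum => k; exact: seg_integrable_Zl. Qed.

Let emom a m : mom (e a) m = v a m.
Proof.
have ex x : e a x * x ^+ m = \sum_k X a k * (f k x * x ^+ m).
  by rewrite mulr_suml; apply: eq_bigr => k _; rewrite mulrA.
have fx k : seg_integrable (fun x => f k x * x ^+ m) by apply: seg_integrableM_cont => //; exact: cont_exp.
rewrite /mom (Iseg_ext ex) Iseg_sum; last by move=> k; exact: seg_integrable_Zl.
by apply: eq_bigr => k _; rewrite Iseg_Zl.
Qed.

Let eabs a : Iseg (fun x => `|e a x|) <= 2 * n.+1%:R.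
Proof.
apply: (@le_trans _ _ (Iseg (fun x => \sum_k `|f k x|))).
  apply: Iseg_le.
  - exact: seg_integrable_abs.
  - by apply: seg_integrable_sum => k; exact: seg_integrable_abs.
  move=> x _; apply: (le_trans (ler_norm_sum _ _ _)); apply: ler_sum => k _.
  by rewrite normrM ler_piMl.
rewrite Iseg_sum; last by move=> k; exact: seg_integrable_abs.
apply: (@le_trans _ _ (\sum_(k < n.+1) 2)); first by apply: ler_sum => k _.
by rewrite sumr_const card_ord [leRHS]mulr_natr.
Qed.

(** The truncated cas transform of f_(S i); the [S i] are the indices at which
    [X] has unit columns. *)
Let h M i x : R := \sum_(l < M) (cas_coeff c l * mom (f (S i)) l) * x ^+ l.

Let hcont M i : continuous (h M i).
Proof. move=> x; exact: (@cont_poly R M (fun l : 'I_M => cas_coeff c l * mom (f (S i)) l) x). Qed.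

Let hint M i : seg_integrable (h M i). Proof. exact: seg_integrable_cont. Qed.

Let hmom M i m : mom (h M i) m = \sum_(l < M) cas_coeff c l * mom (f (S i)) l * xmom R (l + m).
Proof.
have ex x : h M i x * x ^+ m = \sum_(l < M) (cas_coeff c l * mom (f (S i)) l) * x ^+ (l + m).
  by rewrite mulr_suml; apply: eq_bigr => l _; rewrite exprD mulrA.
rewrite /mom (Iseg_ext ex) Iseg_sum; last first.
  by move=> l; apply: seg_integrable_Zl; apply: seg_integrable_cont; exact: cont_exp.
by apply: eq_bigr => l _; rewrite Iseg_Zl //; apply: seg_integrable_cont; exact: cont_exp.
Qed.

Let h_pair M i (u : nat -> R) :
  \sum_(m < M) cas_coeff c m * mom (h M i) m * u m = gram_sum c u (mom (f (S i))) M.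
Proof.
apply: eq_bigr => m _; rewrite hmom mulr_sumr mulr_suml; apply: eq_bigr => l _.
by rewrite addnC; ring.
Qed.

Let hsq M i : Iseg (fun x => h M i x ^+ 2) = gram_sum c (mom (f (S i))) (mom (f (S i))) M.
Proof.
rewrite -h_pair.
have ex x : h M i x ^+ 2 = \sum_(m < M) (cas_coeff c m * mom (f (S i)) m) * (h M i x * x ^+ m).
  by rewrite expr2 {2}/h mulr_sumr; apply: eq_bigr => m _; ring.
have hx k : seg_integrable (fun x => h M i x * x ^+ k) by apply: seg_integrableM_cont => //; exact: cont_exp.
rewrite (Iseg_ext ex) Iseg_sum; last by move=> m; exact: seg_integrable_Zl.
by apply: eq_bigr => m _; rewrite Iseg_Zl // -/(mom (h M i) m); ring.
Qed.

Let gr M i := gram_sum c (mom (f (S i))) (mom (f (S i))) M.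
(** The norm of the cas transform of f_(S i). *)
Let rt i := Num.sqrt (g (S i)).

Let rt0 i : 0 < rt i. Proof. by rewrite sqrtr_gt0. Qed.

Let habs M i : Iseg (fun x => `|h M i x|) <= rt i + gr M i / (2 * rt i).
Proof. by rewrite /gr -hsq; apply: Iseg_abs_le_sqr => //; exact: cont_sqint. Qed.

Let gram_lim i k : gram_sum c (mom (f k)) (mom (f (S i))) @ \oo --> g (S i) * (k == S i)%:R.
Proof.
rewrite -orth; apply: gram_eigen => //.
by case: (ef k).
Qed.

Let A M : 'M[R]_(N + w, M) :=
  col_mx (\matrix_(j, m) (th * s j) ^+ m) (\matrix_(i, m) mom (h M i) m).
Let B M : 'M[R]_(N + w, M) :=
  col_mx (\matrix_(j, m) s j ^+ m) (\matrix_(a, m) v a m).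
Let TA M : 'M[R]_(N + w, M) :=
  col_mx (\matrix_(j, k) chebT k (th * s j)) (\matrix_(i, k) cmom (h M i) k).
Let TB M : 'M[R]_(N + w, M) :=
  col_mx (\matrix_(j, k) chebT k (s j)) (\matrix_(a, k) cmom (e a) k).
Let CA M (b : 'I_(N + w)) : R :=
  match fintype.split b with inl _ => 1 | inr i => rt i + gr M i / (2 * rt i) end.
Let CB (b : 'I_(N + w)) : R :=
  match fintype.split b with inl _ => 1 | inr _ => 2 * n.+1%:R end.

(** The functionals acting on s are the points th s_j and the functions [h M i];
    those acting on x are the points s_j and the functions [e a]. *)
Let P M : 'M[R]_(N + w) := \matrix_(a, b) \sum_(m < M) cas_coeff c m * A M a m * B M b m.

Let AE M (b : 'I_(N + w)) (m : 'I_M) : A M b m = 2^-1 ^+ m * \sum_(k < M) (chebN m k)%:R * TA M b k.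
Proof.
rewrite !mxE; under eq_bigr do rewrite mxE.
case: fintype.split => j; rewrite mxE; under eq_bigr do rewrite mxE.
  exact: expr_chebT.
by apply: mom_cheb.
Qed.

Let BE M (b : 'I_(N + w)) (m : 'I_M) : B M b m = 2^-1 ^+ m * \sum_(k < M) (chebN m k)%:R * TB M b k.
Proof.
rewrite !mxE; under eq_bigr do rewrite mxE.
case: fintype.split => j; rewrite mxE; under eq_bigr do rewrite mxE.
  exact: expr_chebT.
by rewrite -emom; apply: mom_cheb.
Qed.

Let P_le M : (N + w <= M)%N -> `|\det (P M)| <= minor_loss (N + w) (c / 4) *
   (\prod_i (rt i + gr M i / (2 * rt i))) * (2 * n.+1%:R) ^+ w *
   \prod_(k < N + w) expw (c / 4) k.
Proof.
move=> hM.
have hTA b k : `|TA M b k| <= CA M b.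
  rewrite /CA mxE; case: fintype.split => i; rewrite mxE; first exact: chebT_norm_le1.
  exact: le_trans (cmom_le _ (hint M i)) (habs M i).
have hTB b k : `|TB M b k| <= CB b.
  rewrite /CB mxE; case: fintype.split => i; rewrite mxE; first exact: chebT_norm_le1.
  exact: le_trans (cmom_le _ (eint i)) (eabs i).
have K0 : (0 < N + w)%N by rewrite addn_gt0 N0.
have := det_cas_le K0 hM c0 cN (@AE M) (@BE M) hTA hTB.
have -> : \prod_b CA M b = \prod_i (rt i + gr M i / (2 * rt i)).
  rewrite big_split_ord /= big1 ?mul1r => [|i _].
    by apply: eq_bigr => i _; rewrite /CA (unsplitK (inr i)).
  by rewrite /CA (unsplitK (inl i)).
have -> : \prod_b CB b = (2 * n.+1%:R) ^+ w.
  rewrite big_split_ord /= big1 ?mul1r => [|i _].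
    rewrite expr_prod_ord; apply: eq_bigr => i _.
    by rewrite /CB (unsplitK (inr i)).
  by rewrite /CB (unsplitK (inl i)).
by [].
Qed.

Let C : 'M[R]_(w, N) :=
  \matrix_(i, b) limn (gram_sum c (fun m => s b ^+ m) (mom (f (S i)))).
Let Gd : 'rV[R]_w := \row_i g (S i).
(** The upper right block vanishes by the choice of [X], and the lower right one
    is diagonal by orthogonality of the eigenfunctions. *)
Let Pinf : 'M[R]_(N + w) := block_mx (cas_nodes N c th) 0 C (diag_mx Gd).

Let P_cvg a b : (fun M => P M a b) @ \oo --> Pinf a b.
Proof.
have e1 M i (x : 'M[R]_(N, M)) (y : 'M[R]_(w, M)) m :
   (col_mx x y) i m = match fintype.split i with inl j => x j m | inr j => y j m end by rewrite mxE.
have PE M : P M a b = \sum_(m < M) cas_coeff c m *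
    (match fintype.split a with inl j => (th * s j) ^+ m | inr i => mom (h M i) m end) *
    (match fintype.split b with inl j => s j ^+ m | inr i => v i m end).
  rewrite mxE; apply: eq_bigr => m _; rewrite !e1.
  by case: (fintype.split a) => j; case: (fintype.split b) => i; rewrite !mxE.
rewrite (funext PE) /Pinf /block_mx mxE.
case: (fintype.split a) => i; rewrite mxE; case: (fintype.split b) => j; rewrite mxE.
- under eq_fun => M do under eq_bigr => m _ do rewrite -mulrA -exprMn.
  apply: (@cas_series_cvg _ _ 1) => [|m]; first exact: ltW.
  by rewrite normrX exprn_ile1 // normrM mulr_ile1.
- have -> : (fun M => \sum_(m < M) cas_coeff c m * (th * s i) ^+ m * v j m) =
     (fun M => \sum_k X j k * \sum_(m < M) cas_coeff c m * ((th * s i) ^+ m * mom (f k) m)).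
    apply/funext => M; under [RHS]eq_bigr do rewrite mulr_sumr.
    rewrite exchange_big /=; apply: eq_bigr => m _.
    by rewrite mulr_sumr; apply: eq_bigr => k _; ring.
  have z : \sum_k X j k * Y k i = 0.
    by have := congr1 (fun Z : 'M[R]_(w, N) => Z j i) XY; rewrite !mxE.
  rewrite -[Z in _ --> Z]z.
  apply: cvg_big => [|k _]; first exact: add_continuous.
  by apply: cvgM; [exact: cvg_cst | exact: Ycvg].
- under eq_fun do rewrite (h_pair _ _ (fun m => s j ^+ m)).
  apply: (gram_sum_cvg (Cu := 1) (Cv := 2)) => [|m|m]; first exact: ltW.
    by rewrite normrX exprn_ile1.
  exact: fmom.
- under eq_fun do rewrite (h_pair _ _ (v j)).
  have -> : (fun M => gram_sum c (v j) (mom (f (S i))) M) =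
     (fun M => \sum_k X j k * gram_sum c (mom (f k)) (mom (f (S i))) M).
    apply/funext => M; under [RHS]eq_bigr do rewrite mulr_sumr.
    rewrite exchange_big /=; apply: eq_bigr => m _.
    under [RHS]eq_bigr do rewrite mulr_sumr.
    rewrite exchange_big /=; apply: eq_bigr => l _.
    by rewrite /v mulr_sumr mulr_suml; apply: eq_bigr => k _; ring.
  have -> : Gd 0 i *+ (i == j) = \sum_k X j k * (g (S i) * (k == S i)%:R).
    rewrite (bigD1 (S i)) //= eqxx mulr1 XS big1 ?addr0 => [|k /negbTE ->]; last first.
      by rewrite !mulr0.
    by rewrite mxE eq_sym; case: eqP; rewrite ?mul1r ?mul0r.
  apply: cvg_big => [|k _]; first exact: add_continuous.
  by apply: cvgM; [exact: cvg_cst | exact: gram_lim].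
Qed.

(** Dividing the rows of [h] by their norms [rt] would make every functional
    bounded; the determinant of the block triangular limit contains the squares
    of these norms, so one factor [rt] survives. *)
Lemma minor_ineq : `|\det (cas_nodes N c th)| * \prod_i Num.sqrt (g (S i)) <=
   minor_loss (N + w) (c / 4) * (4 * n.+1%:R) ^+ w * \prod_(k < N + w) expw (c / 4) k.
Proof.
have hdet : (fun M => `|\det (P M)|) @ \oo --> `|\det Pinf|.
  by apply: cvg_norm; apply: det_cvg; exact: P_cvg.
set RHS0 := fun M => minor_loss (N + w) (c / 4) *
   (\prod_i (rt i + gr M i / (2 * rt i))) * (2 * n.+1%:R) ^+ w *
   \prod_(k < N + w) expw (c / 4) k.
have hR : RHS0 @ \oo --> minor_loss (N + w) (c / 4) *
   (\prod_i (rt i + g (S i) / (2 * rt i))) * (2 * n.+1%:R) ^+ w *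
   \prod_(k < N + w) expw (c / 4) k.
  apply: cvgM; last exact: cvg_cst.
  apply: cvgM; last exact: cvg_cst.
  apply: cvgM; first exact: cvg_cst.
  apply: cvg_big => [|i _]; first exact: mul_continuous.
  apply: cvgD; first exact: cvg_cst.
  apply: cvgM; last exact: cvg_cst.
  by have := @gram_lim i (S i); rewrite eqxx mulr1.
have ineq : `|\det Pinf| <= minor_loss (N + w) (c / 4) *
   (\prod_i (rt i + g (S i) / (2 * rt i))) * (2 * n.+1%:R) ^+ w *
   \prod_(k < N + w) expw (c / 4) k.
  apply: (ler_cvg_to hdet hR); exists (N + w)%N => // M /= hM; exact: P_le.
have rtE i : rt i + g (S i) / (2 * rt i) = 3 / 2 * rt i.
  rewrite -{1}(sqr_sqrtr (ltW (g0 (S i)))) -/(rt i).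
  by field; rewrite gt_eqF.
have detE : `|\det Pinf| = `|\det (cas_nodes N c th)| * (\prod_i rt i) * \prod_i rt i.
  rewrite /Pinf det_lblock normrM det_diag normr_prod -mulrA; congr (_ * _).
  rewrite -big_split /=; apply: eq_bigr => i _.
  by rewrite mxE ger0_norm ?ltW // -expr2 sqr_sqrtr // ltW.
have prt : 0 < \prod_i rt i by apply: prodr_gt0 => i _.
rewrite -(ler_pM2r prt) -detE; apply: (le_trans ineq).
under eq_bigr do rewrite rtE.
have P0 : 0 <= \prod_(k < N + w) expw (c / 4) k.
  by apply: prodr_ge0 => k _; apply: expw_ge0; rewrite divr_ge0 // ltW.
rewrite [leRHS]mulrAC; apply: ler_wpM2r => //.
have := minor_loss_gt0 (N + w) (c / 4); move: (minor_loss _ _) => W W0.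
rewrite big_split /= -expr_prod_ord; move: prt; move: (\prod_i rt i) => q q0.
have -> : W * ((3 / 2) ^+ w * q) * (2 * n.+1%:R) ^+ w = W * q * ((3 / 2) * (2 * n.+1%:R)) ^+ w.
  by rewrite !exprMn; ring.
rewrite [leRHS]mulrAC; apply: ler_wpM2l; first by rewrite ltW // mulr_gt0.
rewrite lerXn2r ?nnegrE ?mulr_ge0 //.
by rewrite mulrA; apply: ler_wpM2r => //; lra.
Qed.

End WithMinor.

(** [kernel_max_minor] supplies the coefficients of the functions [e]. *)
Lemma block_det_ineq (gm : R) : 0 <= gm -> (forall i, gm <= g i) ->
  `|\det (cas_nodes N c th)| * Num.sqrt gm ^+ w <=
   minor_loss (N + w) (c / 4) * (4 * n.+1%:R) ^+ w * \prod_(k < N + w) expw (c / 4) k.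
Proof.
move=> gm0 hgm; have [X [S [XY XS X1]]] := kernel_max_minor Y wN.
apply: le_trans (minor_ineq XY XS X1).
apply: ler_wpM2l => //; rewrite expr_prod_ord; apply: ler_prod => i _.
by rewrite sqrtr_ge0 /= ler_wsqrtr.
Qed.

End Main.

(** * The inequality for an eigenvalue sequence *)

Lemma spectrum_lt (R : realType) (lambda : nat -> R) (i j : nat) :
  (forall n, lambda n.+1 < lambda n) -> (i < j)%N -> lambda j < lambda i.
Proof.
move=> dec; elim: j => // j IH; rewrite ltnS leq_eqVlt => /orP[/eqP -> //|/IH h].
exact: lt_trans (dec j) h.
Qed.

(** Comparison of the upper and the lower bound: the product over k < N cancels,
    and the last [w] factors remain. *)
Lemma spectrum_ineq (R : realType) (c delta rho : R) (lambda : nat -> R) (n N w D : nat) :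
  0 < c -> sinc_spectrum c lambda -> 0 < lambda n ->
  (0 < N)%N -> (N + w = n.+1)%N -> (0 < D)%N ->
  0 < delta -> delta <= 2^-1 -> 1 <= rho -> 2 * c * rho <= N%:R -> 
  2 * (minor_loss N (c * rho / 4) * (4 * expR 1 / delta) ^+ D) <= rho ^+ D ->
  (1 - delta) ^+ (\sum_(k < N) k) * Num.sqrt (2 * pi / c * lambda n) ^+ w <=
  4 * (4 * expR 1 / delta) ^+ D * (minor_loss n.+1 (c / 4) * (4 * n.+1%:R) ^+ w) *
    \prod_(j < w) expw (c / 4) (N + j).
Proof.
move=> c0 [dec spec] ln0 N0 Nw D0 d0 d1 rho1 hrho hD.
have ex i : exists f, is_eigen c (lambda i) f /\ Iseg (fun x => f x ^+ 2) = 1.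
  apply: eigenfunction => //.
  have : range lambda (lambda i) by exists i.
  by rewrite spec.
have [f hf] := choice ex.
have ef (i : 'I_n.+1) : is_eigen c (lambda i) (f i) by case: (hf i).
have orth (i j : 'I_n.+1) : Iseg (fun x => f i x * f j x) = (i == j)%:R.
  case: eqP => [->|ne].
    by rewrite -[RHS](hf j).2; apply: Iseg_ext => x; rewrite expr2.
  apply: (eigen_orth c0 (ef i) (ef j)).
  have [h|h|h] := ltngtP i j.
  - by rewrite gt_eqF // spectrum_lt.
  - by rewrite lt_eqF // spectrum_lt.
  - by case: ne; apply: val_inj.
have lge (i : 'I_n.+1) : lambda n <= lambda i.
  have := ltn_ord i; rewrite ltnS leq_eqVlt => /orP[/eqP -> //|h].
  exact: ltW (spectrum_lt dec h).
have nu0 (i : 'I_n.+1) : 0 < lambda i by apply: lt_le_trans (lge i).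
have h8 : 8 * (c * rho / 4) <= N%:R by have -> : 8 * (c * rho / 4) = 2 * c * rho by field.
have [th [th0 th1 low]] := det_cas_nodes_lower N0 c0 D0 d0 d1 rho1 h8 hD.
have cN : 2 * c <= (N + w)%:R.
  apply: (@le_trans _ _ (2 * c * rho)).
    by rewrite ler_peMr // ltW // mulr_gt0.
  by apply: (le_trans hrho); rewrite ler_nat leq_addr.
have wN : (w + N <= n.+1)%N by rewrite addnC Nw.
have K0 : 0 < 2 * pi / c by rewrite divr_gt0 // mulr_gt0 // pi_gt0.
have up := block_det_ineq c0 N0 wN nu0 ef orth th0 th1 cN (ltW (mulr_gt0 K0 ln0))
  (fun i => ler_wpM2l (ltW K0) (lge i)).
move: low up; rewrite Nw.
set L := (4 * expR 1 / delta) ^+ D.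
set sq := Num.sqrt _ ^+ w; set dt := `|_|.
have Pr0 : 0 < \prod_(k < N) expw (c / 4) k.
  by apply: prodr_gt0 => k _; rewrite expw_gt0 // divr_gt0.
have -> : \prod_(k < n.+1) expw (c / 4) k =
   \prod_(k < N) expw (c / 4) k * \prod_(j < w) expw (c / 4) (N + j).
  by rewrite -Nw big_split_ord.
move: Pr0; move: (\prod_(k < N) _) => P P0 low up.
have sq0 : 0 <= sq by rewrite exprn_ge0 // sqrtr_ge0.
have L0 : 0 <= 4 * L.
  by rewrite mulr_ge0 // exprn_ge0 // divr_ge0 ?(ltW d0) // mulr_ge0 // expR_ge0.
rewrite -(ler_pM2r P0).
have h1 := ler_wpM2r sq0 low.
have h2 := ler_wpM2l L0 up.
have e1 : 4 * L * (dt * sq) = 4 * L * dt * sq by rewrite mulrA.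
rewrite e1 in h2.
apply: (@le_trans _ _ ((1 - delta) ^+ (\sum_(k < N) k) * P * sq)).
  by rewrite mulrAC.
apply: le_trans h1 (le_trans h2 _).
by rewrite le_eqVlt; apply/orP; left; apply/eqP; ring.
Qed.

(** A crude bound, for the finitely many small indices. *)
Lemma eigenvalue_le (R : realType) (c nu : R) : 0 < c -> sinc_eigenvalue c nu ->
  nu <= 2 * c * expR (2 * c).
Proof.
move=> c0 /(eigenfunction c0)[f [ef f1]].
have sf := ef.1; have fi := sqint_integrable sf.
have fabs : Iseg (fun x => `|f x|) <= 2.
  by apply: (le_trans (Iseg_abs_le_sqr sf ltr01)); rewrite f1; lra.
have fm m : `|mom f m| <= 2 by exact: le_trans (mom_le m fi) fabs.
have hc := gram_eigen c0 ef sf.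
have e2 : Iseg (fun x => f x * f x) = 1 by rewrite -f1; apply: Iseg_ext => x; rewrite expr2.
rewrite e2 mulr1 in hc.
have bound M : gram_sum c (mom f) (mom f) M <= 8 * expR (2 * c).
  apply: le_trans (ler_norm _) _; apply: le_trans (ler_norm_sum _ _ _) _.
  apply: (@le_trans _ _ (\sum_(m < M) \sum_(l < M) 8 * (expw c m * expw c l))).
    apply: ler_sum => m _; apply: le_trans (ler_norm_sum _ _ _) _; apply: ler_sum => l _.
    apply: le_trans (gram_entry_le m l (ltW c0) fm fm) _.
    by apply: ler_wpM2r; [rewrite mulr_ge0 ?expw_ge0 // ltW | lra].
  under eq_bigr do rewrite -mulr_sumr -mulr_sumr mulrA.
  rewrite -mulr_suml -mulr_sumr -mulrA; apply: ler_wpM2l => //.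
  have -> : 2 * c = c + c by ring.
  rewrite expRD; have h := sum_expw_le M (ltW c0).
  by apply: ler_pM => //; apply: sumr_ge0 => i _; apply: expw_ge0; exact: ltW.
have h : 2 * pi / c * nu <= 8 * expR (2 * c).
  rewrite -(cvg_lim _ hc) //; apply: limr_le; first by apply/cvg_ex; eexists; exact: hc.
  exact: nearW.
have [nu0|nu0] := leP nu 0.
  by apply: le_trans nu0 _; rewrite !mulr_ge0 ?expR_ge0 // ltW.
have h2 : 4 * nu <= 2 * pi * nu.
  by apply: ler_wpM2r; [exact: ltW | have := @pi_ge2 R; lra].
have h3 : 2 * pi * nu <= c * (8 * expR (2 * c)).
  have := ler_wpM2l (ltW c0) h; congr (_ <= _).
  by move: (pi : R) => P; field; rewrite gt_eqF.
by move: h2 h3; move: (expR _) (2 * pi * nu) => E z; lra.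
Qed.

(** Each quotient of consecutive terms is (k + 1) / y <= n / y. *)
Lemma expw_ratio (R : realType) (y q : R) (n j : nat) : 0 < y -> 1 <= q -> n%:R / y <= q ->
  (j <= n)%N -> expw y (n - j) <= expw y n * q ^+ j.
Proof.
move=> y0 q1 hq; have q0 : 0 < q by apply: lt_le_trans q1.
elim: j => [|j IH] jn; first by rewrite subn0 expr0 mulr1.
apply: (@le_trans _ _ (expw y (n - j) * q)); last first.
  by rewrite exprSr mulrA; apply: ler_wpM2r; [exact: ltW | apply: IH; exact: ltnW].
have -> : (n - j = (n - j.+1).+1)%N by lia.
set k := (n - j.+1)%N; rewrite expwS -mulrA ler_peMr //; first by rewrite expw_ge0 // ltW.
rewrite -(ler_pM2l (_ : 0 < k.+1%:R / y)); last by rewrite divr_gt0.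
rewrite mulr1 mulrA; have -> : k.+1%:R / y * (y / k.+1%:R) = 1 :> R.
  by field; rewrite nat1r !gt_eqF.
rewrite mul1r; apply: (le_trans _ hq); apply: ler_wpM2r; first by rewrite invr_ge0 ltW.
by rewrite ler_nat /k; lia.
Qed.

Lemma prod_expw_window (R : realType) (y q : R) (n N w : nat) : 0 < y -> 1 <= q ->
  n%:R / y <= q -> (N + w = n.+1)%N ->
  \prod_(j < w) expw y (N + j) <= expw y n ^+ w * q ^+ (w * w).
Proof.
move=> y0 q1 hq Nw.
rewrite exprM -exprMn expr_prod_ord; apply: ler_prod => j _.
rewrite (expw_ge0 _ (ltW y0)) /=.
have jw := ltn_ord j.
have -> : (N + j = n - (n - (N + j)))%N by lia.
apply: le_trans (expw_ratio y0 q1 hq (leq_subr _ _)) _.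
apply: ler_wpM2l; first by rewrite expw_ge0 // ltW.
by apply: ler_weXn2l => //; lia.
Qed.

(** * Size of the losses *)

Section Asymptotics.
Variable R : realType.

Lemma le_expR_id (x : R) : x <= expR x.
Proof. by apply: le_trans (expR_ge1Dx x); rewrite lerDr. Qed.

Lemma expR1_ge2 : 2 <= expR 1 :> R.
Proof. exact: (expR_ge1Dx (1 : R)). Qed.

Lemma minor_loss_le (K : nat) (y a : R) : 8 * K.+2%:R ^+ 4 <= expR a ->
  minor_loss K y <= expR (2 + K%:R * (a + 17 * y)).
Proof.
move=> h; rewrite /minor_loss (expRD 2 (K%:R * _)) (expRM_natl K (a + 17 * y)).
apply: ler_wpM2l; first exact: expR_ge0.
have h0 : 0 <= 8 * K.+2%:R ^+ 4 :> R by rewrite mulr_ge0 // exprn_ge0.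
rewrite lerXn2r ?nnegrE ?(mulr_ge0 h0) ?expR_ge0 //.
by rewrite (expRD a (17 * y)); apply: ler_wpM2r => //; exact: expR_ge0.
Qed.

Lemma one_sub_ge_exp (d : R) : 0 <= d -> d <= 2^-1 -> expR (- (2 * d)) <= 1 - d.
Proof.
move=> d0 d1; rewrite expRN -[leLHS]mul1r ler_pdivrMr ?expR_gt0 //.
have h : 0 <= 1 - d by lra.
by apply: le_trans (ler_wpM2l h (expR_ge1Dx (2 * d))); nra.
Qed.

Lemma nat_ceil (x : R) : 0 <= x -> exists D : nat, [/\ (0 < D)%N, x <= D%:R & D%:R <= x + 1].
Proof.
move=> x0; exists (Num.truncn x).+1; split=> //.
- by rewrite ltW // truncnS_gt.
- by rewrite -natr1 lerD2r truncn_le.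
Qed.

Lemma succ_le_double (t : nat) : (2 <= t)%N -> (t.+1 <= 2 * t)%N.
Proof. lia. Qed.

Lemma window_sub_le (N w n : nat) : (0 < w)%N -> (N + w = n.+1)%N -> (N <= n)%N.
Proof. lia. Qed.

Section LargeDegree.
Variables (m M eta : R) (n t : nat) (c : R) (lambda : nat -> R).
Hypotheses (m0 : 0 < m) (M0 : 0 < M).
Hypotheses (t2 : (2 <= t)%N) (tn : (t ^ 14 <= n)%N) (nt : (n < t.+1 ^ 14)%N).
Hypotheses (spec : sinc_spectrum c lambda) (mc : m <= c)
  (cM : c <= M * Num.sqrt n%:R) (ln0 : 0 < lambda n).

Let T : R := t%:R.
Let nR : R := n%:R.
Let B : R := 2 ^+ 14.
Let E2 : R := expR 1 * expR 1.
Let KM : R := 2 ^+ 7 * M.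
Let C1 : R := 4 + 118 + 17 * KM * E2.
Let K : R := 2 * B + 2 + 5 * C1 + (238 + 34 * KM) + 30 + (4 / m + 28).

Hypotheses (tK : K <= eta * T) (tKM : 8 * KM * E2 <= T).

Let t0 : (0 < t)%N. Proof. exact: leq_trans t2. Qed.
Let T2 : 2 <= T. Proof. by rewrite /T ler_nat. Qed.
Let T1 : 1 <= T. Proof. by have := T2; lra. Qed.
Let T0 : 0 < T. Proof. by have := T2; lra. Qed.
Let Tn : T ^+ 14 <= nR. Proof. by rewrite /T /nR -natrX ler_nat. Qed.
Let Tpow i j : (i <= j)%N -> T ^+ i <= T ^+ j.
Proof. by move=> h; apply: ler_weXn2l. Qed.
Let n2T : (n <= (2 * t) ^ 14)%N.
Proof. by apply: leq_trans (ltnW nt) _; rewrite leq_exp2r // succ_le_double. Qed.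
Let nB : nR <= B * T ^+ 14.
Proof. by rewrite /B -exprMn /nR /T -natrM -natrX ler_nat. Qed.
Let Tpow1 i : 1 <= T ^+ i. Proof. exact: exprn_ege1. Qed.
Let n1 : 1 <= nR. Proof. exact: le_trans (Tpow1 14) Tn. Qed.
Let c0 : 0 < c. Proof. exact: lt_le_trans mc. Qed.
Let KM0 : 0 < KM. Proof. by rewrite mulr_gt0 // exprn_gt0. Qed.
Let E20 : 0 < E2. Proof. by rewrite mulr_gt0 // expR_gt0. Qed.

Let cT : c <= KM * T ^+ 7.
Proof.
apply: (le_trans cM); have -> : KM * T ^+ 7 = M * (2 ^+ 7 * T ^+ 7) by rewrite /KM; ring.
apply: ler_wpM2l; first exact: ltW.
have h : 0 <= 2 ^+ 7 * T ^+ 7 by rewrite mulr_ge0 ?exprn_ge0 // ltW.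
rewrite -[leRHS](ger0_norm h) -sqrtr_sqr; apply: ler_wsqrtr.
rewrite exprMn -!exprM; exact: nB.
Qed.

Let twn : (t ^ 12 <= n)%N.
Proof. by apply: leq_trans tn; exact: leq_pexp2l. Qed.

Let w : nat := (t ^ 12)%N.
Let N : nat := (n.+1 - w)%N.
Let Nw : (N + w = n.+1)%N. Proof. by rewrite subnK //; exact: leqW. Qed.
Let N0 : (0 < N)%N. Proof. by rewrite subn_gt0 ltnS. Qed.
Let w0 : (0 < w)%N. Proof. by rewrite expn_gt0 t0. Qed.
Let Nn : (N <= n)%N. Proof. exact: window_sub_le w0 Nw. Qed.
Let wE : w%:R = T ^+ 12 :> R. Proof. by rewrite /w natrX. Qed.

(* The exponents balance the losses: delta n / w, c / (delta w) and w / n are all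
   at most 1 / T^2 up to constants, against logarithms bounded by T. *)
Let delta : R := (T ^+ 3)^-1.
Let d0 : 0 < delta. Proof. by rewrite invr_gt0 exprn_gt0. Qed.
Let d1 : delta <= 2^-1.
Proof.
rewrite lef_pV2 ?posrE ?exprn_gt0 //; apply: (le_trans T2).
by rewrite -[leLHS]expr1; exact: Tpow.
Qed.

Let Lb : R := 4 * expR 1 / delta.
Let LbE : Lb = 4 * expR 1 * T ^+ 3. Proof. by rewrite /Lb invrK. Qed.
(* Lb^D bounds the weights; the extra factor e beats minor_loss once D >= x. *)
Let rho : R := expR 1 * Lb.
Let rhoE : rho = 4 * E2 * T ^+ 3. Proof. by rewrite /rho LbE /E2; ring. Qed.

Let e4 : 4 <= expR T.
Proof.
have h := expR1_ge2.
apply: (@le_trans _ _ (expR (1 + 1))); last by rewrite ler_expR; have := T2; lra.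
by rewrite expRD; nra.
Qed.

Let Te k : T ^+ k <= expR (k%:R * T).
Proof. by rewrite expRM_natl lerXn2r ?nnegrE ?expR_ge0 ?le_expR_id // ltW. Qed.

Let Lb_le : Lb <= expR (5 * T).
Proof.
rewrite LbE; have -> : 5 * T = T + T + 3%:R * T by ring.
have h1 : 0 <= 4 * expR 1 :> R by apply: mulr_ge0 => //; exact: expR_ge0.
have h2 : 0 <= T ^+ 3 by apply: exprn_ge0; exact: ltW.
have h3 : 4 * expR 1 <= expR T * expR T.
  by apply: ler_pM; rewrite ?expR_ge0 ?ler_expR.
rewrite (expRD (T + T)) (expRD T T).
exact: ler_pM h1 h2 h3 (Te 3).
Qed.

Let Lb1 : 1 <= Lb.
Proof.
have h := expR1_ge2; have h2 := Tpow1 3.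
by rewrite LbE; apply: (@le_trans _ _ (4 * expR 1)); [lra | rewrite ler_peMr //; lra].
Qed.

Let rho1 : 1 <= rho.
Proof. by have h := expR1_ge2; have h2 := Lb1; rewrite /rho; nra. Qed.

Let nE : n.+3%:R <= expR (29 * T) :> R.
Proof.
have h1 : n.+3%:R <= 4 * nR.
  by rewrite -[n.+3]addn3 natrD; have := n1; rewrite /nR; lra.
apply: (le_trans h1); have -> : 29 * T = T + 14%:R * (2 * T) by ring.
rewrite expRD (expRM_natl 14); apply: ler_pM => //.
apply: (@le_trans _ _ ((2 * T) ^+ 14)).
  by rewrite exprMn; exact: nB.
by rewrite lerXn2r ?nnegrE ?expR_ge0 ?le_expR_id // mulr_ge0 // ltW.
Qed.

Let fac_le k : (k <= n.+3)%N -> 8 * k%:R ^+ 4 <= expR (118 * T).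
Proof.
move=> hk; have -> : 118 * T = (T + T) + 4%:R * (29 * T) by ring.
rewrite (expRD (T + T)) (expRM_natl 4).
apply: ler_pM; rewrite ?exprn_ge0 //.
  by rewrite (expRD T T); have := e4; nra.
rewrite lerXn2r ?nnegrE ?expR_ge0 //; apply: le_trans nE.
by rewrite ler_nat.
Qed.

(** All losses are bounded by exponentials of multiples of [U], while n w is
    [T] times [U]. *)
Let U : R := nR * T ^+ 11.
Let U1 : 1 <= U.
Proof. by rewrite /U; have h1 := n1; have h2 := Tpow1 11; nra. Qed.

(** The exponent for which [minor_loss] at radius [rho] is at most half of
    exp x; the number of nodes [D] has to exceed it. *)
Let x : R := 3 + nR * (118 * T + 17 * (c * rho / 4)).

Let y_le : c * rho / 4 <= KM * E2 * T ^+ 10.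
Proof.
rewrite rhoE; have -> : c * (4 * E2 * T ^+ 3) / 4 = c * (E2 * T ^+ 3) by field.
have -> : KM * E2 * T ^+ 10 = KM * T ^+ 7 * (E2 * T ^+ 3) by ring.
by apply: ler_wpM2r cT; rewrite mulr_ge0 ?exprn_ge0 ?ltW.
Qed.

Let y0 : 0 <= c * rho / 4.
Proof. by rewrite divr_ge0 // mulr_ge0 ?(ltW c0) //; exact: le_trans rho1. Qed.

Let x0 : 0 <= x.
Proof.
have h1 := n1; have h2 := T0; have h3 := y0.
have h4 : 0 <= nR * (118 * T + 17 * (c * rho / 4)) by apply: mulr_ge0; lra.
rewrite /x; lra.
Qed.

Let x_le : x + 1 <= C1 * nR * T ^+ 10.
Proof.
have h1 : 118 * T + 17 * (c * rho / 4) <= (118 + 17 * KM * E2) * T ^+ 10.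
  have hT : T <= T ^+ 10 by rewrite -[leLHS]expr1; exact: Tpow.
  have -> : (118 + 17 * KM * E2) * T ^+ 10 = 118 * T ^+ 10 + 17 * (KM * E2 * T ^+ 10) by ring.
  by apply: lerD; apply: ler_wpM2l => //; exact: y_le.
have h2 : nR * (118 * T + 17 * (c * rho / 4)) <= nR * ((118 + 17 * KM * E2) * T ^+ 10).
  by apply: ler_wpM2l h1; have := n1; lra.
have h3 : 1 <= nR * T ^+ 10 by have h1' := n1; have h2' := Tpow1 10; nra.
have -> : C1 * nR * T ^+ 10 = 4 * (nR * T ^+ 10) + nR * ((118 + 17 * KM * E2) * T ^+ 10).
  by rewrite /C1; ring.
by rewrite /x; lra.
Qed.

Let growth_ok (D : nat) : x <= D%:R ->
  2 * (minor_loss N (c * rho / 4) * Lb ^+ D) <= rho ^+ D.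
Proof.
move=> xD.
have -> : rho ^+ D = expR 1 ^+ D * Lb ^+ D by exact: exprMn.
rewrite mulrA; apply: ler_wpM2r; first by rewrite exprn_ge0 // (le_trans _ Lb1).
have hN : (N.+2 <= n.+3)%N by rewrite !ltnS; apply: leqW; exact: Nn.
have h1 := minor_loss_le (c * rho / 4) (fac_le hN).
have h2 : N%:R * (118 * T + 17 * (c * rho / 4)) <= nR * (118 * T + 17 * (c * rho / 4)).
  apply: ler_wpM2r; last by rewrite ler_nat.
  by have := T0; have := y0; lra.
apply: (@le_trans _ _ (expR x)); last first.
  rewrite -expRM_natl mulr1 ler_expR; exact: xD.
have -> : x = 1 + (2 + nR * (118 * T + 17 * (c * rho / 4))) by rewrite /x; ring.
rewrite (expRD 1); apply: ler_pM => //; first exact: ltW (minor_loss_gt0 _ _).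
  exact: expR1_ge2.
by apply: le_trans h1 _; rewrite ler_expR lerD2l.
Qed.

Let c_rho_N : 2 * c * rho <= N%:R.
Proof.
have h1 : 2 * c * rho <= 8 * KM * E2 * T ^+ 10.
  have -> : 2 * c * rho = 8 * (c * rho / 4) by field.
  have -> : 8 * KM * E2 * T ^+ 10 = 8 * (KM * E2 * T ^+ 10) by ring.
  by apply: ler_wpM2l.
apply: (le_trans h1).
apply: (@le_trans _ _ (T ^+ 11)).
  rewrite [leRHS]exprS; apply: ler_wpM2r; last exact: tKM.
  by rewrite exprn_ge0 // ltW.
apply: (@le_trans _ _ (T ^+ 12)); first exact: Tpow.
have hN : nR + 1 = N%:R + T ^+ 12.
  by rewrite -wE -natrD Nw /nR -natr1.
have h14 : 2 * T ^+ 12 <= T ^+ 14.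
  have -> : T ^+ 14 = T ^+ 2 * T ^+ 12 by rewrite -exprD.
  by apply: ler_wpM2r; [rewrite exprn_ge0 // ltW | have := T2; nra].
by have := Tn; lra.
Qed.

Let q : R := 4 / m * nR + 1.
Let q1 : 1 <= q.
Proof. by rewrite lerDr mulr_ge0 ?divr_ge0 ?(ltW m0) // (le_trans _ n1). Qed.
Let nq : n%:R / (c / 4) <= q.
Proof.
have h : n%:R / (c / 4) = 4 / c * nR by rewrite /nR; field; rewrite gt_eqF.
rewrite h /q; apply: (@le_trans _ _ (4 / m * nR)); last by rewrite lerDl.
apply: ler_wpM2r; first exact: le_trans n1.
by apply: ler_wpM2l => //; rewrite lef_pV2.
Qed.

Let q_le : q <= expR ((4 / m + 28) * T).
Proof.
have m4 : 0 <= 4 / m by rewrite divr_ge0 // ltW.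
have h1 : q <= (1 + 4 / m) * nR by rewrite /q; have := n1; lra.
apply: (le_trans h1); rewrite [X in expR X]mulrDl expRD; apply: ler_pM.
- by rewrite addr_ge0.
- exact: le_trans n1.
- apply: le_trans (expR_ge1Dx _) _; rewrite ler_expR ler_peMr //.
- have -> : 28 * T = 14%:R * (2 * T) by ring.
  rewrite (expRM_natl 14); apply: (@le_trans _ _ ((2 * T) ^+ 14)).
    by rewrite exprMn; exact: nB.
  by rewrite lerXn2r ?nnegrE ?expR_ge0 ?le_expR_id // mulr_ge0 // ltW.
Qed.

Let n0 : 0 <= nR. Proof. exact: le_trans n1. Qed.

Let U0 : 0 <= U. Proof. exact: le_trans U1. Qed.

Let T_U i j : (i <= 14 + j)%N -> (j <= 11)%N -> T ^+ i <= U.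
Proof.
move=> h1 h2; apply: (@le_trans _ _ (T ^+ 14 * T ^+ j)).
  by rewrite -exprD; exact: Tpow.
by rewrite /U; apply: ler_pM; rewrite ?exprn_ge0 ?(ltW T0) //; exact: Tpow.
Qed.

(** Loss from the dilation by 1 - delta. *)
Let loss_dil : expR (- (2 * B * U)) <= (1 - delta) ^+ (\sum_(k < N) k).
Proof.
have k0 : (\sum_(k < N) k <= N * N)%N.
  rewrite -[X in (_ <= X * _)%N](card_ord N) -sum_nat_const.
  by apply: leq_sum => k _; exact: ltnW.
have d1' : 0 <= 1 - delta by rewrite subr_ge0; apply: le_trans d1 _; lra.
apply: (@le_trans _ _ (expR (- (2 * delta)) ^+ (\sum_(k < N) k))); last first.
  rewrite lerXn2r ?nnegrE ?expR_ge0 //.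
  by apply: one_sub_ge_exp; [exact: ltW | exact: d1].
rewrite -expRM_natl ler_expR mulrN lerN2.
have h1 : (\sum_(k < N) k)%:R <= nR * nR :> R.
  rewrite /nR -natrM ler_nat; apply: (leq_trans k0).
  by apply: leq_mul; exact: Nn.
apply: (@le_trans _ _ (nR * nR * (2 * delta))).
  by apply: ler_wpM2r => //; rewrite mulr_ge0 // ltW.
apply: (@le_trans _ _ (nR * (B * T ^+ 14) * (2 * delta))).
  apply: ler_wpM2r; first by rewrite mulr_ge0 // ltW.
  by apply: ler_wpM2l.
rewrite le_eqVlt; apply/orP; left; apply/eqP; rewrite /U /delta.
have -> : T ^+ 14 = T ^+ 11 * T ^+ 3 by rewrite -exprD.
by field; rewrite gt_eqF.
Qed.

(** Loss from the weights of [finite_remez]. *)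
Let loss_rem (D : nat) : D%:R <= x + 1 -> Lb ^+ D <= expR (5 * C1 * U).
Proof.
move=> hD; apply: (@le_trans _ _ (expR (5 * T) ^+ D)).
  by rewrite lerXn2r ?nnegrE ?expR_ge0 // (le_trans _ Lb1).
rewrite -expRM_natl ler_expR; have h := le_trans hD x_le.
apply: (@le_trans _ _ (C1 * nR * T ^+ 10 * (5 * T))).
  by apply: ler_wpM2r => //; rewrite mulr_ge0 // ltW.
by rewrite le_eqVlt; apply/orP; left; apply/eqP; rewrite /U; ring.
Qed.

(** Loss from the upper bound. *)
Let loss_up : minor_loss n.+1 (c / 4) <= expR ((2 + 236 + 34 * KM) * U).
Proof.
apply: le_trans (minor_loss_le _ (fac_le (leqnn _))) _; rewrite ler_expR.
have h2 : n.+1%:R <= 2 * nR by rewrite -natr1 -/nR; have := n1; lra.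
have h3 : 118 * T + 17 * (c / 4) <= (118 + 17 * KM) * T ^+ 11.
  have hT : T <= T ^+ 11 by rewrite -[leLHS]expr1; exact: Tpow.
  have h7 : KM * T ^+ 7 <= KM * T ^+ 11 by apply: ler_wpM2l; [exact: ltW | exact: Tpow].
  by move: cT c0 h7 hT; move: (T ^+ 7) (T ^+ 11) => a b; rewrite mulrDl; lra.
have h4 : 0 <= 118 * T + 17 * (c / 4) by have := T0; have := c0; lra.
have h5 : n.+1%:R * (118 * T + 17 * (c / 4)) <= 2 * nR * ((118 + 17 * KM) * T ^+ 11).
  exact: ler_pM.
have e5 : 2 * nR * ((118 + 17 * KM) * T ^+ 11) = (236 + 34 * KM) * U by rewrite /U; ring.
rewrite e5 in h5.
have -> : (2 + 236 + 34 * KM) * U = 2 * U + (236 + 34 * KM) * U by ring.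
by apply: lerD => //; have := U1; lra.
Qed.

(** Loss from the normalisation of the functions [e]. *)
Let loss_win : (4 * n.+1%:R) ^+ w <= expR (30 * U).
Proof.
have h : 4 * n.+1%:R <= expR (30 * T).
  have -> : 30 * T = T + 29 * T by ring.
  rewrite (expRD T (29 * T)); apply: ler_pM => //; apply: le_trans nE.
  by rewrite ler_nat ltnS leqW.
apply: (@le_trans _ _ (expR (30 * T) ^+ w)).
  by rewrite lerXn2r ?nnegrE ?expR_ge0 // mulr_ge0.
rewrite -expRM_natl ler_expR wE.
have -> : T ^+ 12 * (30 * T) = 30 * T ^+ 13 by ring.
by apply: ler_wpM2l => //; exact: (@T_U 13 0).
Qed.

(** Loss from replacing d_N, ..., d_n by d_n. *)
Let loss_idx : q ^+ (w * w) <= expR ((4 / m + 28) * U).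
Proof.
have m4 : 0 <= 4 / m + 28 by rewrite addr_ge0 // divr_ge0 // ltW.
apply: (@le_trans _ _ (expR ((4 / m + 28) * T) ^+ (w * w))).
  by rewrite lerXn2r ?nnegrE ?expR_ge0 // (le_trans _ q1).
rewrite -expRM_natl ler_expR natrM wE.
have -> : T ^+ 12 * T ^+ 12 * ((4 / m + 28) * T) = (4 / m + 28) * T ^+ 25 by ring.
by apply: ler_wpM2l => //; exact: (@T_U 25 11).
Qed.

Lemma sqrt_eigen_le :
  Num.sqrt (2 * pi / c * lambda n) <= expw (c / 4) n * expR (eta * nR).
Proof.
have [D [D0 xD Dx]] := nat_ceil x0.
have main := spectrum_ineq c0 spec ln0 N0 Nw D0 d0 d1 rho1 c_rho_N (growth_ok xD).
have c40 : 0 < c / 4 by rewrite divr_gt0.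
have hw := prod_expw_window c40 q1 nq Nw.
set sq := Num.sqrt _ in main *.
have sq0 : 0 <= sq by exact: sqrtr_ge0.
have dn0 : 0 <= expw (c / 4) n by rewrite expw_ge0 // ltW.
rewrite -(ler_pXn2r w0) ?nnegrE //; last by rewrite mulr_ge0 // expR_ge0.
have X0 : 0 < expR (- (2 * B * U)) by exact: expR_gt0.
rewrite -(ler_pM2l X0).
apply: (@le_trans _ _ ((1 - delta) ^+ (\sum_(k < N) k) * sq ^+ w)).
  by apply: ler_wpM2r loss_dil; rewrite exprn_ge0.
apply: (le_trans main).
have e4U : 4 <= expR (2 * U).
  by apply: (le_trans e4); rewrite ler_expR; have := @T_U 1 0 isT isT; rewrite expr1; have := U1; lra.
have LD0 : 0 <= Lb ^+ D by rewrite exprn_ge0 // (le_trans _ Lb1).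
have W0 := ltW (minor_loss_gt0 n.+1 (c / 4)).
have s1 : 4 * Lb ^+ D <= expR (2 * U) * expR (5 * C1 * U).
  by apply: ler_pM => //; exact: loss_rem.
have s2 : minor_loss n.+1 (c / 4) * (4 * n.+1%:R) ^+ w <=
   expR ((2 + 236 + 34 * KM) * U) * expR (30 * U).
  by apply: ler_pM => //; rewrite exprn_ge0 // mulr_ge0.
have s3 : \prod_(j < w) expw (c / 4) (N + j) <=
   expw (c / 4) n ^+ w * expR ((4 / m + 28) * U).
  by apply: (le_trans hw); apply: ler_wpM2l => //; rewrite exprn_ge0.
have p0 : 0 <= \prod_(j < w) expw (c / 4) (N + j).
  by apply: prodr_ge0 => j _; rewrite expw_ge0 // ltW.
have s12 : 4 * Lb ^+ D * (minor_loss n.+1 (c / 4) * (4 * n.+1%:R) ^+ w) <=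
  expR (2 * U) * expR (5 * C1 * U) * (expR ((2 + 236 + 34 * KM) * U) * expR (30 * U)).
  apply: ler_pM => //; first by rewrite mulr_ge0.
  by rewrite mulr_ge0 // exprn_ge0 // mulr_ge0.
have l0 : 0 <= 4 * Lb ^+ D * (minor_loss n.+1 (c / 4) * (4 * n.+1%:R) ^+ w).
  by rewrite mulr_ge0 // mulr_ge0 // exprn_ge0 // mulr_ge0.
apply: (le_trans (ler_pM l0 p0 s12 s3)).
have -> : (expw (c / 4) n * expR (eta * nR)) ^+ w = expw (c / 4) n ^+ w * expR (eta * nR) ^+ w.
  exact: exprMn.
rewrite [leRHS]mulrCA [leLHS]mulrCA; apply: ler_wpM2l; first by rewrite exprn_ge0.
rewrite -!expRD -(expRM_natl w) -expRD ler_expR wE.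
have KU : K * U <= eta * T * U by apply: ler_wpM2r.
have e1 : eta * T * U = T ^+ 12 * (eta * nR) by rewrite /U; ring.
rewrite e1 in KU.
apply: (@le_trans _ _ (- (2 * B * U) + K * U)); last by rewrite lerD2l.
by rewrite le_eqVlt; apply/orP; left; apply/eqP; rewrite /K; ring.
Qed.

End LargeDegree.
End Asymptotics.

(** * Conclusion *)

Definition target (R : realType) (n : nat) (c : R) : R :=
  (expR 1 * c / (4 * (n%:R + 1 / 2))) ^+ (2 * n + 1).

Lemma target_gt0 (R : realType) (n : nat) (c : R) : 0 < c -> 0 < target n c.
Proof.
move=> c0; have h : 0 < n%:R + 1 / 2 :> R by rewrite ltr_wpDl // divr_gt0.
by rewrite exprn_gt0 // divr_gt0 ?mulr_gt0 ?expR_gt0.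
Qed.

Lemma target_mono (R : realType) (n : nat) (c d : R) : 0 <= c -> c <= d ->
  target n c <= target n d.
Proof.
move=> c0 cd.
have h : 0 <= 4 * (n%:R + 1 / 2) :> R by rewrite mulr_ge0 // addr_ge0 // divr_ge0.
have e0 := expR_ge0 (1 : R).
rewrite /target lerXn2r ?nnegrE ?divr_ge0 ?mulr_ge0 // ?(le_trans c0) //.
by apply: ler_wpM2r; [rewrite invr_ge0 | exact: ler_wpM2l].
Qed.

(** n^n / n! <= e^n replaces the factorial, and (1 + 1 / (2 n))^(2 n) <= e the
    shift from n to n + 1/2; the missing factor c / n costs n + 1. *)
Lemma expw_sqr_le_target (R : realType) (n : nat) (c : R) : (0 < n)%N -> 0 < c ->
  c / (2 * pi) * expw (c / 4) n ^+ 2 <= (n%:R + 1) * target n c.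
Proof.
move=> n0 c0; set x : R := n%:R.
have x0 : 0 < x by rewrite ltr0n.
set r := expR 1 * c / (4 * (x + 1 / 2)).
have e0 : 0 < expR 1 :> R by exact: expR_gt0.
have xh : 0 < x + 1 / 2 by lra.
have r0 : 0 < r by rewrite divr_gt0 ?mulr_gt0.
have h1 : expw (c / 4) n <= (expR 1 * c / (4 * x)) ^+ n.
  have -> : expw (c / 4) n = (c / (4 * x)) ^+ n * expw x n.
    rewrite /expw mulrA -exprMn; congr (_ ^+ _ / _).
    by field; rewrite gt_eqF.
  have -> : (expR 1 * c / (4 * x)) ^+ n = (c / (4 * x)) ^+ n * expR x.
    have -> : expR x = expR 1 ^+ n by rewrite -expRM_natl mulr1.
    by rewrite -exprMn; congr (_ ^+ _); ring.
  apply: ler_wpM2l; first by rewrite exprn_ge0 // divr_ge0 ?ltW // mulr_gt0.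
  exact: expX_fact_le (ltW x0).
have h2 : expR 1 * c / (4 * x) = r * (1 + (2 * x)^-1).
  by rewrite /r; field; rewrite !gt_eqF //; lra.
have h3 : (1 + (2 * x)^-1) ^+ (2 * n) <= expR 1.
  have -> : expR 1 = expR ((2 * x)^-1) ^+ (2 * n) :> R.
    by rewrite -expRM_natl natrM -/x divff // mulf_neq0 // gt_eqF.
  have hx : 0 <= (2 * x)^-1 by rewrite invr_ge0 mulr_ge0 // ltW.
  by rewrite lerXn2r ?nnegrE ?expR_ge0 ?expR_ge1Dx // addr_ge0.
have d0 : 0 <= expw (c / 4) n by rewrite expw_ge0 // divr_ge0 // ltW.
have h4 : expw (c / 4) n ^+ 2 <= r ^+ (2 * n) * expR 1.
  apply: (@le_trans _ _ ((r * (1 + (2 * x)^-1)) ^+ (2 * n))).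
    rewrite mulnC exprM -h2 ler_sqr ?nnegrE //.
    by rewrite exprn_ge0 // divr_ge0 ?ltW // mulr_gt0.
  rewrite exprMn; apply: ler_wpM2l h3; by rewrite exprn_ge0 // ltW.
have p2 := @pi_ge2 R; have p0 := @pi_gt0 R.
have cp : 0 <= c / (2 * pi) by rewrite divr_ge0 ?mulr_ge0 ?ltW.
apply: (le_trans (ler_wpM2l cp h4)).
rewrite /target -/x -/r exprD expr1.
have -> : c / (2 * pi) * (r ^+ (2 * n) * expR 1) = r ^+ (2 * n) * (c * expR 1 / (2 * pi)).
  by move: (pi : R) => P; ring.
rewrite [leRHS]mulrCA; apply: ler_wpM2l; first by rewrite exprn_ge0 // ltW.
apply: (@le_trans _ _ (c * expR 1 / 4)).
  apply: ler_wpM2l; first by rewrite mulr_ge0 // ltW.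
  by rewrite lef_pV2 ?posrE ?mulr_gt0 //; lra.
have -> : (x + 1) * r = (c * expR 1 / 4) * ((x + 1) / (x + 1 / 2)).
  by rewrite /r; field; rewrite !gt_eqF //; lra.
rewrite ler_peMr //; first by rewrite !mulr_ge0 // ltW.
by rewrite ler_pdivlMr //; lra.
Qed.

Lemma root_window (n : nat) : exists t : nat, (t ^ 14 <= n)%N /\ (n < t.+1 ^ 14)%N.
Proof.
have ex0 : exists t : nat, (t ^ 14 <= n)%N by exists 0%N; rewrite exp0n.
have bd t : (t ^ 14 <= n)%N -> (t <= n)%N.
  apply: leq_trans; case: t => // t.
  by rewrite -[leqLHS]expn1 leq_pexp2l.
case: (ex_maxnP ex0 bd) => t h1 h2; exists t; split=> //.
by rewrite ltnNge; apply/negP => /h2; rewrite ltnn.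
Qed.

Theorem corollary1 (R : realType) (m M eps : R) :
  0 < m -> m < M -> 0 < eps ->
  exists A : R,
    forall (n : nat) (c : R) (lambda : nat -> R),
      sinc_spectrum c lambda ->
      m <= c -> c <= M * Num.sqrt (n%:R) ->
      lambda n <=
        A * expR (eps * n%:R)
          * (expR 1 * c / (4 * (n%:R + 1 / 2))) ^+ (2 * n + 1).
Proof.
move=> m0 mM eps0; have M0 := lt_trans m0 mM.
(* Two thirds of eps come from squaring the bound for the square root, one third
   absorbs the factor n + 1. *)
pose eta := eps / 3.
have eta0 : 0 < eta by rewrite divr_gt0.
pose KM : R := 2 ^+ 7 * M.
pose E2 : R := expR 1 * expR 1.
pose K : R := 2 * 2 ^+ 14 + 2 + 5 * (4 + 118 + 17 * KM * E2) + (238 + 34 * KM) + 30 +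
  (4 / m + 28).
have KM0 : 0 < KM by rewrite mulr_gt0 // exprn_gt0.
have E20 : 0 < E2 by rewrite mulr_gt0 // expR_gt0.
have ME0 : 0 < KM * E2 by exact: mulr_gt0.
have K0 : 0 < K.
  have h1 : 0 < 4 / m by rewrite divr_gt0.
  have h2 : 0 < 2 ^+ 14 :> R by rewrite exprn_gt0.
  rewrite /K -(mulrA 17); lra.
have Ke0 : 0 < K / eta by rewrite divr_gt0.
have [t0 [_ ht0 _]] : exists D : nat, [/\ (0 < D)%N, K / eta + 8 * (KM * E2) + 2 <= D%:R &
    D%:R <= (K / eta + 8 * (KM * E2) + 2) + 1] by apply: nat_ceil; lra.
(* An equation instead of a definition: the unary numeral t0 ^ 14 must stay folded. *)
have [n0 n0E] : exists n0, n0 = (t0 ^ 14)%N by eexists.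
pose c1 := M * Num.sqrt n0%:R.
pose Bd := 2 * c1 * expR (2 * c1).
pose A2 := \sum_(k < n0) Bd / target k m.
have c10 : 0 <= c1 by rewrite mulr_ge0 ?sqrtr_ge0 // ltW.
have Bd0 : 0 <= Bd.
  by apply: mulr_ge0; [exact: mulr_ge0 | exact: expR_ge0].
have A2i (k : 'I_n0) : 0 <= Bd / target k m by rewrite divr_ge0 // ltW // target_gt0.
have A20 : 0 <= A2 by apply: sumr_ge0 => k _.
have A10 : 0 <= 1 + eta^-1 by rewrite addr_ge0 // invr_ge0 ltW.
exists ((1 + eta^-1) + A2) => n c lambda spec mc cM.
have c0 : 0 < c by apply: lt_le_trans mc.
rewrite -/(target n c).
have tg0 := target_gt0 n c0.
have ee : 1 <= expR (eps * n%:R).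
  by apply: le_trans (expR_ge1Dx _); rewrite lerDl mulr_ge0 // ltW.
have [ln0|ln0] := leP (lambda n) 0.
  apply: le_trans ln0 _; rewrite !mulr_ge0 ?addr_ge0 ?expR_ge0 ?A20 ?(ltW tg0) //.
  by rewrite invr_ge0 ltW.
have npos : (0 < n)%N.
  rewrite lt0n; apply/eqP => n0'; move: cM; rewrite n0' sqrtr0 mulr0.
  by rewrite leNgt c0.
have [nn0|nn0] := ltnP n n0.
  have ev : sinc_eigenvalue c (lambda n).
    have : range lambda (lambda n) by exists n.
    by case: spec => _ ->.
  have cc1 : c <= c1.
    apply: (le_trans cM); apply: ler_wpM2l; first exact: ltW.
    by apply: ler_wsqrtr; rewrite ler_nat ltnW.
  have h1 : lambda n <= Bd.
    apply: (le_trans (eigenvalue_le c0 ev)); rewrite /Bd.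
    apply: ler_pM; rewrite ?expR_ge0 ?mulr_ge0 ?(ltW c0) //.
      exact: ler_wpM2l.
    by rewrite ler_expR; exact: ler_wpM2l.
  have h2 : Bd <= A2 * target n c.
    apply: (@le_trans _ _ (Bd / target n m * target n c)).
      rewrite mulrAC -mulrA ler_peMr // ler_pdivlMr ?target_gt0 // mul1r.
      exact: target_mono (ltW m0) mc.
    apply: ler_wpM2r; first exact: ltW.
    by rewrite /A2 (bigD1 (Ordinal nn0)) //= lerDl sumr_ge0.
  apply: (le_trans h1); apply: (le_trans h2); apply: ler_wpM2r; first exact: ltW.
  apply: (@le_trans _ _ (1 + eta^-1 + A2)); first by rewrite lerDr.
  by rewrite ler_peMr // addr_ge0.
have [t [tn nt]] := root_window n.
have tt0 : (t0 <= t)%N.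
  by move: nt; rewrite ltnNge; apply: contraNT; rewrite -ltnNge => h;
     apply: leq_trans nn0; rewrite n0E leq_exp2r.
have Tt : K / eta + 8 * (KM * E2) + 2 <= t%:R.
  by apply: (le_trans ht0); rewrite ler_nat.
have t2 : (2 <= t)%N.
  by rewrite -(ler_nat R); move: Tt Ke0 ME0; lra.
have tK : K <= eta * t%:R.
  by rewrite mulrC -ler_pdivrMr //; move: Tt Ke0 ME0; lra.
have tKM : 8 * KM * E2 <= t%:R by rewrite -mulrA; move: Tt Ke0 ME0; lra.
have main := sqrt_eigen_le m0 M0 t2 tn nt spec mc cM ln0 tK tKM.
set G := 2 * pi / c * lambda n in main.
have p0 := @pi_gt0 R.
have G0 : 0 < G by rewrite mulr_gt0 // divr_gt0 // mulr_gt0.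
have c40 : 0 <= c / 4 by rewrite divr_ge0 // ltW.
have hG : G <= (expw (c / 4) n * expR (eta * n%:R)) ^+ 2.
  rewrite -(sqr_sqrtr (ltW G0)) ler_sqr ?nnegrE ?sqrtr_ge0 //.
  by rewrite mulr_ge0 ?expR_ge0 // expw_ge0.
have lE : lambda n = c / (2 * pi) * G.
  rewrite /G; move: p0; move: (pi : R) => P P0.
  by field; rewrite !gt_eqF.
have cp : 0 <= c / (2 * pi) by rewrite divr_ge0 ?mulr_ge0 ?ltW.
have step1 : lambda n <= (n%:R + 1) * target n c * expR (eta * n%:R) ^+ 2.
  rewrite lE; apply: (le_trans (ler_wpM2l cp hG)).
  have -> : (expw (c / 4) n * expR (eta * n%:R)) ^+ 2 =
     expw (c / 4) n ^+ 2 * expR (eta * n%:R) ^+ 2 by exact: exprMn.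
  rewrite mulrA; apply: ler_wpM2r; first by rewrite exprn_ge0 // expR_ge0.
  exact: expw_sqr_le_target.
apply: (le_trans step1).
have step2 : n%:R + 1 <= (1 + eta^-1) * expR (eta * n%:R).
  apply: le_trans (ler_wpM2l A10 (expR_ge1Dx _)).
  have -> : (1 + eta^-1) * (1 + eta * n%:R) = 1 + eta * n%:R + eta^-1 + n%:R.
    by field; rewrite gt_eqF.
  have h1 : 0 <= eta * n%:R by rewrite mulr_ge0 // ltW.
  have h2 : 0 <= eta^-1 by rewrite invr_ge0 ltW.
  lra.
have e3 : expR (eps * n%:R) = expR (eta * n%:R) * expR (eta * n%:R) ^+ 2.
  by rewrite -exprS -expRM_natl; congr expR; rewrite /eta; field.
rewrite e3 [leLHS]mulrAC; apply: ler_wpM2r; first exact: ltW.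
rewrite mulrA; apply: ler_wpM2r; first by rewrite exprn_ge0 // expR_ge0.
apply: (le_trans step2); apply: ler_wpM2r; first exact: expR_ge0.
by rewrite lerDl.
Qed.
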